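(* Assume the following hypothesis: for every fixed $\epsilon>0$, $$\sum_{d\le x^{1-\epsilon}}\left|\pi(x;d,1)-\frac{\pi(x)}{\phi(d)}\right| = o(\pi(x)) \quad\text{as } x\to\infty.$$ Fix $U>1$ and an integer $k\ge 0$. If $y=x^{1/u}$ where $1\le u\le U$, then $$\Phi_k(x,y)\sim x\,\sigma_k(u)\quad\text{as } x\to\infty.$$ Moreover, for every $k\ge1$, $$\sigma_k(u)=\left(\frac{1+o(1)}{\log_k(u)\log_{k+1}(u)}\right)^u\quad\text{as } u\to\infty.$$
   Context: $\phi$ is Euler's function, $\phi_0(n)=n$ and $\phi_{k+1}(n)=\phi(\phi_k(n))$. $\pi(x)$ is the number of primes $\le x$ and $\pi(x;d,1)$ the number of primes $p\le x$ with $p\equiv1\pmod d$. Define $\Phi_k(x,y)=\#\{n\le x:\ p\mid\phi_k(n)\Rightarrow p\le y\}$ ($p$ prime). $\rho$ is the Dickman function: the unique continuous solution of $u\rho'(u)=-\rho(u-1)$ for $u\ge1$ with $\rho(u)=1$ for $0\le u\le1$; it satisfies $\rho(u)=((e+o(1))/(u\log u))^u$. The functions $\sigma_k$ are defined by $\sigma_0=\rho$, and for $k\ge0$, $\sigma_{k+1}(u)=1$ for $0\le u\le1$ and $u\sigma_{k+1}(u)=\int_0^u\sigma_{k+1}(u-t)\sigma_k(t)\,dt$ for $u\ge1$. $\log_k$ denotes the $k$-fold iterated logarithm $\log(\log(\cdots\log(u)\cdots))$. *)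

(* Defs.v *)
From Stdlib Require Import Reals.
From Coquelicot Require Import Coquelicot.
From mathcomp Require Import ssreflect ssrbool ssrfun eqtype ssrnat seq div prime.

Set Implicit Arguments.
Unset Strict Implicit.

Local Open Scope R_scope.

(* floor of a real, as a nat (0 for negative reals) *)
Definition nfloor (x : R) : nat := Z.to_nat (Int_part x).

Definition phi_iter (k n : nat) : nat := ssrnat.iter k totient n.

Definition prime_pi (x : R) : R :=
  INR (count (fun p => prime p) (iota 0 (nfloor x).+1)).

Definition prime_pi_ap (x : R) (d : nat) : R :=
  INR (count (fun p => prime p && (p == 1 %[mod d])%N) (iota 0 (nfloor x).+1)).

Definition rsum1 (N : nat) (f : nat -> R) : R := foldr Rplus 0 (map f (iota 1 N)).

Definition smooth_phi_k (k : nat) (y : R) (n : nat) : bool :=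
  all (fun p => if Rle_dec (INR p) y then true else false) (primes (phi_iter k n)).

Definition Phi_count (k : nat) (x y : R) : R :=
  INR (count (smooth_phi_k k y) (iota 1 (nfloor x))).

Definition logk (k : nat) (u : R) : R := ssrnat.iter k ln u.

Definition is_dickman (rho : R -> R) : Prop :=
  (forall u, 0 < u -> continuous rho u) /\
  (forall u, 0 <= u <= 1 -> rho u = 1) /\
  (forall u, 1 < u -> is_derive rho u (- rho (u - 1) / u)).

Definition is_sigma_family (rho : R -> R) (sigma : nat -> R -> R) : Prop :=
  (forall u, 0 <= u -> sigma 0%nat u = rho u) /\
  (forall k u, 0 < u -> continuous (sigma k) u) /\
  (forall k u, 0 <= u <= 1 -> sigma k.+1 u = 1) /\
  (forall k u, 1 <= u ->
     u * sigma k.+1 u = RInt (fun t => sigma k.+1 (u - t) * sigma k t) 0 u).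

Definition EH_hypothesis : Prop :=
  forall eps, 0 < eps ->
  forall delta, 0 < delta ->
  exists X, forall x, X <= x ->
    rsum1 (nfloor (Rpower x (1 - eps)))
      (fun d => Rabs (prime_pi_ap x d - prime_pi x / INR (totient d)))
    <= delta * prime_pi x.

(* Main.v *)
From Pilot Require Import Defs.
From Stdlib Require Import ZArith Reals Lra Lia.
From Coquelicot Require Import Coquelicot.
From mathcomp Require Import ssreflect ssrbool ssrfun eqtype ssrnat seq div prime.
From mathcomp Require Import binomial fintype bigop zify.
Import Pilot.Defs.

Set Implicit Arguments.
Unset Strict Implicit.

Local Open Scope R_scope.

(** Call a prime bad of level 0 if it exceeds [y], and [p] bad of level [k + 1] if [p - 1] has a
    bad prime factor of level [k].  Apart from the negligibly many [n] for which the square of a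
    prime above [y] divides some [phi_j(n)], [j < k], the number [phi_k(n)] is [y]-smooth exactly
    when [n] has no bad prime factor of level [k].

    Inclusion-exclusion over the products [d] of bad primes dividing [n] only involves
    [d <= x^(1-eps)] as soon as [n] has a prime factor in [(x^eps, x^(1/U)]], which by a second
    moment computation fails rarely.  Hence, under the hypothesis, shifted primes [p - 1] avoid
    bad primes of level [k] with the same density as integers do, and the primes near [y^t] that
    are good of level [k + 1] have relative density [sigma_k(t)].  The identity
    [sum f(n) log n = sum f(p) log p S(x/p) + O(x)] and Mertens' first theorem then turn the
    count of integers without bad factors into a perturbation of the equation defining
    [sigma_(k+1)], and this equation is stable.

    For the decay, the maximum and the minimum of [sigma_(k+1)(u) exp(s u)] are compared through
    the equation with the transform [H(s)] of [sigma_k] (the integral of [exp(s t) sigma_k(t)]),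
    which gives [sigma_(k+1)(u) = exp(- u (s + o(1)))] where [H(s) = u].  For [k = 0] the delay
    equation gives [H'/H = (exp s - 1)/s], so [log H(s) ~ exp s / s]; for [k >= 1] only
    [t = (log u)^(1+o(1))] matters in [H(s)]. *)

(** * Finite sums *)

(** The main term of the sieve is never evaluated: integers and shifted primes are both compared
    with one and the same Moebius sum truncated at [x^(1-eps)], and only the difference of the two
    counts is used. The obstacle is that the hypothesis is silent on moduli between [x^(1-eps)] and
    [x]. On the integers without a prime factor in [(x^eps, x^(1/U)]] the truncated sum can be wrong
    by a factor [2^K], where [K >= U] bounds the number of bad primes dividing one integer. This [K]
    does not depend on [eps], while the sum of [1/q] over that interval of primes tends to infinity
    as [eps] tends to 0; hence [eps] is fixed after [K] and the wanted precision.

    For the decay only a factor [exp(o(u))] has to be controlled, so a maximum principle at a single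
    well-chosen [s] replaces any inversion of the transform. The minimum principle has to be started
    on an initial segment [[0, T]], at a cost [exp(- O(T^2))]; this is harmless because [T] can be
    taken bounded by a power of [log u]. *)

Definition b2r (b : bool) : R := if b then 1 else 0.

Lemma b2r_ge0 b : 0 <= b2r b.
Proof. by case: b => /=; lra. Qed.

Lemma b2r_le1 b : b2r b <= 1.
Proof. by case: b => /=; lra. Qed.

Lemma b2r_and a b : b2r (a && b) = b2r a * b2r b.
Proof. by case: a; case: b => /=; ring. Qed.

Lemma b2r_imp (a b : bool) : (a -> b) -> b2r a <= b2r b.
Proof. by case: a; case: b => //= H; try lra; have := H isT. Qed.

Lemma foldr_Rplus_init a s : foldr Rplus a s = foldr Rplus 0 s + a.
Proof. by elim: s => [|x s IH] /=; [|rewrite IH]; ring. Qed.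

Lemma rsum10 f : rsum1 0 f = 0.
Proof. by []. Qed.

Lemma rsum1S N f : rsum1 N.+1 f = rsum1 N f + f N.+1.
Proof.
rewrite /rsum1 -(addn1 N) iotaD map_cat foldr_cat foldr_Rplus_init /=.
by rewrite add1n addn1 Rplus_0_r.
Qed.

Lemma rsum1_ext N f g :
  (forall i, (1 <= i <= N)%N -> f i = g i) -> rsum1 N f = rsum1 N g.
Proof.
elim: N => [|N IH] H //; rewrite !rsum1S IH ?H ?ltnSn //.
by move=> i Hi; apply: H; lia.
Qed.

Lemma rsum1_le N f g :
  (forall i, (1 <= i <= N)%N -> f i <= g i) -> rsum1 N f <= rsum1 N g.
Proof.
elim: N => [|N IH] H; first exact: Rle_refl.
rewrite !rsum1S; apply: Rplus_le_compat; last by apply: H; lia.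
by apply: IH => i Hi; apply: H; lia.
Qed.

Lemma rsum1_plus N f g : rsum1 N (fun i => f i + g i) = rsum1 N f + rsum1 N g.
Proof. by elim: N => [|N IH]; rewrite ?rsum1S ?IH ?rsum10; ring. Qed.

Lemma rsum1_minus N f g : rsum1 N (fun i => f i - g i) = rsum1 N f - rsum1 N g.
Proof. by elim: N => [|N IH]; rewrite ?rsum1S ?IH ?rsum10; ring. Qed.

Lemma rsum1_scal N c f : rsum1 N (fun i => c * f i) = c * rsum1 N f.
Proof. by elim: N => [|N IH]; rewrite ?rsum1S ?IH ?rsum10; ring. Qed.

Lemma rsum1_scalr N c f : rsum1 N (fun i => f i * c) = rsum1 N f * c.
Proof. by elim: N => [|N IH]; rewrite ?rsum1S ?IH ?rsum10; ring. Qed.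

Lemma rsum1_const N c : rsum1 N (fun=> c) = INR N * c.
Proof. by elim: N => [|N IH]; rewrite ?rsum1S ?IH ?rsum10 ?S_INR /=; ring. Qed.

Lemma rsum1_zero N f : (forall i, (1 <= i <= N)%N -> f i = 0) -> rsum1 N f = 0.
Proof. by move/rsum1_ext => ->; rewrite rsum1_const; ring. Qed.

Lemma rsum1_ge0 N f : (forall i, (1 <= i <= N)%N -> 0 <= f i) -> 0 <= rsum1 N f.
Proof.
move=> H; have <- : rsum1 N (fun=> 0) = 0 by apply: rsum1_zero.
exact: rsum1_le.
Qed.

Lemma rsum1_abs N f : Rabs (rsum1 N f) <= rsum1 N (fun i => Rabs (f i)).
Proof.
elim: N => [|N IH]; first by rewrite !rsum10 Rabs_R0; lra.
rewrite !rsum1S; apply: Rle_trans (Rabs_triang _ _) _; lra.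
Qed.

Lemma rsum1_swap N M (f : nat -> nat -> R) :
  rsum1 N (fun i => rsum1 M (f i)) = rsum1 M (fun j => rsum1 N (fun i => f i j)).
Proof.
elim: N => [|N IH]; first by rewrite rsum10 rsum1_zero.
by rewrite rsum1S IH -rsum1_plus; apply: rsum1_ext => j _; rewrite rsum1S.
Qed.

Lemma rsum1_mono N M f : (N <= M)%N ->
  (forall i, (1 <= i <= M)%N -> 0 <= f i) -> rsum1 N f <= rsum1 M f.
Proof.
elim: M => [|M IH]; first by rewrite leqn0 => /eqP ->; move=> _; apply: Rle_refl.
rewrite leq_eqVlt => /orP[/eqP ->|HN] H; first exact: Rle_refl.
rewrite rsum1S.
have H1 : 0 <= f M.+1 by apply: H; lia.
have : rsum1 N f <= rsum1 M f by apply: IH => // i Hi; apply: H; lia.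
lra.
Qed.

Lemma rsum1_extend N M f : (N <= M)%N ->
  (forall i, (N < i <= M)%N -> f i = 0) -> rsum1 M f = rsum1 N f.
Proof.
elim: M => [|M IH]; first by rewrite leqn0 => /eqP ->.
rewrite leq_eqVlt => /orP[/eqP ->|HN] H //.
rewrite rsum1S H; last by lia.
by rewrite Rplus_0_r IH // => i Hi; apply: H; lia.
Qed.

Lemma rsum1_trunc N M f : (N <= M)%N ->
  rsum1 N f = rsum1 M (fun i => b2r (i <= N)%N * f i).
Proof.
move=> H; rewrite (@rsum1_extend N M) //.
  by apply: rsum1_ext => i Hi; (have -> : (i <= N)%N by lia); rewrite /=; ring.
by move=> i Hi; (have -> : (i <= N)%N = false by lia); rewrite /=; ring.
Qed.

Lemma rsum1_ge_term N f i : (1 <= i <= N)%N ->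
  (forall j, (1 <= j <= N)%N -> 0 <= f j) -> f i <= rsum1 N f.
Proof.
move=> Hi H; apply: Rle_trans (rsum1_mono (N := i) _ H); last by lia.
case: i Hi => // i Hi; rewrite rsum1S.
have : 0 <= rsum1 i f by apply: rsum1_ge0 => j Hj; apply: H; lia.
lra.
Qed.

Lemma rsum1_single N i f : (1 <= i <= N)%N ->
  rsum1 N (fun j => b2r (j == i) * f j) = f i.
Proof.
move=> Hi; rewrite (@rsum1_extend i N); first last.
- by move=> j Hj; (have -> : (j == i) = false by lia); rewrite /=; ring.
- by lia.
case: i Hi => // i Hi; rewrite rsum1S eqxx rsum1_zero /=; first by ring.
by move=> j Hj; (have -> : (j == i.+1) = false by lia); rewrite /=; ring.
Qed.

Lemma rsum1_single_le N i f : 0 <= f i ->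
  rsum1 N (fun j => b2r (j == i) * f j) <= f i.
Proof.
move=> Hf; case: (boolP (1 <= i <= N)%N) => Hi; first by rewrite rsum1_single //; lra.
rewrite rsum1_zero // => j Hj; have -> : (j == i) = false by lia.
by rewrite /=; ring.
Qed.

Lemma count_rsum1 (P : pred nat) N :
  INR (count P (iota 1 N)) = rsum1 N (fun n => b2r (P n)).
Proof.
elim: N => [|N IH] //.
rewrite rsum1S -IH -(addn1 N) iotaD count_cat plus_INR /= add1n addn0 addn1.
by case: (P N.+1).
Qed.

Lemma rsum1_dvd d N f : (0 < d)%N ->
  rsum1 N (fun n => b2r (d %| n) * f n) = rsum1 (N %/ d) (fun m => f (d * m)%N).
Proof.
move=> Hd; elim: N => [|N IH]; first by rewrite div0n.
rewrite rsum1S IH divnS //.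
case: (boolP (d %| N.+1)) => H; last by rewrite add0n /=; ring.
rewrite add1n rsum1S Rmult_1_l; do 2 f_equal.
by move: H => /divnK; rewrite divnS //; lia.
Qed.

Lemma lt_0_INR1 n : (0 < n)%N -> 0 < INR n.
Proof. by move=> H; apply: lt_0_INR; lia. Qed.

Lemma INR_leq m n : (m <= n)%N -> INR m <= INR n.
Proof. by move=> H; apply: le_INR; lia. Qed.

Lemma INR_leq_inv m n : INR m <= INR n -> (m <= n)%N.
Proof. by move/INR_le; lia. Qed.

Lemma INR_ge1 n : (0 < n)%N -> 1 <= INR n.
Proof. by move=> H; have := @INR_leq 1 n H. Qed.

Lemma INR_muln m n : INR (m * n)%N = INR m * INR n.
Proof. by rewrite -mult_INR. Qed.

Lemma divn_le_INR N d : (0 < d)%N -> INR (N %/ d) <= INR N / INR d.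
Proof.
move=> Hd; have H := lt_0_INR1 Hd.
apply/Rle_div_r => //; rewrite -INR_muln; apply: INR_leq; exact: leq_trunc_div.
Qed.

Lemma divn_ge_INR N d : (0 < d)%N -> INR N / INR d - 1 <= INR (N %/ d).
Proof.
move=> Hd; have H := lt_0_INR1 Hd.
suff : INR N / INR d <= INR (N %/ d) + 1 by lra.
apply/Rle_div_l => //; rewrite -S_INR -INR_muln; apply: INR_leq.
have := ltn_ceil N Hd; lia.
Qed.

Lemma count_dvd d N : (0 < d)%N -> rsum1 N (fun n => b2r (d %| n)) = INR (N %/ d).
Proof.
move=> Hd; rewrite -[RHS]Rmult_1_r -rsum1_const -(rsum1_dvd N (fun=> 1) Hd).
by apply: rsum1_ext => i _; ring.
Qed.

Lemma count_dvd_le d N : (0 < d)%N ->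
  rsum1 N (fun n => b2r (d %| n)) <= INR N / INR d.
Proof. by move=> Hd; rewrite count_dvd //; exact: divn_le_INR. Qed.

Lemma ln_ge0 x : 1 <= x -> 0 <= ln x.
Proof. by move=> H; rewrite -ln_1; apply: ln_le; lra. Qed.

Lemma ln_le_sub1 x : 0 < x -> ln x <= x - 1.
Proof. by move=> H; have := exp_ineq1_le (ln x); rewrite exp_ln //; lra. Qed.

Lemma harmonic_le N : rsum1 N (fun n => / INR n) <= 1 + ln (INR N).
Proof.
elim: N => [|[|N] IH].
(* [ln] takes the value 0 at 0, so the bound also covers [N = 0]. *)
- have -> : ln (INR 0) = 0 by rewrite /ln /=; case: Rlt_dec => // H; exfalso; lra.
  by rewrite rsum10; lra.
- by rewrite rsum1S rsum10 /= ln_1; lra.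
rewrite rsum1S; set a := INR N.+1 in IH *.
have Ha : 0 < a by exact: lt_0_INR1.
have Hb : INR N.+2 = a + 1 by rewrite S_INR.
rewrite Hb; suff : / (a + 1) <= ln (a + 1) - ln a by lra.
have := @ln_le_sub1 (a / (a + 1)); rewrite ln_div; try lra.
have -> : a / (a + 1) - 1 = - / (a + 1) by field; lra.
have H : 0 < a / (a + 1) by apply: Rdiv_lt_0_compat; lra.
by move=> /(_ H); lra.
Qed.

Lemma INR_addn m n : INR (m + n)%N = INR m + INR n.
Proof. by rewrite -plus_INR. Qed.

(** * Chebyshev and Mertens bounds *)

Lemma ln_INR_ge0 n : 0 <= ln (INR n).
Proof.
case: n => [|n]; last by apply: ln_ge0; exact: INR_ge1.
by rewrite /ln /=; case: Rlt_dec => H; [exfalso|]; lra.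
Qed.

(** The range of [p] is a common bound [N] instead of [n], so that sums over [n] and over [p] can
    later be interchanged. *)
Lemma ln_logn N n : (1 <= n <= N)%N ->
  ln (INR n) = rsum1 N (fun p => b2r (prime p) * (INR (logn p n) * ln (INR p))).
Proof.
elim/ltn_ind: n => n IH Hn.
case: (ltnP 1 n) => Hn1; last first.
  have -> : n = 1%N by lia.
  by rewrite ln_1 rsum1_zero // => i _; rewrite logn1 /=; ring.
have Hp := pdiv_prime Hn1; have Hd := pdiv_dvd n.
set p := pdiv n in Hp Hd.
have Hp1 := prime_gt1 Hp.
have Hm : (n = p * (n %/ p))%N by rewrite mulnC divnK.
set m := (n %/ p)%N in Hm.
have Hm0 : (0 < m)%N by rewrite lt0n; apply/negP => /eqP E; move: Hm; rewrite E; lia.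
have Hpn : (p <= n)%N by apply: dvdn_leq => //; lia.
have Hmn : (m < n)%N by rewrite Hm; apply: ltn_Pmull.
rewrite {1}Hm INR_muln ln_mult; try by apply: lt_0_INR1 => //; lia.
rewrite (IH m) //; last by lia.
have -> : ln (INR p) = rsum1 N (fun q => b2r (q == p) * ln (INR q)).
  by rewrite rsum1_single //; lia.
rewrite -rsum1_plus; apply: rsum1_ext => q _.
rewrite Hm lognM //; last by lia.
case: (boolP (prime q)) => Hq; last first.
  have -> : (q == p) = false by apply/negP => /eqP E; rewrite E Hp in Hq.
  by rewrite /=; ring.
rewrite (logn_prime q Hp) INR_addn.
by case: (q == p) => /=; ring.
Qed.

Definition theta (N : nat) : R := rsum1 N (fun p => b2r (prime p) * ln (INR p)).

Lemma theta_mono m n : (m <= n)%N -> theta m <= theta n.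
Proof.
move=> H; apply: rsum1_mono => // p _.
by apply: Rmult_le_pos; [exact: b2r_ge0|exact: ln_INR_ge0].
Qed.

Lemma prime_dvd_fact p n : prime p -> (p %| n`!)%N = (p <= n)%N.
Proof.
move=> Hp; elim: n => [|n IH]; first by rewrite dvdn1; have := prime_gt1 Hp; lia.
rewrite factS Euclid_dvdM // IH.
apply/idP/idP; last by rewrite leq_eqVlt ltnS => /orP[/eqP <-|->]; rewrite ?dvdnn ?orbT.
by case/orP => [/dvdn_leq|]; [apply|lia].
Qed.

(** The primes in [(m, 2m]] all divide the central binomial coefficient, which is at most
    [2 ^ (2 * m)]. *)
Lemma theta_double m : theta (2 * m)%N - theta m <= INR (2 * m) * ln 2.
Proof.
set c := 'C(2 * m, m).
have Hc0 : (0 < c)%N by rewrite bin_gt0; lia.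
have Hc : (c <= 2 ^ (2 * m))%N.
  have := expnDn 1 1 (2 * m); rewrite /= => ->.
  have Hm : (m < (2 * m).+1)%N by lia.
  rewrite (bigD1 (Ordinal Hm)) //= !exp1n !muln1.
  exact: leq_addr.
have -> : INR (2 * m) * ln 2 = ln (INR (2 ^ (2 * m))).
  elim: (2 * m)%N => [|k IH]; first by rewrite /= ln_1; ring.
  rewrite expnS INR_muln ln_mult; [|by rewrite /=; lra|by apply: lt_0_INR1; rewrite expn_gt0].
  have -> : INR 2 = 2 by [].
  by rewrite -IH S_INR; ring.
apply: Rle_trans (ln_le _ _ _ (INR_leq Hc)); last exact: lt_0_INR1.
set M := maxn c (2 * m).
rewrite (@ln_logn M); last by rewrite Hc0 leq_maxl.
rewrite /theta (@rsum1_trunc m (2 * m)%N); last by lia.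
rewrite -rsum1_minus.
apply: Rle_trans (rsum1_mono (N := (2 * m)%N) _ _); first last.
- move=> i _; apply: Rmult_le_pos; first exact: b2r_ge0.
  by apply: Rmult_le_pos; [exact: pos_INR|exact: ln_INR_ge0].
- exact: leq_maxr.
apply: rsum1_le => p Hp.
have H0 := ln_INR_ge0 p.
case: (boolP (prime p)) => Hpr /=; last by rewrite /=; lra.
case: (leqP p m) => Hpm /=.
  have := Rmult_le_pos _ _ (pos_INR (logn p c)) H0; lra.
have H1 : 1 <= INR (logn p c).
  apply: INR_ge1; rewrite logn_gt0 mem_primes Hpr Hc0 /=.
  have : (p %| (2 * m)`!)%N by rewrite prime_dvd_fact //; lia.
  rewrite -(@bin_fact (2 * m) m); last by lia.
  by rewrite !Euclid_dvdM // !prime_dvd_fact // => /orP[//|]; lia.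
nra.
Qed.

(** Summing the doubling bound gives [2 * 2^j * ln 2] at powers of two, and some power of two lies
    in [[N, 2N)]; hence the constant [4 * ln 2]. *)
Lemma theta_le : exists2 C, 0 < C & forall N, theta N <= C * INR N.
Proof.
have Hl2 : 0 < ln 2 by rewrite -ln_1; apply: ln_increasing; lra.
exists (4 * ln 2); first by lra.
have H2 : forall j, theta (2 ^ j)%N <= 2 * INR (2 ^ j) * ln 2.
  elim=> [|j IH]; first by rewrite /theta rsum1S rsum10 /=; lra.
  have := theta_double (2 ^ j); rewrite -expnS => H.
  have E : INR (2 ^ j.+1) = 2 * INR (2 ^ j) by rewrite expnS INR_muln.
  rewrite E in H *; lra.
case=> [|N]; first by rewrite /theta rsum10 /=; lra.
have [j Hj] : exists j, (N.+1 <= 2 ^ j < 2 * N.+1)%N.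
  have Hb := trunc_log_bounds (ltnSn 1) (ltn0Sn N).
  case/andP: Hb => Hb1 Hb2; rewrite expnS in Hb2.
  case: (leqP N.+1 (2 ^ trunc_log 2 N.+1)) => H; first by exists (trunc_log 2 N.+1); lia.
  by exists (trunc_log 2 N.+1).+1; rewrite expnS; lia.
apply: Rle_trans (theta_mono (n := (2 ^ j)%N) _) _; first by lia.
apply: Rle_trans (H2 j) _.
have : INR (2 ^ j) <= INR (2 * N.+1) by apply: INR_leq; lia.
rewrite INR_muln [INR 2]/=; nra.
Qed.

Lemma ln_le_2sqrt x : 0 < x -> ln x <= 2 * sqrt x.
Proof.
move=> Hx; have Hs := sqrt_lt_R0 x Hx.
have {1}-> : x = sqrt x * sqrt x by rewrite sqrt_sqrt; lra.
by rewrite ln_mult //; have := ln_le_sub1 Hs; lra.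
Qed.

Lemma sum_ln_sq : exists2 C, 0 < C & forall N, rsum1 N (fun n => ln (INR n) / INR n ^ 2) <= C.
Proof.
exists 8; first by lra.
(* The subtracted term carries the induction: by [ln x <= 2 sqrt x] the next summand is at most
   [2 / (a + 1)^(3/2)], and this is no more than the increase of [- 4 / sqrt]. *)
have H : forall N, (0 < N)%N -> rsum1 N (fun n => ln (INR n) / INR n ^ 2) <= 8 - 4 / sqrt (INR N).
  case=> // N _; elim: N => [|N IH].
    by rewrite rsum1S rsum10 /= ln_1 sqrt_1; lra.
  rewrite rsum1S; set a := INR N.+1 in IH *.
  have Ha : 1 <= a by exact: INR_ge1.
  have -> : INR N.+2 = a + 1 by rewrite S_INR.
  have Hs1 : 0 < sqrt a by apply: sqrt_lt_R0; lra.
  have Hs2 : 0 < sqrt (a + 1) by apply: sqrt_lt_R0; lra.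
  have Hs3 : sqrt a <= sqrt (a + 1) by apply: sqrt_le_1; lra.
  have E1 : sqrt a * sqrt a = a by apply: sqrt_sqrt; lra.
  have E2 : sqrt (a + 1) * sqrt (a + 1) = a + 1 by apply: sqrt_sqrt; lra.
  have HL : ln (a + 1) <= 2 * sqrt (a + 1) by apply: ln_le_2sqrt; lra.
  set r := sqrt a in IH Hs1 Hs3 E1 *; set t := sqrt (a + 1) in Hs2 Hs3 E2 HL *.
  have K : ln (a + 1) / (a + 1) ^ 2 <= 2 / t ^ 3.
    have -> : 2 / t ^ 3 = 2 * t / (a + 1) ^ 2 by rewrite -E2; field; lra.
    by apply: Rmult_le_compat_r => //; apply/Rlt_le/Rinv_0_lt_compat; nra.
  suff : 2 / t ^ 3 <= 4 / r - 4 / t by lra.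
  have -> : 4 / r - 4 / t = 4 / (r * t * (r + t)).
    have E3 : (t - r) * (r + t) = 1 by lra.
    have -> : 4 / r - 4 / t = 4 * (t - r) / (r * t) by field; lra.
    have -> : 4 / (r * t * (r + t)) = 4 * ((t - r) * (r + t)) / (r * t * (r + t)) by rewrite E3 Rmult_1_r.
    by field; split; [nra|lra].
  have P1 : 0 < r * t by nra.
  have -> : 2 / t ^ 3 = 4 / (t * t * (t + t)) by field; lra.
  apply: Rmult_le_compat_l; first by lra.
  apply: Rinv_le_contravar; first by nra.
  apply: Rmult_le_compat; nra.
case=> [|N]; first by rewrite rsum10; lra.
apply: Rle_trans (H _ (ltn0Sn N)) _.
have : 0 < 4 / sqrt (INR N.+1) by apply: Rdiv_lt_0_compat; [lra|apply: sqrt_lt_R0; exact: lt_0_INR1].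
lra.
Qed.

(** For [1 <= n <= N], the logarithm of the radical of [n]. Counting each prime factor once makes a
    weighted sum over [n] an exact double sum over factorizations [n = p * m], with no coprimality
    condition. *)
Definition ln_rad (N n : nat) : R :=
  rsum1 N (fun p => b2r (prime p) * (b2r (p %| n) * ln (INR p))).

Lemma ln_rad_le N n : (1 <= n <= N)%N -> ln_rad N n <= ln (INR n).
Proof.
move=> Hn; rewrite (ln_logn Hn); apply: rsum1_le => p _.
case: (boolP (prime p)) => Hp; last by rewrite /=; lra.
rewrite /= !Rmult_1_l; apply: Rmult_le_compat_r; first exact: ln_INR_ge0.
case: (boolP (p %| n)) => Hd /=; last exact: pos_INR.
by apply: INR_ge1; rewrite logn_gt0 mem_primes Hp Hd; lia.
Qed.

Lemma sum_dvd_pow p N n K : prime p -> (1 <= n <= N)%N -> (N <= K)%N ->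
  INR (logn p n) = b2r (p %| n) + rsum1 K (fun a => b2r (p ^ a.+1 %| n)).
Proof.
move=> Hp Hn HK.
have E : INR (logn p n) = rsum1 K.+1 (fun a => b2r (p ^ a %| n)).
  rewrite (@rsum1_trunc _ K.+1 _ (leqnn _)).
  have H : (logn p n <= K.+1)%N.
    have Hn0 : (0 < n)%N by lia.
    by have := ltn_logl p Hn0; lia.
  rewrite -[LHS]Rmult_1_r -rsum1_const (@rsum1_trunc _ K.+1 _ H).
  apply: rsum1_ext => a Ha.
  have -> : (a <= K.+1)%N by lia.
  rewrite pfactor_dvdn //; last by lia.
  by rewrite /= ; ring.
rewrite E; elim: K {HK E} => [|K IH]; first by rewrite rsum1S !rsum10 expn1; ring.
by rewrite rsum1S IH rsum1S; ring.
Qed.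

Lemma geom_tail (x : R) K : 2 <= x -> rsum1 K (fun a => / x ^ a.+1) <= 2 / x ^ 2.
Proof.
move=> Hx.
have Hp : forall k, 0 < x ^ k by move=> k; apply: pow_lt; lra.
suff H : rsum1 K (fun a => / x ^ a.+1) <= 2 / x ^ 2 - 2 * / x ^ K.+2.
  have := Rinv_0_lt_compat _ (Hp K.+2); lra.
elim: K => [|K IH]; first by rewrite rsum10 /Rdiv; lra.
rewrite rsum1S.
suff : / x ^ K.+2 <= 2 * / x ^ K.+2 - 2 * / x ^ K.+3 by lra.
have -> : / x ^ K.+3 = / x * / x ^ K.+2 by rewrite -Rinv_mult.
have H1 := Rinv_0_lt_compat _ (Hp K.+2).
have H2 : / x <= / 2 by apply: Rinv_le_contravar; lra.
nra.
Qed.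

(** The excess comes from the powers [p^a] with [a >= 2], which for each [p] contribute at most
    [2 N ln p / p^2], a convergent series. *)
Lemma ln_rad_excess : exists2 C, 0 < C &
  forall N, rsum1 N (fun n => ln (INR n) - ln_rad N n) <= C * INR N.
Proof.
have [C HC H] := sum_ln_sq; exists (2 * C); first by lra.
move=> N.
have -> : rsum1 N (fun n => ln (INR n) - ln_rad N n) =
  rsum1 N (fun p => b2r (prime p) * ln (INR p) *
     rsum1 N (fun a => rsum1 N (fun n => b2r (p ^ a.+1 %| n)))).
  transitivity (rsum1 N (fun n => rsum1 N (fun p => b2r (prime p) * ln (INR p) *
     rsum1 N (fun a => b2r (p ^ a.+1 %| n))))).
    apply: rsum1_ext => n Hn; rewrite (ln_logn Hn) /ln_rad -rsum1_minus.
    apply: rsum1_ext => p _; case: (boolP (prime p)) => Hp; last by rewrite /=; ring.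
    by rewrite (sum_dvd_pow Hp Hn (leqnn _)); ring.
  rewrite rsum1_swap; apply: rsum1_ext => p _.
  by rewrite rsum1_scal rsum1_swap.
apply: (@Rle_trans _ (rsum1 N (fun p => 2 * INR N * (ln (INR p) / INR p ^ 2)))); last first.
  rewrite rsum1_scal; have := H N; have := pos_INR N; nra.
apply: rsum1_le => p Hp; have H0 := ln_INR_ge0 p.
case: (boolP (prime p)) => Hpr; last first.
  rewrite [b2r _]/= !Rmult_0_l; apply: Rmult_le_pos; first by have := pos_INR N; lra.
  by apply: Rdiv_le_0_compat => //; apply: pow_lt; apply: lt_0_INR1; lia.
rewrite /= Rmult_1_l.
have Hp2 : 2 <= INR p by have := @INR_leq 2 p (prime_gt1 Hpr); rewrite /=; lra.
have K : rsum1 N (fun a => rsum1 N (fun n => b2r (p ^ a.+1 %| n))) <= INR N * (2 / INR p ^ 2).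
  apply: (@Rle_trans _ (rsum1 N (fun a => INR N * / INR p ^ a.+1))).
    apply: rsum1_le => a _; apply: Rle_trans (count_dvd_le _ _) _.
      by rewrite expn_gt0 prime_gt0.
    have -> : INR (p ^ a.+1)%N = INR p ^ a.+1.
      by elim: (a.+1) => [|b IH] //; rewrite expnS INR_muln IH.
    exact: Rle_refl.
  rewrite rsum1_scal; apply: Rmult_le_compat_l; first exact: pos_INR.
  exact: geom_tail.
apply: Rle_trans (Rmult_le_compat_l _ _ _ H0 K) _.
by right; rewrite /=; field; lra.
Qed.

Lemma sum_ln_le N : rsum1 N (fun n => ln (INR n)) <= INR N * ln (INR N).
Proof.
rewrite -rsum1_const; apply: rsum1_le => n Hn.
by apply: ln_le; [apply: lt_0_INR1; lia|apply: INR_leq; lia].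
Qed.

Lemma sum_ln_ge N : INR N * ln (INR N) - INR N <= rsum1 N (fun n => ln (INR n)).
Proof.
elim: N => [|[|N] IH]; first by rewrite rsum10 /=; lra.
  by rewrite rsum1S rsum10 /= ln_1; lra.
rewrite rsum1S; set a := INR N.+1 in IH *.
have Ha : 0 < a by exact: lt_0_INR1.
have -> : INR N.+2 = a + 1 by rewrite S_INR.
suff : a * (ln (a + 1) - ln a) <= 1 by lra.
have Hd : 0 < (a + 1) / a by apply: Rdiv_lt_0_compat; lra.
have := ln_le_sub1 Hd; rewrite ln_div; try lra.
have -> : (a + 1) / a - 1 = / a by field; lra.
move=> H; apply: Rle_trans (Rmult_le_compat_l a _ _ _ H) _; first by lra.
by rewrite Rinv_r; lra.
Qed.

Definition mertens (N : nat) : R := rsum1 N (fun p => b2r (prime p) * (ln (INR p) / INR p)).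

Lemma sum_ln_rad N f : rsum1 N (fun n => f n * ln_rad N n) =
  rsum1 N (fun p => b2r (prime p) * (ln (INR p) * rsum1 (N %/ p) (fun m => f (p * m)%N))).
Proof.
transitivity (rsum1 N (fun n => rsum1 N (fun p => b2r (prime p) * ln (INR p) * (b2r (p %| n) * f n)))).
  by apply: rsum1_ext => n _; rewrite -rsum1_scal; apply: rsum1_ext => p _; ring.
rewrite rsum1_swap; apply: rsum1_ext => p Hp.
by rewrite rsum1_scal rsum1_dvd; [ring|lia].
Qed.

(** The sum of the logarithms of radicals equals the sum of [ln p * (N %/ p)]. Rounding the quotient
    costs at most [theta N], passing from radicals to integers costs [C1 * N], and [sum_ln_ge] loses
    one more [N]. *)
Lemma mertens_first : exists2 C, 0 < C &
  forall N, (0 < N)%N -> Rabs (mertens N - ln (INR N)) <= C.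
Proof.
have [C1 HC1 H1] := ln_rad_excess; have [C2 HC2 H2] := theta_le.
exists (1 + C1 + C2); first by lra.
move=> N HN; have HN' := lt_0_INR1 HN.
have E := sum_ln_rad N (fun=> 1).
have E1 : rsum1 N (fun n => 1 * ln_rad N n) = rsum1 N (ln_rad N).
  by apply: rsum1_ext => n _; ring.
have E2 : rsum1 N (fun p => b2r (prime p) * (ln (INR p) * rsum1 (N %/ p) (fun=> 1))) =
  rsum1 N (fun p => b2r (prime p) * (ln (INR p) * INR (N %/ p))).
  by apply: rsum1_ext => p _; rewrite rsum1_const Rmult_1_r.
have U : rsum1 N (ln_rad N) <= INR N * mertens N.
  rewrite -E1 E E2 /mertens -rsum1_scal; apply: rsum1_le => p Hp.
  have Hp0 : (0 < p)%N by lia.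
  have := divn_le_INR N Hp0; have := ln_INR_ge0 p; have := b2r_ge0 (prime p).
  move=> A B D.
  have -> : INR N * (b2r (prime p) * (ln (INR p) / INR p)) = b2r (prime p) * (ln (INR p) * (INR N / INR p)).
    by rewrite /Rdiv; ring.
  by apply: Rmult_le_compat_l => //; apply: Rmult_le_compat_l.
have L : INR N * mertens N - theta N <= rsum1 N (ln_rad N).
  rewrite -E1 E E2 /mertens /theta -rsum1_scal -rsum1_minus; apply: rsum1_le => p Hp.
  have Hp0 : (0 < p)%N by lia.
  have := divn_ge_INR N Hp0; have := ln_INR_ge0 p; have := b2r_ge0 (prime p).
  move=> A B D.
  have -> : INR N * (b2r (prime p) * (ln (INR p) / INR p)) - b2r (prime p) * ln (INR p) = b2r (prime p) * (ln (INR p) * (INR N / INR p - 1)).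
    by rewrite /Rdiv; ring.
  by apply: Rmult_le_compat_l => //; apply: Rmult_le_compat_l.
have X : rsum1 N (ln_rad N) <= rsum1 N (fun n => ln (INR n)).
  by apply: rsum1_le => n Hn; exact: ln_rad_le.
have Y := H1 N; rewrite rsum1_minus in Y.
have Z := H2 N; have S1 := sum_ln_le N; have S2 := sum_ln_ge N.
apply/Rabs_le; split.
  suff : INR N * (- (1 + C1 + C2)) <= INR N * (mertens N - ln (INR N)) by move/(Rmult_le_reg_l _ _ _ HN').
  nra.
suff : INR N * (mertens N - ln (INR N)) <= INR N * (1 + C1 + C2) by move/(Rmult_le_reg_l _ _ _ HN').
nra.
Qed.

(** * A sieve by large primes *)

(* Signed ([c = -1]) or absolute ([c = 1]) Moebius weights supported on the
   squarefree products of primes of [L]. *)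
Fixpoint mobL (c : R) (L : seq nat) (d : nat) : R :=
  if L is p :: L' then mobL c L' d + c * (b2r (p %| d) * mobL c L' (d %/ p))
  else b2r (d == 1)%N.

Definition avoids (L : seq nat) (n : nat) : bool := all (fun p => ~~ (p %| n)) L.

Lemma mobL_supp c L d : all prime L -> mobL c L d <> 0 ->
  (0 < d)%N /\ (forall q, prime q -> q %| d -> q \in L).
Proof.
elim: L d => [|p L IH] d /=.
  move=> _; case: (boolP (d == 1)%N) => [/eqP -> _|] //.
  by split=> // q Hq; rewrite dvdn1 => /eqP E; move: Hq; rewrite E.
move=> /andP[Hp HL] H.
have Hp0 := prime_gt0 Hp.
case: (Req_dec (mobL c L d) 0) => [E|/(IH d HL)[A B]]; last first.
  by split=> // q Hq Hqd; rewrite inE B ?orbT.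
rewrite E in H; have Hd : p %| d.
  by apply/negPn/negP => Hn; apply: H; rewrite (negbTE Hn) /=; ring.
have H2 : mobL c L (d %/ p) <> 0 by move=> E2; apply: H; rewrite E2; ring.
have [A B] := IH _ HL H2.
split; first by move: A; rewrite divn_gt0 //; lia.
move=> q Hq; rewrite -(divnK Hd) Euclid_dvdM // => /orP[/(B q Hq)|].
  by rewrite inE => ->; rewrite orbT.
by rewrite dvdn_prime2 // => /eqP ->; rewrite inE eqxx.
Qed.

Lemma mobL_dvd0 c L p d : all prime L -> prime p -> p \notin L -> p %| d -> mobL c L d = 0.
Proof.
move=> HL Hp HpL Hd; case: (Req_dec (mobL c L d) 0) => // /(mobL_supp HL)[_ /(_ p Hp Hd)].
by rewrite (negbTE HpL).
Qed.

(** Expansion of the product of [1 + c * [p divides n]] over [L]. For [c = -1] it is the indicator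
    of avoiding [L], for [c = 1] it is 2 to the number of primes of [L] dividing [n]. *)
Lemma mobL_sum c L N n : uniq L -> all prime L -> (1 <= n <= N)%N ->
  rsum1 N (fun d => mobL c L d * b2r (d %| n)) =
  foldr (fun p a => (1 + c * b2r (p %| n)) * a) 1 L.
Proof.
move=> + + Hn; elim: L => [|p L IH] /=.
  move=> _ _; rewrite (rsum1_single (fun d => b2r (d %| n))); last by lia.
  by rewrite dvd1n.
move=> /andP[HpL Hu] /andP[Hp HL]; rewrite -(IH Hu HL).
have Hp0 := prime_gt0 Hp.
transitivity (rsum1 N (fun d => mobL c L d * b2r (d %| n)) +
   c * rsum1 N (fun d => b2r (p %| d) * (mobL c L (d %/ p) * b2r (d %| n)))).
  by rewrite -rsum1_scal -rsum1_plus; apply: rsum1_ext => d _; ring.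
rewrite (rsum1_dvd N (fun d => mobL c L (d %/ p) * b2r (d %| n)) Hp0).
have E : forall m, (0 < m)%N -> mobL c L m * b2r (p * m %| n) = b2r (p %| n) * (mobL c L m * b2r (m %| n)).
  move=> m Hm; case: (boolP (p %| m)) => Hpm.
    by rewrite (mobL_dvd0 c HL Hp HpL Hpm); ring.
  rewrite Gauss_dvd; last by rewrite prime_coprime.
  by rewrite b2r_and; ring.
suff -> : rsum1 (N %/ p) (fun m => mobL c L (p * m %/ p) * b2r (p * m %| n)) =
   b2r (p %| n) * rsum1 N (fun d => mobL c L d * b2r (d %| n)) by ring.
rewrite -rsum1_scal (@rsum1_extend (N %/ p) N); first last.
- move=> m /andP[Hm1 Hm2]; rewrite -E; last exact: leq_ltn_trans Hm1.
  have -> : (p * m %| n) = false; last by rewrite /=; ring.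
  apply/negP => /dvdn_leq H; have this : (p * m <= n)%N by apply: H; case/andP: Hn.
  move: Hm1; rewrite ltn_divLR // ltnNge mulnC (leq_trans this) //.
  by case/andP: Hn.
- exact: leq_div.
by apply: rsum1_ext => m Hm; rewrite mulKn // E //; lia.
Qed.

Lemma mobL1_ge0 L d : 0 <= mobL 1 L d.
Proof.
elim: L d => [|p L IH] d /=; first exact: b2r_ge0.
rewrite Rmult_1_l; apply: Rplus_le_le_0_compat; first exact: IH.
by apply: Rmult_le_pos; [exact: b2r_ge0|exact: IH].
Qed.

Lemma mobL_abs_le L d : Rabs (mobL (-1) L d) <= mobL 1 L d.
Proof.
elim: L d => [|p L IH] d /=; first by rewrite Rabs_pos_eq; [lra|exact: b2r_ge0].
apply: Rle_trans (Rabs_triang _ _) _; rewrite !Rabs_mult Rabs_Ropp Rabs_R1 !Rmult_1_l.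
rewrite (Rabs_pos_eq (b2r _)); last exact: b2r_ge0.
by apply: Rplus_le_compat => //; apply: Rmult_le_compat_l => //; exact: b2r_ge0.
Qed.

Lemma mobL1_le1 L d : uniq L -> all prime L -> mobL 1 L d <= 1.
Proof.
elim: L d => [|p L IH] d /=; first by move=> _ _; exact: b2r_le1.
move=> /andP[HpL Hu] /andP[Hp HL]; rewrite Rmult_1_l.
case: (boolP (p %| d)) => Hd /=; last by have := IH d Hu HL; lra.
by rewrite (mobL_dvd0 1 HL Hp HpL Hd); have := IH (d %/ p)%N Hu HL; lra.
Qed.

Lemma foldr_avoids L n :
  foldr (fun p a => (1 + (-1) * b2r (p %| n)) * a) 1 L = b2r (avoids L n).
Proof.
elim: L => [|p L IH] //=; rewrite IH /avoids /=.
by case: (p %| n) => /=; ring.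
Qed.

Lemma foldr_pow2 L n :
  foldr (fun p a => (1 + 1 * b2r (p %| n)) * a) 1 L = 2 ^ count (fun p => p %| n) L.
Proof.
elim: L => [|p L IH] //=; rewrite IH.
by case: (p %| n); rewrite ?add1n ?add0n /=; ring.
Qed.

(** The primes of [L] dividing [n] are divided out one at a time, each accounting for a factor at
    least [b]. *)
Lemma count_large_primes b L n : uniq L -> all prime L -> all (fun p => b <= p)%N L ->
  (0 < n)%N -> (b ^ count (fun p => p %| n) L <= n)%N.
Proof.
elim: L n => [|p L IH] n /=; first by rewrite expn0.
move=> /andP[HpL Hu] /andP[Hp HL] /andP[Hb HbL] Hn.
case: (boolP (p %| n)) => Hd /=; last by rewrite add0n; exact: IH.
have Hp0 := prime_gt0 Hp.
rewrite add1n expnS -{2}(divnK Hd) mulnC; apply: leq_mul => //.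
apply: leq_trans (IH (n %/ p)%N Hu HL HbL _); last by rewrite divn_gt0 // dvdn_leq.
(* Since [0 ^ 0 = 1], powers of 0 are not monotone in the exponent, so [b = 0] asks for equality of
   the two counts where [b > 0] only asks for an inequality. *)
case: b {Hb HbL IH} => [|b]; last first.
  apply: leq_pexp2l => //.
  have Hsub : {in L, forall q, (q %| n) -> (q %| n %/ p)}.
    move=> q Hq; have Hqp : prime q by exact: (allP HL).
    rewrite -{1}(divnK Hd) Euclid_dvdM // => /orP[//|].
    by rewrite dvdn_prime2 // => /eqP E; move: HpL; rewrite -E Hq.
  by rewrite -!size_filter; apply: uniq_leq_size; [exact: filter_uniq|move=> q; rewrite !mem_filter => /andP[H1 H2]; rewrite H2 Hsub].
have Hsub : {in L, (fun q => q %| n) =1 (fun q => q %| n %/ p)}.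
  move=> q Hq; have Hqp : prime q by exact: (allP HL).
  rewrite -{1}(divnK Hd) Euclid_dvdM //.
  case: (boolP (q %| n %/ p)) => //= _.
  by rewrite dvdn_prime2 //; apply/negP => /eqP E; move: HpL; rewrite -E Hq.
by rewrite (eq_in_count Hsub).
Qed.

Lemma count_large_primes_le b K N L n : (1 < b)%N -> (N <= b ^ K)%N ->
  uniq L -> all prime L -> all (fun p => b <= p)%N L ->
  (1 <= n <= N)%N -> (count (fun p => p %| n) L <= K)%N.
Proof.
move=> Hb HN Hu HL HbL Hn.
rewrite -(leq_exp2l _ _ Hb); apply: leq_trans HN.
apply: leq_trans (count_large_primes Hu HL HbL _) _; lia.
Qed.

(** * Weights with small discrepancy and the second moment over middle primes *)

Definition rough (z d : nat) : bool := all (fun p => (z < p)%N) (primes d).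

Definition mass (N : nat) (w : nat -> R) (d : nat) : R :=
  rsum1 N (fun n => b2r (d %| n) * w n).

(** Only rough moduli enter. On them [1/phi(d)], the density given by the hypothesis for shifted
    primes, is close to [1/d], the density for integers, so a single target serves both weights. *)
Definition discrepancy (N D z : nat) (w : nat -> R) : R :=
  rsum1 D (fun d => b2r (rough z d) * Rabs (mass N w d - / INR d)).

Definition no_mid_prime (z Y n : nat) : bool :=
  all (fun q => ~~ (prime q && (z < q)%N && (q %| n))) (iota 1 Y).

Lemma no_mid_primeP z Y n : reflect
  (exists2 q, prime q & (z < q <= Y)%N /\ q %| n) (~~ no_mid_prime z Y n).
Proof.
rewrite /no_mid_prime -has_predC; apply: (iffP hasP) => [[q]|[q Hq [Hz Hd]]].
  rewrite mem_iota /= negbK => Hq /andP[/andP[Hp Hz] Hd]; exists q => //; split=> //; lia.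
exists q; first by rewrite mem_iota; have := prime_gt0 Hq; lia.
by rewrite /= negbK Hq Hd; lia.
Qed.

Section Sieve.

(** In the application [D], [z], [Y] are the floors of [N^(1-e)], [N^e], [N^(1/U)], and [w] is
    uniform either on the integers up to [N] or on the shifted primes. [K] and [K'] bound the number
    of prime factors above [Y] and above [z]. *)
Variables (N D z Y K K' : nat) (w : nat -> R) (delta : R).
Hypothesis w_ge0 : forall n, 0 <= w n.
Hypothesis w_sum : rsum1 N w = 1.
Hypothesis DN : (D <= N)%N.
Hypothesis dD : forall d, (d * z.+1 <= N)%N -> (d <= D)%N.
Hypothesis zY : (z <= Y)%N.
Hypothesis YD : (Y * Y <= D)%N.
Hypothesis z_gt0 : (0 < z)%N.
Hypothesis NK : (N <= Y.+1 ^ K)%N.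
Hypothesis NK' : (N <= z.+1 ^ K')%N.
Hypothesis disc : discrepancy N D z w <= delta.

Lemma delta_ge0 : 0 <= delta.
Proof.
apply: Rle_trans disc; apply: rsum1_ge0 => d _.
by apply: Rmult_le_pos; [exact: b2r_ge0|exact: Rabs_pos].
Qed.

(** Suppose a prime [q] in [(z, Y]] divides [n]. Then [q] is coprime to every product [d] of primes
    of [L], so [d] dividing [n] forces [q * d <= N], hence [d <= D]: the truncation loses nothing.
    Otherwise the lost terms are bounded by the number of divisors built from [L], at most
    [2 ^ K]. *)
Lemma avoids_approx_pointwise L n : uniq L -> all prime L -> all (fun p => (Y < p)%N) L ->
  (1 <= n <= N)%N ->
  Rabs (b2r (avoids L n) - rsum1 D (fun d => mobL (-1) L d * b2r (d %| n)))
    <= 2 ^ K * b2r (no_mid_prime z Y n).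
Proof.
move=> Hu HL HY Hn.
rewrite -foldr_avoids -(mobL_sum (-1) Hu HL Hn) (@rsum1_trunc D N) // -rsum1_minus.
apply: Rle_trans (rsum1_abs _ _) _.
case: (boolP (no_mid_prime z Y n)) => Hno.
  rewrite [b2r true]/= Rmult_1_r.
  apply: (@Rle_trans _ (2 ^ count (fun p => p %| n) L)); last first.
    apply: Rle_pow; first by lra.
    by apply/leP; apply: (@count_large_primes_le Y.+1 K N) => //; lia.
  rewrite -foldr_pow2 -(mobL_sum 1 Hu HL Hn); apply: rsum1_le => d _.
  have H1 := mobL_abs_le L d; have H2 := mobL1_ge0 L d; have H3 := Rabs_pos (mobL (-1) L d).
  by case: (d <= D)%N; case: (d %| n); rewrite /= ?Rmult_0_r ?Rmult_0_l ?Rmult_1_l ?Rmult_1_r ?Rminus_diag ?Rminus_0_r ?Rabs_R0 //; lra.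
rewrite /= Rmult_0_r; right; apply: rsum1_zero => d Hd.
move: Hno => /no_mid_primeP[q Hq [Hqz Hqn]].
case: (leqP d D) => HdD; first by rewrite /= Rmult_1_l Rminus_diag Rabs_R0.
case: (boolP (d %| n)) => Hdn; last by rewrite /= !Rmult_0_r Rminus_diag Rabs_R0.
case: (Req_dec (mobL (-1) L d) 0) => [->|/(mobL_supp HL)[Hd0 Hsup]].
  by rewrite /= !Rmult_0_l Rminus_diag Rabs_R0.
exfalso; have Hqd : ~~ (q %| d).
  by apply/negP => /(Hsup q Hq) /(allP HY); lia.
have Hqdn : (q * d %| n)%N by rewrite Gauss_dvd ?Hqn ?Hdn // prime_coprime.
have Hle : (q * d <= n)%N by apply: dvdn_leq => //; lia.
have : (d <= D)%N; last by lia.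
apply: dD; apply: leq_trans (_ : n <= N)%N; last by lia.
apply: leq_trans Hle; rewrite mulnC leq_mul2r; lia.
Qed.

(** The sum subtracted on the left depends on [L] and [D] but not on the weight [w]; two weights can
    therefore be compared through it. *)
Lemma avoids_approx L : uniq L -> all prime L -> all (fun p => (Y < p)%N) L ->
  Rabs (rsum1 N (fun n => b2r (avoids L n) * w n) - rsum1 D (fun d => mobL (-1) L d * / INR d))
   <= delta + 2 ^ K * rsum1 N (fun n => b2r (no_mid_prime z Y n) * w n).
Proof.
move=> Hu HL HY.
have E : rsum1 N (fun n => rsum1 D (fun d => mobL (-1) L d * b2r (d %| n)) * w n) =
   rsum1 D (fun d => mobL (-1) L d * mass N w d).
  transitivity (rsum1 N (fun n => rsum1 D (fun d => mobL (-1) L d * b2r (d %| n) * w n))).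
    by apply: rsum1_ext => n _; rewrite rsum1_scalr.
  rewrite rsum1_swap; apply: rsum1_ext => d _; rewrite /mass -rsum1_scal.
  by apply: rsum1_ext => n _; ring.
have -> : rsum1 N (fun n => b2r (avoids L n) * w n) - rsum1 D (fun d => mobL (-1) L d * / INR d)
  = rsum1 N (fun n => (b2r (avoids L n) - rsum1 D (fun d => mobL (-1) L d * b2r (d %| n))) * w n)
   + rsum1 D (fun d => mobL (-1) L d * (mass N w d - / INR d)).
  have -> : rsum1 D (fun d => mobL (-1) L d * (mass N w d - / INR d)) =
    rsum1 D (fun d => mobL (-1) L d * mass N w d) - rsum1 D (fun d => mobL (-1) L d * / INR d).
    by rewrite -rsum1_minus; apply: rsum1_ext => d _; ring.
  rewrite -E; have -> : rsum1 N (fun n => (b2r (avoids L n) - rsum1 D (fun d => mobL (-1) L d * b2r (d %| n))) * w n)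
    = rsum1 N (fun n => b2r (avoids L n) * w n) - rsum1 N (fun n => rsum1 D (fun d => mobL (-1) L d * b2r (d %| n)) * w n).
    by rewrite -rsum1_minus; apply: rsum1_ext => d _; ring.
  by ring.
apply: Rle_trans (Rabs_triang _ _) _; rewrite Rplus_comm; apply: Rplus_le_compat.
  apply: Rle_trans disc; apply: Rle_trans (rsum1_abs _ _) _.
  apply: rsum1_le => d Hd; rewrite Rabs_mult.
  apply: Rmult_le_compat_r; first exact: Rabs_pos.
  case: (Req_dec (mobL (-1) L d) 0) => [->|/(mobL_supp HL)[_ Hs]].
    by rewrite Rabs_R0; exact: b2r_ge0.
  have -> : rough z d.
    apply/allP => p; rewrite mem_primes => /and3P[Hp _ /(Hs p Hp) /(allP HY)]; lia.
  by apply: Rle_trans (mobL_abs_le _ _) _; exact: mobL1_le1.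
apply: Rle_trans (rsum1_abs _ _) _; rewrite -rsum1_scal; apply: rsum1_le => n Hn.
rewrite Rabs_mult (Rabs_pos_eq (w n)) // -Rmult_assoc.
by apply: Rmult_le_compat_r => //; exact: avoids_approx_pointwise.
Qed.

Definition midp (q : nat) : R := b2r (prime q && (z < q)%N).

Definition mid_mass : R := rsum1 Y (fun q => midp q * / INR q).

Definition mid_count (n : nat) : R := rsum1 Y (fun q => midp q * b2r (q %| n)).

Lemma midp_ge0 q : 0 <= midp q. Proof. exact: b2r_ge0. Qed.

Lemma mid_mass_ge0 : 0 <= mid_mass.
Proof.
apply: rsum1_ge0 => q Hq; apply: Rmult_le_pos; first exact: midp_ge0.
by apply/Rlt_le/Rinv_0_lt_compat/lt_0_INR1; case/andP: Hq.
Qed.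

Lemma Y_le_D : (Y <= D)%N.
Proof. by apply: leq_trans YD; case: Y => // y; apply: leq_pmulr. Qed.

Lemma rough_prime q : prime q -> (z < q)%N -> rough z q.
Proof. by move=> Hq Hz; rewrite /rough primes_prime //= andbT. Qed.

Lemma mid_count_mean : mid_mass - delta <= rsum1 N (fun n => w n * mid_count n) <= mid_mass + delta.
Proof.
suff : Rabs (rsum1 N (fun n => w n * mid_count n) - mid_mass) <= delta.
  by move=> H; have := Rabs_le_between' (rsum1 N (fun n => w n * mid_count n)) mid_mass delta; case=> /(_ H); lra.
have -> : rsum1 N (fun n => w n * mid_count n) = rsum1 Y (fun q => midp q * mass N w q).
  transitivity (rsum1 N (fun n => rsum1 Y (fun q => midp q * (b2r (q %| n) * w n)))).
    by apply: rsum1_ext => n _; rewrite -rsum1_scal; apply: rsum1_ext => q _; ring.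
  by rewrite rsum1_swap; apply: rsum1_ext => q _; rewrite rsum1_scal.
rewrite /mid_mass -rsum1_minus; apply: Rle_trans (rsum1_abs _ _) _.
apply: Rle_trans disc; apply: Rle_trans (rsum1_mono Y_le_D _); last first.
  by move=> d _; apply: Rmult_le_pos; [exact: b2r_ge0|exact: Rabs_pos].
apply: rsum1_le => q Hq.
have -> : midp q * mass N w q - midp q * / INR q = midp q * (mass N w q - / INR q) by ring.
rewrite Rabs_mult (Rabs_pos_eq (midp q)); last exact: midp_ge0.
apply: Rmult_le_compat_r; first exact: Rabs_pos.
by apply: b2r_imp => /andP[Hp Hz]; exact: rough_prime.
Qed.

Lemma mid_count_le n : (1 <= n <= N)%N -> mid_count n <= INR K'.
Proof.
move=> Hn.
set L := [seq q <- iota 1 Y | prime q && (z < q)%N].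
have Hc : (count (fun p => p %| n) L <= K')%N.
  apply: (@count_large_primes_le z.+1 K' N) => //.
  - exact: filter_uniq (iota_uniq _ _).
  - by apply/allP => p; rewrite mem_filter => /andP[/andP[]].
  - by apply/allP => p; rewrite mem_filter => /andP[/andP[]].
apply: Rle_trans (INR_leq Hc); right.
rewrite count_filter count_rsum1; apply: rsum1_ext => q _.
by rewrite /midp -b2r_and /= andbC.
Qed.

(** Distinct primes [p], [q] give the modulus [p * q <= Y * Y <= D], whose error is part of the
    discrepancy. A given modulus arises at most [K'] times, once for each of its middle prime
    factors [p], because [p] determines [q]. The diagonal reproduces the first moment. *)
Lemma mid_count_sq : rsum1 N (fun n => w n * mid_count n ^ 2) <=
  mid_mass ^ 2 + INR K' * delta + (mid_mass + delta).
Proof.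
pose e d := b2r (rough z d) * Rabs (mass N w d - / INR d).
have He : forall d, 0 <= e d by move=> d; apply: Rmult_le_pos; [exact: b2r_ge0|exact: Rabs_pos].
have -> : rsum1 N (fun n => w n * mid_count n ^ 2) =
  rsum1 Y (fun p => rsum1 Y (fun q => midp p * midp q * rsum1 N (fun n => b2r (p %| n) * b2r (q %| n) * w n))).
  transitivity (rsum1 N (fun n => rsum1 Y (fun p => rsum1 Y (fun q => midp p * midp q * (b2r (p %| n) * b2r (q %| n) * w n))))).
    apply: rsum1_ext => n _.
    have -> : w n * mid_count n ^ 2 = (mid_count n * w n) * mid_count n by ring.
    rewrite {2}/mid_count -rsum1_scal; apply: rsum1_ext => p _.
    have -> : mid_count n * w n * (midp p * b2r (p %| n)) = (w n * (midp p * b2r (p %| n))) * mid_count n by ring.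
    by rewrite /mid_count -rsum1_scal; apply: rsum1_ext => q _; ring.
  rewrite rsum1_swap; apply: rsum1_ext => p _; rewrite rsum1_swap; apply: rsum1_ext => q _.
  by rewrite rsum1_scal.
apply: (@Rle_trans _ (rsum1 Y (fun p => rsum1 Y (fun q => midp p * midp q * (/ INR p * / INR q)
   + midp p * midp q * e (p * q)%N + b2r (q == p) * (midp q * mass N w q))))).
  apply: rsum1_le => p Hp; apply: rsum1_le => q Hq.
  have Hm : 0 <= midp q * mass N w q.
    apply: Rmult_le_pos; first exact: midp_ge0.
    by apply: rsum1_ge0 => n _; apply: Rmult_le_pos => //; exact: b2r_ge0.
  have Hpq : 0 <= midp p * midp q by apply: Rmult_le_pos; exact: midp_ge0.
  have Hi : 0 <= / INR p * / INR q.
    by apply: Rmult_le_pos; apply/Rlt_le/Rinv_0_lt_compat/lt_0_INR1; lia.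
  case: (eqVneq q p) => [E|Hne].
    have H1 : midp p * midp q * rsum1 N (fun n => b2r (p %| n) * b2r (q %| n) * w n) = midp q * mass N w q.
      rewrite E; congr (_ * _); first by rewrite /midp; case: (_ && _) => /=; ring.
      by apply: rsum1_ext => n _; case: (p %| n) => /=; ring.
    rewrite H1 [b2r true]/=.
    have := Rmult_le_pos _ _ Hpq Hi; have := Rmult_le_pos _ _ Hpq (He (p * q)%N); lra.
  rewrite [b2r false]/= Rmult_0_l Rplus_0_r.
  case: (boolP (prime p && (z < p)%N)) => Ap; last by rewrite {1 3 5}/midp (negbTE Ap) /=; lra.
  case: (boolP (prime q && (z < q)%N)) => Aq; last by rewrite {2 4 6}/midp (negbTE Aq) /=; lra.
  move: Ap Aq => /andP[Pp Zp] /andP[Pq Zq].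
  rewrite /midp Pp Zp Pq Zq [b2r _]/= !Rmult_1_l.
  have -> : rsum1 N (fun n => b2r (p %| n) * b2r (q %| n) * w n) = mass N w (p * q)%N.
    apply: rsum1_ext => n _; rewrite Gauss_dvd; first by rewrite b2r_and.
    by rewrite prime_coprime // dvdn_prime2 //; apply/negP => /eqP E; rewrite E eqxx in Hne.
  rewrite /e; have -> : rough z (p * q).
    apply/allP => r; rewrite mem_primes => /and3P[Pr _]; rewrite Euclid_dvdM //.
    by case/orP; rewrite dvdn_prime2 // => /eqP ->.
  rewrite [b2r _]/= Rmult_1_l INR_muln Rinv_mult.
  by have := Rle_abs (mass N w (p * q)%N - / INR p * / INR q); lra.
have -> : rsum1 Y (fun p => rsum1 Y (fun q => midp p * midp q * (/ INR p * / INR q)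
   + midp p * midp q * e (p * q)%N + b2r (q == p) * (midp q * mass N w q)))
  = mid_mass ^ 2 + rsum1 Y (fun p => rsum1 Y (fun q => midp p * midp q * e (p * q)%N)) +
    rsum1 N (fun n => w n * mid_count n).
  have -> : mid_mass ^ 2 = rsum1 Y (fun p => rsum1 Y (fun q => midp p * midp q * (/ INR p * / INR q))).
    rewrite /= Rmult_1_r {1}/mid_mass -rsum1_scalr; apply: rsum1_ext => p _.
    by rewrite /mid_mass -rsum1_scal; apply: rsum1_ext => q _; ring.
  have -> : rsum1 N (fun n => w n * mid_count n) = rsum1 Y (fun p => rsum1 Y (fun q => b2r (q == p) * (midp q * mass N w q))).
    transitivity (rsum1 Y (fun q => midp q * mass N w q)).
      transitivity (rsum1 N (fun n => rsum1 Y (fun q => midp q * (b2r (q %| n) * w n)))).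
        by apply: rsum1_ext => n _; rewrite -rsum1_scal; apply: rsum1_ext => q _; ring.
      by rewrite rsum1_swap; apply: rsum1_ext => q _; rewrite rsum1_scal.
    by apply: rsum1_ext => p Hp; rewrite rsum1_single.
  by rewrite -!rsum1_plus; apply: rsum1_ext => p _; rewrite -!rsum1_plus.
apply: Rplus_le_compat; last by have := mid_count_mean; lra.
apply: Rplus_le_compat_l.
apply: (@Rle_trans _ (rsum1 D (fun d => e d * INR K'))); last first.
  rewrite rsum1_scalr Rmult_comm; apply: Rmult_le_compat_l; first exact: pos_INR.
  exact: disc.
apply: (@Rle_trans _ (rsum1 Y (fun p => rsum1 Y (fun q => rsum1 D (fun d => b2r (d == p * q)%N * (midp p * midp q * e d)))))).
  right; apply: rsum1_ext => p Hp; apply: rsum1_ext => q Hq.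
  rewrite (rsum1_single (fun d => midp p * midp q * e d)) //.
  apply/andP; split; first by rewrite muln_gt0; lia.
  by apply: leq_trans YD; apply: leq_mul; lia.
have -> : rsum1 Y (fun p => rsum1 Y (fun q => rsum1 D (fun d => b2r (d == p * q)%N * (midp p * midp q * e d))))
  = rsum1 D (fun d => e d * rsum1 Y (fun p => midp p * rsum1 Y (fun q => b2r (d == p * q)%N * midp q))).
  transitivity (rsum1 Y (fun p => rsum1 D (fun d => rsum1 Y (fun q => b2r (d == p * q)%N * (midp p * midp q * e d))))).
    by apply: rsum1_ext => p _; rewrite rsum1_swap.
  rewrite rsum1_swap; apply: rsum1_ext => d _; rewrite -rsum1_scal; apply: rsum1_ext => p _.
  by rewrite -rsum1_scal -rsum1_scal; apply: rsum1_ext => q _; ring.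
apply: rsum1_le => d Hd; apply: Rmult_le_compat_l => //.
apply: Rle_trans (mid_count_le (n := d) _); last by lia.
apply: rsum1_le => p Hp; apply: Rmult_le_compat_l; first exact: midp_ge0.
case: (boolP (p %| d)) => Hpd; last first.
  right; apply: rsum1_zero => q Hq.
  have -> : (d == p * q)%N = false by apply/negP => /eqP E; move: Hpd; rewrite E dvdn_mulr.
  by rewrite /=; ring.
apply: (@Rle_trans _ (rsum1 Y (fun q => b2r (q == d %/ p)%N * 1))); last first.
  by apply: (@rsum1_single_le Y (d %/ p) (fun=> 1)); lra.
apply: rsum1_le => q Hq; apply: Rmult_le_compat; try exact: b2r_ge0; last exact: b2r_le1.
by apply: b2r_imp => /eqP ->; rewrite mulKn //; lia.
Qed.

(** Chebyshev's inequality: [mid_count] vanishes on these [n], so each adds [w n * mid_mass ^ 2] to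
    the variance. *)
Lemma no_mid_prime_mass : mid_mass ^ 2 * rsum1 N (fun n => b2r (no_mid_prime z Y n) * w n)
   <= mid_mass + (INR K' + 1 + 2 * mid_mass) * delta.
Proof.
apply: (@Rle_trans _ (rsum1 N (fun n => w n * (mid_count n - mid_mass) ^ 2))).
  rewrite -rsum1_scal; apply: rsum1_le => n Hn.
  case: (boolP (no_mid_prime z Y n)) => H.
    have -> : mid_count n = 0.
      apply: rsum1_zero => q Hq; rewrite /midp -b2r_and.
      have /(allP H) : q \in iota 1 Y by rewrite mem_iota; lia.
      by move/negbTE => ->.
    by rewrite /=; lra.
  rewrite [b2r _]/= Rmult_0_l Rmult_0_r; apply: Rmult_le_pos => //; exact: pow2_ge_0.
have -> : rsum1 N (fun n => w n * (mid_count n - mid_mass) ^ 2) =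
  rsum1 N (fun n => w n * mid_count n ^ 2) - 2 * mid_mass * rsum1 N (fun n => w n * mid_count n)
  + mid_mass ^ 2 * rsum1 N w.
  move: mid_mass => mm.
  by rewrite -!rsum1_scal -rsum1_minus -rsum1_plus; apply: rsum1_ext => n _; ring.
rewrite w_sum; have H1 := mid_count_sq; have H2 := mid_count_mean.
have H3 := mid_mass_ge0; have H4 := delta_ge0.
nra.
Qed.

End Sieve.

(** * Eventual inequalities and mid-size primes *)

Definition ev (P : R -> Prop) : Prop := exists X, forall x, X <= x -> P x.

Lemma ev_and P Q : ev P -> ev Q -> ev (fun x => P x /\ Q x).
Proof.
move=> [X HX] [Y HY]; exists (Rmax X Y) => x Hx.
have := Rmax_l X Y; have := Rmax_r X Y => H1 H2.
by split; [apply: HX|apply: HY]; lra.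
Qed.

Lemma ev_imp (P Q : R -> Prop) : (forall x, P x -> Q x) -> ev P -> ev Q.
Proof. by move=> H [X HX]; exists X => x /HX /H. Qed.

Lemma ev_ge c : ev (fun x => c <= x).
Proof. by exists c. Qed.

Lemma ev_comp f P : (forall c, ev (fun x => c <= f x)) -> ev P -> ev (fun x => P (f x)).
Proof. by move=> Hf [X HX]; apply: ev_imp (Hf X) => x; exact: HX. Qed.

Lemma ev_ln c : ev (fun x => c <= ln x).
Proof.
exists (exp c) => x Hx; have := exp_pos c => Hc.
by rewrite -(ln_exp c); apply: ln_le.
Qed.

Lemma ln_gt0_pos y : 0 < ln y -> 0 < y.
Proof. by rewrite /ln; case: Rlt_dec => // _; lra. Qed.

Lemma ev_Rpower e c : 0 < e -> ev (fun x => c <= Rpower x e).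
Proof.
move=> He; apply: ev_imp (ev_ln (c / e)) => x Hx.
have : e * (c / e) <= e * ln x by apply: Rmult_le_compat_l; lra.
have -> : e * (c / e) = c by field; lra.
by rewrite /Rpower => H; have := exp_ineq1_le (e * ln x); lra.
Qed.

Lemma ev_poly_ln m a e d : 0 <= a -> 0 < e -> 0 < d ->
  ev (fun x => (1 + a * ln x) ^ m <= d * Rpower x e).
Proof.
move=> Ha He Hd.
(* [x^e] is split into [m + 1] equal factors, each at least [c * (1 + a1 * ln x)]. Only [m] of them
   are needed for the power on the left; the last one absorbs the constants. [a1] replaces [a] so as
   to be positive. *)
pose b := e / INR m.+1; pose a1 := a + 1; pose c := Rmin 1 (b / a1).
have Hm : 0 < INR m.+1 by exact: lt_0_INR1.
have Hb : 0 < b by exact: Rdiv_lt_0_compat.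
have Hba : 0 < b / a1 by apply: Rdiv_lt_0_compat => //; rewrite /a1; lra.
have Hc : 0 < c by apply: Rmin_pos; lra.
have Hc1 : c <= 1 by exact: Rmin_l.
have Hc2 : c * a1 <= b.
  have : c <= b / a1 by exact: Rmin_r.
  by move=> H; apply/Rle_div_r => //; rewrite /a1; lra.
have Hcp : 0 < c ^ m.+1 by exact: pow_lt.
apply: ev_imp (ev_and (ev_ln 0) (ev_ln (/ (d * c ^ m.+1)))) => x [H0 H1].
set s := ln x in H0 H1 *.
apply: (@Rle_trans _ ((1 + a1 * s) ^ m)).
  by apply: pow_incr; split; rewrite /a1; nra.
have -> : Rpower x e = exp (b * s) ^ m.+1.
  rewrite -Rpower_pow; last exact: exp_pos.
  by rewrite /Rpower ln_exp -/s; congr exp; rewrite /b; field; lra.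
have H2 : 0 <= c * (1 + a1 * s) <= exp (b * s).
  have := exp_ineq1_le (b * s) => H3.
  split; last by nra.
  by apply: Rmult_le_pos; [lra|rewrite /a1; nra].
have H3 := pow_incr _ _ m.+1 H2.
apply: (@Rle_trans _ (d * (c * (1 + a1 * s)) ^ m.+1)); last by apply: Rmult_le_compat_l => //; lra.
rewrite Rpow_mult_distr.
have H4 : 1 <= d * c ^ m.+1 * (1 + a1 * s).
  have H5 : 0 < d * c ^ m.+1 by nra.
  have : d * c ^ m.+1 * / (d * c ^ m.+1) <= d * c ^ m.+1 * s by apply: Rmult_le_compat_l; lra.
  rewrite Rinv_r; last by lra.
  rewrite /a1; nra.
have H6 : 0 <= (1 + a1 * s) ^ m by apply: pow_le; rewrite /a1; nra.
have -> : d * (c ^ m.+1 * (1 + a1 * s) ^ m.+1) = (d * c ^ m.+1 * (1 + a1 * s)) * (1 + a1 * s) ^ m.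
  by rewrite /=; ring.
nra.
Qed.

Lemma nfloor_spec x : 0 <= x -> INR (nfloor x) <= x < INR (nfloor x) + 1.
Proof.
move=> Hx; have [H1 H2] := base_Int_part x.
have Hz : (0 <= Int_part x)%Z.
  have : (-1 < Int_part x)%Z by apply: lt_IZR; lra.
  by lia.
by rewrite /nfloor INR_IZR_INZ Stdlib.ZArith.Znat.Z2Nat.id //; lra.
Qed.

Lemma nfloor_leP x n : 0 <= x -> ((n <= nfloor x)%N <-> INR n <= x).
Proof.
move=> Hx; have [H1 H2] := nfloor_spec Hx; split=> H.
  by have := INR_leq H; lra.
by have : INR n < INR (nfloor x).+1 by [rewrite S_INR; lra]; move/INR_lt; lia.
Qed.

Lemma nfloor_INR n : nfloor (INR n) = n.
Proof.
have [H1 H2] := nfloor_spec (pos_INR n).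
have A := INR_leq_inv H1.
have : INR n < INR (nfloor (INR n)).+1 by rewrite S_INR.
by move/INR_lt; lia.
Qed.

Lemma ln2_le1 : ln 2 <= 1.
Proof. by have := @ln_le_sub1 2; lra. Qed.

Lemma ln_nfloor v : 1 <= v -> ln v - 1 <= ln (INR (nfloor v)) <= ln v.
Proof.
move=> Hv; have H0 : 0 <= v by lra.
have [H1 H2] := nfloor_spec H0.
have H3 : 1 <= INR (nfloor v).
  by apply: INR_ge1; apply/nfloor_leP => //=.
split; last by apply: ln_le; lra.
have : ln v <= ln (2 * INR (nfloor v)) by apply: ln_le; lra.
by rewrite ln_mult; have := ln2_le1; lra.
Qed.

Lemma mertens_real : exists2 C, 0 < C &
  forall v, 1 <= v -> Rabs (mertens (nfloor v) - ln v) <= C.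
Proof.
have [C HC H] := mertens_first; exists (C + 1); first by lra.
move=> v Hv; have Hf : (0 < nfloor v)%N by apply/nfloor_leP; rewrite /=; lra.
have := H _ Hf; have := ln_nfloor Hv => H1.
by move/Rabs_le_between => H2; apply/Rabs_le; lra.
Qed.

Lemma mid_mass_cat a b c : (a <= b <= c)%N -> mid_mass a b + mid_mass b c <= mid_mass a c.
Proof.
move=> Habc; rewrite /mid_mass (@rsum1_trunc b c); last by lia.
rewrite -rsum1_plus; apply: rsum1_le => q Hq.
have Hi : 0 < / INR q by apply/Rinv_0_lt_compat/lt_0_INR1; lia.
rewrite /midp; case: (prime q) => /=; last by lra.
case: (leqP q b) => H1; case: (ltnP a q) => H2 /=; try lra.
by exfalso; lia.
Qed.

(** By Mertens the sum of [ln q / q] over [(v, v^2]] is at least [ln v - 2 C], and each [ln q] there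
    is at most [2 ln v]. *)
Lemma mid_mass_square : exists V, forall v, V <= v -> / 4 <= mid_mass (nfloor v) (nfloor (v ^ 2)).
Proof.
have [C HC H] := mertens_real.
have [V HV] := ev_and (ev_ge 2) (ev_ln (4 * C)).
exists V => v /HV [H2 HL].
have H1 := H v; have H3 := H (v ^ 2).
have Hl0 : 0 < ln v by lra.
have : 1 <= v ^ 2 by nra.
move=> {}/H3; have : 1 <= v by lra.
move=> {}/H1; rewrite {2}/pow Rmult_1_r ln_mult; try lra.
move/Rabs_le_between => A /Rabs_le_between B.
set a := nfloor v in A *; set b := nfloor (v ^ 2) in B *.
have Hab : (a <= b)%N.
  apply/nfloor_leP; first by nra.
  by have := @nfloor_spec v; rewrite -/a; nra.
suff : mertens b - mertens a <= 2 * ln v * mid_mass a b by nra.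
rewrite /mertens (@rsum1_trunc a b) // -rsum1_minus /mid_mass -rsum1_scal.
apply: rsum1_le => q Hq.
have Hq0 : 0 < INR q by apply: lt_0_INR1; lia.
have Hi := Rinv_0_lt_compat _ Hq0.
have Hlq : ln (INR q) <= 2 * ln v.
  have -> : 2 * ln v = ln (v ^ 2) by rewrite /= Rmult_1_r ln_mult; lra.
  apply: ln_le => //; apply/nfloor_leP; [nra|rewrite -/b; lia].
rewrite /midp; case: (prime q); rewrite /=; last by lra.
rewrite ltnNge; case: (q <= a)%N => /=; first by lra.
by rewrite /Rdiv; nra.
Qed.

(** The interval from [x^e] contains many successive squarings [v -> v^2], each contributing at
    least [1/4]; this is the divergence of the sum of [1/q] on a doubly logarithmic scale. *)
Lemma mid_mass_large (B : R) U : 0 < U -> exists2 e, 0 < e <= / U /\ e <= / 2 &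
  ev (fun x => B <= mid_mass (nfloor (Rpower x e)) (nfloor (Rpower x (1 / U)))).
Proof.
move=> HU; have [V HV] := mid_mass_square.
have [j Hj] : exists j : nat, 4 * B <= INR j by have [n Hn] := INR_unbounded (4 * B); exists n; lra.
have HI : forall i v, Rmax 1 V <= v -> INR i / 4 <= mid_mass (nfloor v) (nfloor (v ^ (2 ^ i)%N)).
  move=> i v Hv; have Hv1 : 1 <= v by have := Rmax_l 1 V; lra.
  elim: i => [|i IH].
    rewrite expn0 /=; have := mid_mass_ge0 (nfloor v) (nfloor (v * 1)); lra.
  set m := v ^ (2 ^ i)%N in IH *.
  have -> : v ^ (2 ^ i.+1)%N = m ^ 2 by rewrite /m -pow_mult; congr pow; rewrite expnS mulnC.
  have Hmv : v <= m.
    by rewrite -{1}(pow_1 v) /m; apply: Rle_pow => //; apply/leP; rewrite expn_gt0.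
  apply: Rle_trans (mid_mass_cat (b := nfloor m) _); last first.
    apply/andP; split; apply/nfloor_leP; try nra.
      by have := @nfloor_spec v; lra.
    by have := @nfloor_spec m; nra.
  have H4 : V <= m by have := Rmax_r 1 V; lra.
  by have := HV m H4; rewrite S_INR; lra.
have Hp : 1 <= INR (2 ^ j.+1) by apply: INR_ge1; rewrite expn_gt0.
have Hp2 : 0 < INR (2 ^ j.+1) by lra.
have HM := Rmax_l 2 U; have HM2 := Rmax_r 2 U.
(* After [j + 1] squarings [x^e] becomes [x^(1 / max(2, U))]; the maximum with 2 ensures
   [e <= 1/2]. *)
exists (/ (Rmax 2 U * INR (2 ^ j.+1))).
  split; first split.
  - by apply: Rinv_0_lt_compat; nra.
  - by apply: Rinv_le_contravar => //; nra.
  - by apply: Rinv_le_contravar; nra.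
set e := / _; have He : 0 < e by apply: Rinv_0_lt_compat; nra.
apply: ev_imp (ev_and (ev_Rpower (Rmax 1 V) He) (ev_ge 1)) => x [Hx Hx1].
apply: Rle_trans (Rle_trans _ _ _ (HI j.+1 _ Hx) _); first by rewrite S_INR; lra.
have -> : Rpower x e ^ (2 ^ j.+1)%N = Rpower x (/ Rmax 2 U).
  rewrite -Rpower_pow; last exact: exp_pos.
  by rewrite Rpower_mult /e; congr Rpower; field; lra.
set A := nfloor _; set Y := nfloor _; set Z := nfloor (Rpower x (1 / U)).
apply: rsum1_mono.
  apply/nfloor_leP; first exact/Rlt_le/exp_pos.
  have := @nfloor_spec (Rpower x (/ Rmax 2 U)); rewrite -/Y => H.
  apply: (@Rle_trans _ (Rpower x (/ Rmax 2 U))); first by apply H; exact/Rlt_le/exp_pos.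
  apply: Rle_Rpower => //; rewrite /Rdiv Rmult_1_l; apply: Rinv_le_contravar; lra.
move=> q Hq; apply: Rmult_le_pos; first exact: b2r_ge0.
by apply/Rlt_le/Rinv_0_lt_compat/lt_0_INR1; lia.
Qed.

(** Union bound: every [i <= d] not coprime to [d] is a multiple of some prime dividing [d]. *)
Lemma totient_defect d : (0 < d)%N -> INR d <= INR (totient d) +
  rsum1 d (fun p => b2r (prime p && (p %| d)) * (INR d / INR p)).
Proof.
move=> Hd.
have -> : INR (totient d) = rsum1 d (fun i => b2r (coprime d i)).
  rewrite totient_count_coprime; transitivity (rsum1 d (fun i => b2r (coprime d (i.-1)))).
    elim: {1 3}d => [|n IH]; first by rewrite big_geq.
    by rewrite big_nat_recr //= INR_addn IH rsum1S /=; case: (coprime d n).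
  (* The residues [0] and [D] have the same gcd with [D], which moves the count from [0 .. D-1] to
     [1 .. D]. *)
  case: d Hd => // n _; move: {1 3}n.+1 (erefl n.+1) => D HD.
  have H : forall m, rsum1 m.+1 (fun i => b2r (coprime D i.-1)) + b2r (coprime D m.+1) = rsum1 m.+1 (fun i => b2r (coprime D i)) + b2r (coprime D 0).
    elim=> [|m IH]; first by rewrite !rsum1S !rsum10 /=; ring.
    by rewrite rsum1S (rsum1S m.+1) /=; lra.
  have := H n; rewrite HD /coprime gcdn0 gcdnn; lra.
rewrite -{1}[INR d]Rmult_1_r -rsum1_const.
apply: (@Rle_trans _ (rsum1 d (fun i => b2r (coprime d i) + rsum1 d (fun p => b2r (prime p && (p %| d)) * b2r (p %| i))))).
  apply: rsum1_le => i Hi.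
  have H0 : forall p, (1 <= p <= d)%N -> 0 <= b2r (prime p && (p %| d)) * b2r (p %| i).
    by move=> p _; apply: Rmult_le_pos; exact: b2r_ge0.
  case: (boolP (coprime d i)) => Hc; first by have := rsum1_ge0 H0; rewrite /=; lra.
  rewrite [b2r false]/= Rplus_0_l.
  have Hg : (1 < gcdn d i)%N.
    by move: Hc; rewrite /coprime; have : (0 < gcdn d i)%N by [rewrite gcdn_gt0 Hd]; lia.
  have Hp := pdiv_prime Hg; have Hpd := pdiv_dvd (gcdn d i); set p := pdiv _ in Hp Hpd.
  move: Hpd; rewrite dvdn_gcd => /andP[H1 H2].
  apply: Rle_trans (rsum1_ge_term (i := p) _ H0); first by rewrite Hp H1 H2 /=; lra.
  by rewrite prime_gt0 //=; exact: dvdn_leq.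
rewrite rsum1_plus; apply: Rplus_le_compat_l.
rewrite rsum1_swap; apply: rsum1_le => p Hp; rewrite rsum1_scal.
by apply: Rmult_le_compat_l; [exact: b2r_ge0|apply: count_dvd_le; lia].
Qed.

(** A rough [d <= N] has at most [K] prime factors, each at least [z + 1], so its totient defect is
    at most [d * K / (z + 1)], which is at most half of [d]. *)
Lemma totient_rough N z K d : (0 < z)%N -> (N <= z.+1 ^ K)%N -> (1 <= d <= N)%N ->
  rough z d -> 2 * INR K <= INR z.+1 ->
  0 <= / INR (totient d) - / INR d <= 2 * INR K / INR z.+1 * / INR d.
Proof.
move=> Hz HN Hd Hr HK; have Hd0 : (0 < d)%N by lia.
have HD := lt_0_INR1 Hd0; have HZ : 0 < INR z.+1 by exact: lt_0_INR1.
have H1 := totient_defect Hd0.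
have H2 : rsum1 d (fun p => b2r (prime p && (p %| d)) * (INR d / INR p)) <= INR d / INR z.+1 * INR K.
  apply: Rle_trans (Rmult_le_compat_l _ _ _ _ (mid_count_le d Hz HN Hd)); last first.
    by apply/Rlt_le/Rdiv_lt_0_compat.
  rewrite /mid_count -rsum1_scal; apply: rsum1_le => p Hp.
  rewrite /midp; case: (boolP (prime p)) => Pp; last by rewrite /=; lra.
  case: (boolP (p %| d)) => Dp; last by rewrite /= !Rmult_0_l Rmult_0_r Rmult_0_r; lra.
  have Hzp : (z < p)%N by apply: (allP Hr); rewrite mem_primes Pp Hd0.
  rewrite Hzp [b2r _]/= Rmult_1_l !Rmult_1_r; apply: Rmult_le_compat_l; first by lra.
  by apply: Rinv_le_contravar => //; exact: INR_leq.
have H3 : INR K / INR z.+1 <= / 2 by apply/Rle_div_l => //; lra.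
set t := INR (totient d) in H1 *.
have E : INR d / INR z.+1 * INR K = INR d * (INR K / INR z.+1) by rewrite /Rdiv; ring.
rewrite E in H2; set k := INR K / INR z.+1 in E H2 H3 *.
have Ht : INR d / 2 <= t by nra.
have Htd : t <= INR d.
  apply: INR_leq; rewrite /t totient_count_coprime.
  apply: leq_trans (_ : \sum_(0 <= i < d) 1 <= d)%N; last by rewrite big_const_nat iter_addn subn0 mul1n addn0.
  by apply: leq_sum => i _; case: coprime.
have Ht0 : 0 < t by lra.
have -> : / t - / INR d = (INR d - t) * / t * / INR d by field; lra.
have Hit : / t <= 2 / INR d.
  have -> : 2 / INR d = / (INR d / 2) by field; lra.
  by apply: Rinv_le_contravar; lra.
have Hit0 := Rinv_0_lt_compat _ Ht0; have Hid0 := Rinv_0_lt_compat _ HD.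
split; first by apply: Rmult_le_pos; [apply: Rmult_le_pos|]; lra.
apply: Rmult_le_compat_r; first by lra.
have -> : 2 * INR K / INR z.+1 = (INR d * k) * (2 / INR d) by rewrite /k; field; lra.
by apply: Rmult_le_compat; lra.
Qed.

(** * Transfer from integers to shifted primes *)

Lemma prime_pi_INR N : prime_pi (INR N) = rsum1 N (fun p => b2r (prime p)).
Proof. by rewrite /prime_pi nfloor_INR -(count_rsum1 prime) /= add0n. Qed.

Lemma rsum1_shift N F : F 1%N = 0 ->
  rsum1 N F = rsum1 N (fun n => b2r (n.+1 <= N)%N * F n.+1).
Proof.
move=> HF; case: N => [|N] //.
have H : forall M, rsum1 M.+1 F = F 1%N + rsum1 M (fun n => F n.+1).
  by elim=> [|M IH]; rewrite rsum1S ?IH ?rsum10 ?rsum1S; ring.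
rewrite H HF rsum1S ltnn (@rsum1_ext N (fun n => b2r (n.+1 <= N.+1)%N * F n.+1) (fun n => F n.+1)).
  by rewrite /=; ring.
by move=> n Hn; have -> : (n.+1 <= N.+1)%N by [lia]; rewrite /=; ring.
Qed.

(** The uniform probability on the primes [p <= N], carried by [n = p - 1]; its mass on multiples of
    [d] is the proportion of primes congruent to 1 modulo [d]. *)
Definition primew (N n : nat) : R := b2r (prime n.+1 && (n.+1 <= N)%N) / prime_pi (INR N).

Lemma primew_sum N f : rsum1 N (fun n => f n * primew N n) =
  rsum1 N (fun p => b2r (prime p) * f p.-1) / prime_pi (INR N).
Proof.
rewrite (@rsum1_shift N (fun p => b2r (prime p) * f p.-1)); last by rewrite /=; ring.
rewrite /Rdiv -rsum1_scalr; apply: rsum1_ext => n _.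
by rewrite /primew b2r_and /Rdiv /=; ring.
Qed.

Lemma primew_mass N d : mass N (primew N) d = prime_pi_ap (INR N) d / prime_pi (INR N).
Proof.
rewrite /mass primew_sum; congr (_ / _).
rewrite /prime_pi_ap nfloor_INR [iota 0 N.+1]/= [count _ _]/= add0n.
rewrite (count_rsum1 (fun p => prime p && (p == 1 %[mod d])%N)).
apply: rsum1_ext => p Hp; rewrite b2r_and eqn_mod_dvd; last by lia.
by rewrite subn1.
Qed.

Lemma prime_pi_pos N : (2 <= N)%N -> 0 < prime_pi (INR N).
Proof.
move=> HN; rewrite prime_pi_INR.
have := @rsum1_ge_term N (fun p => b2r (prime p)) 2; rewrite /= => H.
apply: (Rlt_le_trans _ 1); first by lra.
by apply: H => // j _; exact: b2r_ge0.
Qed.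

Lemma primew_total N : (2 <= N)%N -> rsum1 N (primew N) = 1.
Proof.
move=> /prime_pi_pos HN.
rewrite (@rsum1_ext N _ (fun n => 1 * primew N n)); last by move=> n _; ring.
rewrite primew_sum prime_pi_INR in HN *.
rewrite (@rsum1_ext N (fun p => b2r (prime p) * 1) (fun p => b2r (prime p))); last by move=> n _; ring.
by field; lra.
Qed.

Lemma discrepancy_unif N D z : (0 < N)%N ->
  discrepancy N D z (fun=> / INR N) <= INR D / INR N.
Proof.
move=> HN; have H0 := lt_0_INR1 HN; have Hi := Rinv_0_lt_compat _ H0.
rewrite /Rdiv -rsum1_const; apply: rsum1_le => d Hd.
have Hd0 : (0 < d)%N by lia.
have Hd1 := lt_0_INR1 Hd0.
rewrite /mass rsum1_scalr count_dvd //.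
have H1 := divn_le_INR N Hd0; have H2 := divn_ge_INR N Hd0.
have : Rabs (INR (N %/ d) * / INR N - / INR d) <= / INR N.
  have -> : INR (N %/ d) * / INR N - / INR d = (INR (N %/ d) - INR N / INR d) * / INR N by field; lra.
  rewrite Rabs_mult (Rabs_pos_eq (/ INR N)); last by lra.
  rewrite -{2}[/ INR N]Rmult_1_l; apply: Rmult_le_compat_r; first by lra.
  by apply/Rabs_le; lra.
have := b2r_ge0 (rough z d); have := b2r_le1 (rough z d).
have := Rabs_pos (INR (N %/ d) * / INR N - / INR d); nra.
Qed.

(** Replacing [1/phi(d)] by [1/d] on rough moduli costs a relative [2 K / (z + 1)]; summing over [d]
    produces the logarithm. *)
Lemma discrepancy_prime N D z K e : (2 <= N)%N -> (D <= N)%N -> (0 < z)%N ->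
  (N <= z.+1 ^ K)%N -> 2 * INR K <= INR z.+1 ->
  rsum1 D (fun d => Rabs (prime_pi_ap (INR N) d - prime_pi (INR N) / INR (totient d)))
    <= e * prime_pi (INR N) ->
  discrepancy N D z (primew N) <= e + 2 * INR K / INR z.+1 * (1 + ln (INR N)).
Proof.
move=> HN DN Hz NK HK Heh; have Hpi := prime_pi_pos HN.
have Hc : 0 <= 2 * INR K / INR z.+1.
  by apply: Rdiv_le_0_compat; [have := pos_INR K; lra|exact: lt_0_INR1].
apply: (@Rle_trans _ (rsum1 D (fun d => Rabs (prime_pi_ap (INR N) d - prime_pi (INR N) / INR (totient d)) * / prime_pi (INR N) + 2 * INR K / INR z.+1 * / INR d))).
  apply: rsum1_le => d Hd.
  have Hid : 0 < / INR d by apply/Rinv_0_lt_compat/lt_0_INR1; lia.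
  have Hip := Rinv_0_lt_compat _ Hpi.
  case: (boolP (rough z d)) => Hr; last first.
    rewrite /= Rmult_0_l; apply: Rplus_le_le_0_compat.
      by apply: Rmult_le_pos; [exact: Rabs_pos|lra].
    by apply: Rmult_le_pos => //; lra.
  rewrite [b2r _]/= Rmult_1_l.
  have Hd' : (1 <= d <= N)%N by lia.
  have Ht := totient_rough Hz NK Hd' Hr HK.
  have Htp : INR (totient d) <> 0.
    by apply/not_0_INR; have : (0 < totient d)%N by [rewrite totient_gt0; lia]; lia.
  have -> : mass N (primew N) d - / INR d = (prime_pi_ap (INR N) d - prime_pi (INR N) / INR (totient d)) * / prime_pi (INR N) + (/ INR (totient d) - / INR d).
    by rewrite primew_mass; field; repeat split => //; try lra; apply/not_0_INR; lia.
  apply: Rle_trans (Rabs_triang _ _) _; rewrite Rabs_mult (Rabs_pos_eq (/ prime_pi _)); last by lra.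
  by apply: Rplus_le_compat_l; rewrite Rabs_pos_eq; lra.
rewrite rsum1_plus rsum1_scalr rsum1_scal; apply: Rplus_le_compat.
  by apply/Rle_div_l.
apply: Rmult_le_compat_l => //; apply: Rle_trans (harmonic_le N).
by apply: rsum1_mono => // d Hd; apply/Rlt_le/Rinv_0_lt_compat/lt_0_INR1; lia.
Qed.

Lemma le_nfloor_pow N a K : (1 <= N)%N -> 0 < a -> 1 <= a * INR K ->
  (N <= (nfloor (Rpower (INR N) a)).+1 ^ K)%N.
Proof.
move=> HN Ha HK; have H1 := INR_ge1 HN.
have Hp : 0 < Rpower (INR N) a by exact: exp_pos.
apply: INR_leq_inv.
have -> : INR ((nfloor (Rpower (INR N) a)).+1 ^ K)%N = INR (nfloor (Rpower (INR N) a)).+1 ^ K.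
  by elim: K {HK} => [|K IH] //; rewrite expnS INR_muln IH.
apply: (@Rle_trans _ (Rpower (INR N) a ^ K)); last first.
  by apply: pow_incr; rewrite S_INR; have := @nfloor_spec (Rpower (INR N) a); lra.
rewrite -Rpower_pow // Rpower_mult -{1}(Rpower_1 (INR N)); last by lra.
exact: Rle_Rpower.
Qed.

(** As [(K' + 3) * delta <= 1], the second moment bound says that the integers without a middle
    prime have mass at most [2 / mid_mass z Y]. The lower bound on [mid_mass] then makes [2 ^ K]
    times that mass at most [eta / 4], and [delta] uses another [eta / 4]. *)
Lemma avoids_approx_final N D z Y K K' w delta eta L :
  (forall n, 0 <= w n) -> rsum1 N w = 1 -> (D <= N)%N ->
  (forall d, (d * z.+1 <= N)%N -> (d <= D)%N) -> (z <= Y)%N -> (Y * Y <= D)%N ->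
  (0 < z)%N -> (N <= Y.+1 ^ K)%N -> (N <= z.+1 ^ K')%N ->
  discrepancy N D z w <= delta -> 0 < eta ->
  1 <= mid_mass z Y -> 2 ^ K * 8 / eta <= mid_mass z Y ->
  delta <= / (INR K' + 3) -> delta <= eta / 4 ->
  uniq L -> all prime L -> all (fun p => (Y < p)%N) L ->
  Rabs (rsum1 N (fun n => b2r (avoids L n) * w n) - rsum1 D (fun d => mobL (-1) L d * / INR d))
   <= eta / 2.
Proof.
move=> H1 H2 H3 H4 H5 H6 H7 H8 H9 H10 Heta Hm1 HmB Hd1 Hd2 Hu HL HY.
apply: Rle_trans (avoids_approx H1 H3 H4 H5 H6 H7 H8 H9 H10 Hu HL HY) _.
have H11 := no_mid_prime_mass H1 H2 H3 H5 H6 H7 H8 H9 H10.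
have Hd0 := delta_ge0 H10.
set m := mid_mass z Y in Hm1 HmB H11.
set r := rsum1 N _ in H11 *.
have HK' := pos_INR K'.
have H12 : (INR K' + 3) * delta <= 1.
  by apply/(Rle_trans _ _ _ (Rmult_le_compat_l _ _ _ _ Hd1)); [lra|rewrite Rinv_r; lra].
have H13 : m * r <= 2.
  apply: (Rmult_le_reg_l m); first by lra.
  have X1 : (INR K' + 1 + 2 * m) * delta <= m * ((INR K' + 3) * delta).
    have -> : m * ((INR K' + 3) * delta) = (m * INR K' + m + 2 * m) * delta by ring.
    by apply: Rmult_le_compat_r => //; nra.
  have X2 : m * ((INR K' + 3) * delta) <= m * 1 by apply: Rmult_le_compat_l; lra.
  have X3 : m * (m * r) = m ^ 2 * r by ring.
  lra.
have Hr : 0 <= r by apply: rsum1_ge0 => n _; apply: Rmult_le_pos => //; exact: b2r_ge0.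
have H2K : 0 < 2 ^ K by apply: pow_lt; lra.
have : 2 ^ K * r <= eta / 4.
  have H14 : 2 ^ K * 8 / eta * r <= 2 by nra.
  have -> : 2 ^ K * r = (2 ^ K * 8 / eta * r) * (eta / 8) by field; lra.
  nra.
lra.
Qed.

(** The order of choices matters: [K] from [U], then [e] so small that the middle primes outweigh
    [2 ^ K * 8 / eta], then [K'] from [e], then [delta]; only then is the hypothesis applied, with
    exponent [1 - e] and precision [delta / 2]. The threshold is uniform in [L]. *)
Lemma EH_transfer : EH_hypothesis -> forall U eta, 4 <= U -> 0 < eta ->
  ev (fun x => forall N, x = INR N -> forall L, uniq L -> all prime L ->
    all (fun p => (nfloor (Rpower x (1 / U)) < p)%N) L ->
    Rabs (rsum1 N (fun n => b2r (avoids L n) * primew N n)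
        - rsum1 N (fun n => b2r (avoids L n)) / INR N) <= eta).
Proof.
move=> EH U eta HU Heta.
have [K HK] : exists K : nat, U <= INR K by have [n Hn] := INR_unbounded U; exists n; lra.
have H2K : 0 < 2 ^ K by apply: pow_lt; lra.
pose B := Rmax 1 (2 ^ K * 8 / eta).
have HU0 : 0 < U by lra.
have [e [[He0 HeU] He2] Hev] := mid_mass_large B HU0.
have [K' HK'] : exists K' : nat, / e <= INR K' by have [n Hn] := INR_unbounded (/ e); exists n; lra.
pose delta := Rmin (eta / 4) (/ (INR K' + 3)).
have HK0 := pos_INR K'.
have Hdel : 0 < delta by apply: Rmin_pos; [lra|apply: Rinv_0_lt_compat; lra].
have Hd2 : 0 < delta / 2 by lra.
have HEH : ev (fun x => rsum1 (nfloor (Rpower x (1 - e)))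
  (fun d => Rabs (prime_pi_ap x d - prime_pi x / INR (totient d))) <= delta / 2 * prime_pi x).
  exact: EH.
have Hc : 0 < 2 * INR K' + 1 by lra.
have Hc2 : 0 < delta / 2 / (2 * INR K' + 1) by exact: Rdiv_lt_0_compat.
have Hlog := @ev_poly_ln 1 1 e _ (Rle_0_1) He0 Hc2.
have := ev_and (ev_and (ev_and Hev HEH) (ev_and Hlog (ev_Rpower (2 * INR K') He0))) (ev_and (ev_ge 2) (ev_Rpower (/ delta) He0)).
apply: ev_imp => x [[[Hmid {}HEH] [{}Hlog HK2]] [Hx2 Hxd]] N HN L Hu HL HY.
have Hx0 : 0 < x by lra.
have HN2 : (2 <= N)%N by apply: INR_leq_inv; rewrite -HN.
have Hpow : forall a, 0 <= Rpower x a by move=> a; exact/Rlt_le/exp_pos.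
set z := nfloor (Rpower x e) in Hmid *; set Y := nfloor (Rpower x (1 / U)) in HY Hmid *.
set D := nfloor (Rpower x (1 - e)) in HEH *.
have Sz := nfloor_spec (Hpow e); have SY := nfloor_spec (Hpow (1 / U)); have SD := nfloor_spec (Hpow (1 - e)).
rewrite -/z in Sz; rewrite -/Y in SY; rewrite -/D in SD.
have Hz1 : INR z.+1 = INR z + 1 by exact: S_INR.
(* With [e <= 1/2] this gives [2 / U <= 1 - e], which is what [Y * Y <= D] asks for. *)
have Hiu : 1 / U <= / 4 by rewrite /Rdiv Rmult_1_l; apply: Rinv_le_contravar; lra.
have A1 : (D <= N)%N.
  apply: INR_leq_inv; rewrite -HN; apply: Rle_trans (proj1 SD) _.
  by rewrite -{2}(Rpower_1 x) //; apply: Rle_Rpower; lra.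
have A2 : forall d, (d * z.+1 <= N)%N -> (d <= D)%N.
  move=> d /INR_leq; rewrite INR_muln Hz1 -HN => Hd; apply/nfloor_leP => //.
  have -> : Rpower x (1 - e) = x / Rpower x e.
    by rewrite /Rminus Rpower_plus Rpower_1 // Rpower_Ropp.
  apply/Rle_div_r; first exact: exp_pos.
  have := pos_INR d; nra.
have A3 : (z <= Y)%N.
  apply/nfloor_leP => //; apply: Rle_trans (proj1 Sz) _.
  by apply: Rle_Rpower; [lra|rewrite /Rdiv Rmult_1_l].
have A4 : (Y * Y <= D)%N.
  apply/nfloor_leP => //; rewrite INR_muln.
  apply: (@Rle_trans _ (Rpower x (1 / U) * Rpower x (1 / U))).
    by have := pos_INR Y; nra.
  by rewrite -Rpower_plus; apply: Rle_Rpower; lra.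
have A5 : (0 < z)%N.
  apply/nfloor_leP => //; rewrite [INR 1]/= -(Rpower_O x) //; apply: Rle_Rpower; lra.
have A6 : (N <= Y.+1 ^ K)%N.
  rewrite /Y HN; apply: le_nfloor_pow; first by lia.
  - by apply: Rdiv_lt_0_compat; lra.
  - have -> : 1 / U * INR K = INR K / U by field; lra.
    by apply/Rle_div_r; lra.
have A7 : (N <= z.+1 ^ K')%N.
  rewrite /z HN; apply: le_nfloor_pow => //; first by lia.
  apply: Rle_trans (Rmult_le_compat_l _ _ _ _ HK'); last by lra.
  by rewrite Rinv_r; lra.
have HB1 := Rmax_l 1 (2 ^ K * 8 / eta); have HB2 := Rmax_r 1 (2 ^ K * 8 / eta).
rewrite -/B in HB1 HB2.
have Hdl1 : delta <= / (INR K' + 3) by exact: Rmin_r.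
have Hdl2 : delta <= eta / 4 by exact: Rmin_l.
have M1 : 1 <= mid_mass z Y by lra.
have M2 : 2 ^ K * 8 / eta <= mid_mass z Y by lra.
have D1 : discrepancy N D z (fun=> / INR N) <= delta.
  apply: Rle_trans (discrepancy_unif _ _ _) _; first by lia.
  rewrite -HN; apply/Rle_div_l => //; apply: Rle_trans (proj1 SD) _.
  have -> : Rpower x (1 - e) = x / Rpower x e.
    by rewrite /Rminus Rpower_plus Rpower_1 // Rpower_Ropp.
  rewrite Rmult_comm; apply: Rmult_le_compat_l; first by lra.
  rewrite -(Rinv_inv delta); apply: Rinv_le_contravar => //.
  exact: Rinv_0_lt_compat.
have D2 : discrepancy N D z (primew N) <= delta.
  rewrite HN in HEH; apply: Rle_trans (discrepancy_prime HN2 A1 A5 A7 _ HEH) _.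
    by rewrite Hz1; lra.
  have Hz0 : 0 < INR z.+1 by exact: lt_0_INR1.
  have -> : 2 * INR K' / INR z.+1 * (1 + ln (INR N)) = 2 * INR K' * (1 + ln (INR N)) / INR z.+1 by field; lra.
  suff : 2 * INR K' * (1 + ln (INR N)) / INR z.+1 <= delta / 2 by lra.
  apply/Rle_div_l => //; rewrite -HN Hz1.
  move: Hlog; rewrite /= !Rmult_1_r Rmult_1_l => Hlog.
  have Hl0 : 0 <= ln x by apply: ln_ge0; lra.
  apply: (@Rle_trans _ ((2 * INR K' + 1) * (1 + ln x))); first by nra.
  apply: Rle_trans (Rmult_le_compat_l _ _ _ _ Hlog) _; first by lra.
  have -> : (2 * INR K' + 1) * (delta / 2 / (2 * INR K' + 1) * Rpower x e) = delta / 2 * Rpower x e by field; lra.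
  by nra.
have W1 : forall n : nat, 0 <= / INR N by move=> _; apply/Rlt_le/Rinv_0_lt_compat/lt_0_INR1; lia.
have W2 : forall n, 0 <= primew N n.
  by move=> n; apply: Rdiv_le_0_compat; [exact: b2r_ge0|exact: prime_pi_pos].
have T1 : rsum1 N (fun=> / INR N) = 1 by rewrite rsum1_const Rinv_r // -HN; lra.
have R1 := avoids_approx_final W1 T1 A1 A2 A3 A4 A5 A6 A7 D1 Heta M1 M2 Hdl1 Hdl2 Hu HL HY.
have R2 := avoids_approx_final W2 (primew_total HN2) A1 A2 A3 A4 A5 A6 A7 D2 Heta M1 M2 Hdl1 Hdl2 Hu HL HY.
rewrite rsum1_scalr in R1.
move/Rabs_le_between: R1 => R1; move/Rabs_le_between: R2 => R2.
by rewrite /Rdiv in R1 R2 *; apply/Rabs_le; lra.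
Qed.

(** * The renewal inequality *)

Definition good (bad : pred nat) (n : nat) : bool := all (fun p => ~~ bad p) (primes n).

Definition goodcount (bad : pred nat) (n : nat) : R := rsum1 n (fun m => b2r (good bad m)).

Definition goodp (bad : pred nat) (p : nat) : R := b2r (prime p && ~~ bad p).

Lemma goodp_ge0 bad p : 0 <= goodp bad p.
Proof. exact: b2r_ge0. Qed.

Lemma goodp_le bad p : goodp bad p <= b2r (prime p).
Proof. by apply: b2r_imp => /andP[]. Qed.

(** Goodness depends only on the set of prime factors, hence is completely multiplicative; this
    matches the exact double sum in [sum_ln_rad]. *)
Lemma good_mul bad p m : prime p -> (0 < m)%N -> good bad (p * m) = ~~ bad p && good bad m.
Proof.
move=> Hp Hm; have Hp0 := prime_gt0 Hp.
apply/allP/andP => [H|[H1 /allP H2] q].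
  split; first by apply: H; rewrite mem_primes Hp muln_gt0 Hp0 Hm dvdn_mulr.
  apply/allP => q; rewrite mem_primes => /and3P[Pq _ Dq].
  by apply: H; rewrite mem_primes Pq muln_gt0 Hp0 Hm dvdn_mull.
rewrite mem_primes => /and3P[Pq _]; rewrite Euclid_dvdM // => /orP[|Dq].
  by rewrite dvdn_prime2 // => /eqP ->.
by apply: H2; rewrite mem_primes Pq Hm.
Qed.

(** For good [m <= n], replacing [ln n] by [ln m] costs at most [n] in total, and replacing [ln m]
    by the logarithm of its radical costs [ln_rad_excess]. The constant is uniform in [bad]. *)
Lemma goodcount_renewal : exists2 C, 0 < C & forall bad n, (0 < n)%N ->
  Rabs (goodcount bad n * ln (INR n)
    - rsum1 n (fun p => goodp bad p * (ln (INR p) * goodcount bad (n %/ p)))) <= C * INR n.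
Proof.
have [C HC H] := ln_rad_excess; exists (C + 1); first by lra.
move=> bad n Hn; have Hn0 := lt_0_INR1 Hn.
have E : rsum1 n (fun p => goodp bad p * (ln (INR p) * goodcount bad (n %/ p))) =
   rsum1 n (fun m => b2r (good bad m) * ln_rad n m).
  rewrite sum_ln_rad; apply: rsum1_ext => p Hp; rewrite /goodp /goodcount.
  case: (boolP (prime p)) => Pp /=; last by ring.
  rewrite (@rsum1_ext (n %/ p) (fun m => b2r (good bad (p * m))) (fun m => b2r (~~ bad p) * b2r (good bad m))).
    by rewrite rsum1_scal; ring.
  by move=> m Hm; rewrite good_mul // ?b2r_and //; lia.
have -> : goodcount bad n * ln (INR n) - rsum1 n (fun p => goodp bad p * (ln (INR p) * goodcount bad (n %/ p)))
  = rsum1 n (fun m => b2r (good bad m) * ((ln (INR n) - ln (INR m)) + (ln (INR m) - ln_rad n m))).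
  rewrite E /goodcount -rsum1_scalr -rsum1_minus; apply: rsum1_ext => m _; ring.
have T : forall m, (1 <= m <= n)%N -> 0 <= (ln (INR n) - ln (INR m)) + (ln (INR m) - ln_rad n m).
  move=> m Hm; have := ln_rad_le Hm.
  have : ln (INR m) <= ln (INR n) by apply: ln_le; [apply: lt_0_INR1; lia|apply: INR_leq; lia].
  lra.
rewrite Rabs_pos_eq; last first.
  by apply: rsum1_ge0 => m Hm; apply: Rmult_le_pos; [exact: b2r_ge0|exact: T].
apply: (@Rle_trans _ (rsum1 n (fun m => (ln (INR n) - ln (INR m)) + (ln (INR m) - ln_rad n m)))).
  apply: rsum1_le => m Hm; have := T m Hm; have := b2r_le1 (good bad m); have := b2r_ge0 (good bad m); nra.
rewrite rsum1_plus rsum1_minus rsum1_const.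
by have := H n; have := sum_ln_ge n; lra.
Qed.

(** Write [ln n = ln p + ln (n / p)]: the first part gives [theta], and the sum of [ln (n / m)] over
    all integers [m <= n] is at most [n]. *)
Lemma pi_ln_le : exists2 C, 0 < C & forall n,
  rsum1 n (fun p => b2r (prime p)) * ln (INR n) <= C * INR n.
Proof.
have [C HC H] := theta_le; exists (C + 1); first by lra.
move=> n; rewrite -rsum1_scalr.
apply: (@Rle_trans _ (rsum1 n (fun p => b2r (prime p) * ln (INR p) + (ln (INR n) - ln (INR p))))).
  apply: rsum1_le => p Hp.
  have : ln (INR p) <= ln (INR n) by apply: ln_le; [apply: lt_0_INR1; lia|apply: INR_leq; lia].
  by case: (prime p) => /=; lra.
rewrite rsum1_plus rsum1_minus rsum1_const.
by have := H n; have := sum_ln_ge n; rewrite /theta; lra.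
Qed.

Lemma Rpower_ge1 y s : 1 <= y -> 0 <= s -> 1 <= Rpower y s.
Proof.
move=> Hy Hs; rewrite -(Rpower_O y); last by lra.
by apply: Rle_Rpower.
Qed.

Lemma ln_Rpower y s : ln (Rpower y s) = s * ln y.
Proof. by rewrite /Rpower ln_exp. Qed.

Lemma exp_le_compat a b : a <= b -> exp a <= exp b.
Proof. by case=> [H|->]; [left; exact: exp_increasing|right]. Qed.

Lemma le_Rpower_ln y s x : 0 < x -> (x <= Rpower y s <-> ln x <= s * ln y).
Proof.
move=> Hx; rewrite -ln_Rpower; split=> H; first exact: ln_le.
by rewrite -(exp_ln x) // -(exp_ln (Rpower y s)); [apply: exp_le_compat|exact: exp_pos].
Qed.

(* The error [E n = |S(n)/n - sigma(t_n)|] satisfies a discrete renewal inequality;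
   bounds propagate from [y^v] to [y^(v+1/2)] since half of the Mertens mass
   sits on [p <= y^(1/2)]. *)
Lemma renewal_stability : exists2 C0, 0 < C0 & forall U, 1 < U -> exists2 c, 0 < c &
  forall (y : R) (bad : pred nat) (sigma : R -> R) (e1 e2 : R),
  C0 <= ln y -> 0 <= e1 -> 0 <= e2 ->
  (forall p, prime p -> INR p <= y -> ~~ bad p) ->
  (forall t, t <= 1 -> sigma t = 1) ->
  (forall t, t <= U -> 0 <= sigma t <= 1) ->
  (forall a b, a <= U -> b <= U -> Rabs (a - b) <= / ln y -> Rabs (sigma a - sigma b) <= e2) ->
  (forall n, (0 < n)%N -> y < INR n <= Rpower y U ->
     Rabs (rsum1 n (fun p => goodp bad p * (ln (INR p) / INR p) * sigma (ln (INR n) / ln y - ln (INR p) / ln y)) / ln y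
        - ln (INR n) / ln y * sigma (ln (INR n) / ln y)) <= e1) ->
  forall n, (0 < n)%N -> INR n <= Rpower y U ->
    Rabs (goodcount bad n / INR n - sigma (ln (INR n) / ln y)) <= c * (e1 + e2 + / ln y).
Proof.
have [C1 HC1 Hren] := goodcount_renewal.
have [C2 HC2 Hth] := theta_le.
have [C3 HC3 Hmer] := mertens_real.
have [C4 HC4 Hmern] := mertens_first.
(* This makes [(C3 + C4) / ln y <= 1/4], so that the primes up to [y^(1/2)] carry at most [3/4] of
   [ln y]: the contraction factor below. *)
pose C0 := 4 * (C3 + C4) + 1; exists C0; first by rewrite /C0; lra.
move=> U HU.
(* The constant may grow with [j] but is chosen before [y], [bad] and [sigma]; [j] about [2 U] steps
   reach [y^U]. *)
have Hcj : forall j : nat, exists2 c, 0 <= c & forall (y : R) (bad : pred nat) (sigma : R -> R) (e1 e2 : R),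
  C0 <= ln y -> 0 <= e1 -> 0 <= e2 ->
  (forall p, prime p -> INR p <= y -> ~~ bad p) ->
  (forall t, t <= 1 -> sigma t = 1) ->
  (forall t, t <= U -> 0 <= sigma t <= 1) ->
  (forall a b, a <= U -> b <= U -> Rabs (a - b) <= / ln y -> Rabs (sigma a - sigma b) <= e2) ->
  (forall n, (0 < n)%N -> y < INR n <= Rpower y U ->
     Rabs (rsum1 n (fun p => goodp bad p * (ln (INR p) / INR p) * sigma (ln (INR n) / ln y - ln (INR p) / ln y)) / ln y
        - ln (INR n) / ln y * sigma (ln (INR n) / ln y)) <= e1) ->
  forall n, (0 < n)%N -> INR n <= Rpower y U -> ln (INR n) <= (1 + INR j / 2) * ln y ->
    Rabs (goodcount bad n / INR n - sigma (ln (INR n) / ln y)) <= c * (e1 + e2 + / ln y); last first.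
  have [j Hj] : exists j : nat, 2 * U <= INR j by have [n Hn] := INR_unbounded (2 * U); exists n; lra.
  have [c Hc H] := Hcj j; exists (c + 1); first by lra.
  move=> y bad sigma e1 e2 Hy He1 He2 Hbad Hs1 Hs2 Hs3 Hs4 n Hn HnU.
  have HT : 0 < ln y by rewrite /C0 in Hy; lra.
  have Hi := Rinv_0_lt_compat _ HT.
  apply: Rle_trans (H y bad sigma e1 e2 Hy He1 He2 Hbad Hs1 Hs2 Hs3 Hs4 n Hn HnU _) _.
    have := proj1 (le_Rpower_ln y U (lt_0_INR1 Hn)) HnU; nra.
  by apply: Rmult_le_compat_r; lra.
elim=> [|j [c Hc IH]].
  exists 0; first by lra.
  move=> y bad sigma e1 e2 Hy He1 He2 Hbad Hs1 Hs2 Hs3 Hs4 n Hn HnU Hnj.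
  have HT : 0 < ln y by rewrite /C0 in Hy; lra.
  have Hn0 := lt_0_INR1 Hn.
  have Hln : ln (INR n) <= ln y by move: Hnj; rewrite [INR 0]/=; lra.
  have Hy0 : 0 < y by exact: ln_gt0_pos HT.
  have Hny : INR n <= y by case: (Rle_dec (INR n) y) => // /Rnot_le_lt /(ln_increasing _ _ Hy0); lra.
  rewrite Hs1; last by apply/Rle_div_l; lra.
  have -> : goodcount bad n = INR n.
    rewrite /goodcount -[RHS]Rmult_1_r -rsum1_const; apply: rsum1_ext => m Hm.
    have -> // : good bad m.
    apply/allP => p; rewrite mem_primes => /and3P[Pp Hm0 Dp]; apply: Hbad => //.
    by apply: Rle_trans Hny; apply: INR_leq; apply: leq_trans (dvdn_leq Hm0 Dp) _; lia.
  have -> : INR n / INR n - 1 = 0 by field; lra.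
  by rewrite Rabs_R0; lra.
(* [kk] collects every contribution except the self-referential one, which enters with coefficient
   [3/4]; the bound [X = 4 * kk] solves [kk + 3 X / 4 = X]. *)
pose kk := (C1 + C2 + 2 + U + (U + 1) * c).
exists (4 * kk); first by rewrite /kk; nra.
move=> y bad sigma e1 e2 Hy He1 He2 Hbad Hs1 Hs2 Hs3 Hs4.
set T := ln y in Hy Hs3 Hs4 *.
have HT1 : 1 < T by rewrite /C0 in Hy; lra.
have HT : 0 < T by lra.
have Hi := Rinv_0_lt_compat _ HT.
have HC3T : (C3 + C4) / T <= / 4 by apply/Rle_div_l => //; rewrite /C0 in Hy; lra.
have Hy0 : 0 < y by exact: ln_gt0_pos HT.
set err := e1 + e2 + / T.
have Herr : 0 <= err by rewrite /err; lra.
have Hkk : 0 <= kk by rewrite /kk; nra.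
elim/ltn_ind => n IHn Hn HnU Hnj.
have Hn0 := lt_0_INR1 Hn; have Hin := Rinv_0_lt_compat _ Hn0.
have IHj := IH y bad sigma e1 e2 Hy He1 He2 Hbad Hs1 Hs2 Hs3 Hs4.
have Hckk : c <= 4 * kk by rewrite /kk; nra.
case: (Rle_dec (ln (INR n)) ((1 + INR j / 2) * T)) => Hnv.
  apply: Rle_trans (IHj n Hn HnU Hnv) _.
  by apply: Rmult_le_compat_r; rewrite -/err.
move/Rnot_le_lt: Hnv => Hnv.
have HlnU := proj1 (le_Rpower_ln y U Hn0) HnU; rewrite -/T in HlnU.
have Hj0 := pos_INR j.
have Hyn : y < INR n.
  by case: (Rlt_dec y (INR n)) => // /Rnot_lt_le /(ln_le _ _ Hn0); rewrite -/T; nra.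
set t := ln (INR n) / T.
have Ht1 : 1 <= t by apply/Rle_div_r => //; nra.
have HtU : t <= U by apply/Rle_div_l.
set E := fun m => Rabs (goodcount bad m / INR m - sigma (ln (INR m) / T)).
rewrite -/(E n).
(* For [p > y^(1/2)] the quotient [n %/ p] falls in the previous range, with constant [c]. For
   smaller [p] it may stay in the current range, and the strong induction on [n] supplies the bound
   being proved. *)
have HE : forall p, (1 <= p <= n)%N -> prime p ->
  E (n %/ p) <= c * err + b2r (p <= nfloor (Rpower y (/ 2)))%N * (4 * kk * err).
  move=> p Hp Pp; have Hp0 : (0 < p)%N by lia.
  have Hp1 := lt_0_INR1 Hp0.
  have Hm0 : (0 < n %/ p)%N by rewrite divn_gt0 //; lia.
  have Hm1 := lt_0_INR1 Hm0.
  have Hmn : (n %/ p < n)%N by apply: ltn_Pdiv => //; exact: prime_gt1.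
  have HmU : INR (n %/ p) <= Rpower y U by apply: Rle_trans HnU; apply: INR_leq; lia.
  have Hce : 0 <= c * err by nra.
  have Hke : 0 <= 4 * kk * err by nra.
  have Hb := b2r_ge0 (p <= nfloor (Rpower y (/ 2)))%N.
  case: (Rle_dec (ln (INR (n %/ p))) ((1 + INR j / 2) * T)) => Hv.
    have := IHj _ Hm0 HmU Hv; rewrite -/err -/(E (n %/ p)%N); nra.
  have -> : (p <= nfloor (Rpower y (/ 2)))%N.
    apply/nfloor_leP; first exact/Rlt_le/exp_pos.
    apply/le_Rpower_ln => //; rewrite -/T.
    have : ln (INR (n %/ p)) <= ln (INR n / INR p) by apply: ln_le => //; exact: divn_le_INR.
    rewrite ln_div //; move: Hnj; rewrite S_INR; lra.
  rewrite [b2r true]/= Rmult_1_l.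
  have : E (n %/ p)%N <= 4 * kk * err; last by lra.
  apply: IHn => //.
  have : ln (INR (n %/ p)) <= ln (INR n) by apply: ln_le => //; apply: INR_leq; lia.
  lra.
pose tp p := ln (INR p) / T.
have Hmain : Rabs (goodcount bad n * ln (INR n)
     - INR n * rsum1 n (fun p => goodp bad p * (ln (INR p) / INR p) * sigma (t - tp p)))
   <= (C1 + C2) * INR n + INR n * e2 * mertens n
     + INR n * rsum1 n (fun p => b2r (prime p) * (ln (INR p) / INR p) * E (n %/ p)).
  have HR := Hren bad n Hn.
  have HD : Rabs (rsum1 n (fun p => goodp bad p * (ln (INR p) * goodcount bad (n %/ p)))
     - INR n * rsum1 n (fun p => goodp bad p * (ln (INR p) / INR p) * sigma (t - tp p)))
    <= theta n + INR n * e2 * mertens n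
     + INR n * rsum1 n (fun p => b2r (prime p) * (ln (INR p) / INR p) * E (n %/ p)).
    rewrite -rsum1_scal -rsum1_minus; apply: Rle_trans (rsum1_abs _ _) _.
    rewrite /theta /mertens -!rsum1_scal -!rsum1_plus; apply: rsum1_le => p Hp.
    have Hp0 : (0 < p)%N by lia.
    have Hp1 := lt_0_INR1 Hp0.
    have Hm0 : (0 < n %/ p)%N by rewrite divn_gt0 //; lia.
    have Hm1 := INR_ge1 Hm0.
    have Hl := ln_INR_ge0 p.
    have -> : goodp bad p * (ln (INR p) * goodcount bad (n %/ p)) - INR n * (goodp bad p * (ln (INR p) / INR p) * sigma (t - tp p))
      = goodp bad p * (ln (INR p) * (goodcount bad (n %/ p) - INR n / INR p * sigma (t - tp p))) by field; lra.
    rewrite Rabs_mult Rabs_mult (Rabs_pos_eq _ (goodp_ge0 _ _)) (Rabs_pos_eq _ Hl).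
    have -> : b2r (prime p) * ln (INR p) + INR n * e2 * (b2r (prime p) * (ln (INR p) / INR p)) +
       INR n * (b2r (prime p) * (ln (INR p) / INR p) * E (n %/ p)%N) =
       b2r (prime p) * (ln (INR p) * (1 + INR n / INR p * e2 + INR n / INR p * E (n %/ p)%N)) by field; lra.
    apply: Rmult_le_compat; [exact: goodp_ge0| |exact: goodp_le|].
      by apply: Rmult_le_pos => //; exact: Rabs_pos.
    apply: Rmult_le_compat_l => //.
    have Dl := divn_le_INR n Hp0; have Dg := divn_ge_INR n Hp0.
    set m := (n %/ p)%N in Hm0 Hm1 Dl Dg *; set q := INR n / INR p in Dl Dg *.
    have Hq0 : 0 < q by lra.
    have Htq : t - tp p = ln q / T by rewrite /t /tp /q ln_div //; field; lra.
    (* The integer part is at least half of [q], so rounding moves the argument of [sigma] by at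
       most [1 / T], the range in which its variation is at most [e2]. *)
    have Hqm : ln q - ln (INR m) <= 1.
      have : ln q <= ln (2 * INR m) by apply: ln_le; lra.
      rewrite ln_mult; try lra; have := ln2_le1; lra.
    have Hqm' : ln (INR m) <= ln q by apply: ln_le; lra.
    have Hqn : ln q <= ln (INR n).
      apply: ln_le => //; apply/Rle_div_l => //; have := INR_ge1 Hp0; nra.
    have Hsm : Rabs (sigma (ln (INR m) / T) - sigma (t - tp p)) <= e2.
      rewrite Htq; apply: Hs3.
      - by apply/Rle_div_l => //; lra.
      - by apply/Rle_div_l => //; lra.
      have -> : ln (INR m) / T - ln q / T = (ln (INR m) - ln q) * / T by field; lra.
      rewrite Rabs_mult (Rabs_pos_eq (/ T)); last by lra.
      rewrite -{2}[/ T]Rmult_1_l; apply: Rmult_le_compat_r; first by lra.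
      by apply/Rabs_le; lra.
    have Hsb : 0 <= sigma (t - tp p) <= 1 by rewrite Htq; apply: Hs2; apply/Rle_div_l => //; lra.
    have -> : goodcount bad m - q * sigma (t - tp p) = (INR m - q) * sigma (t - tp p)
        + INR m * (sigma (ln (INR m) / T) - sigma (t - tp p))
        + INR m * (goodcount bad m / INR m - sigma (ln (INR m) / T)) by field; lra.
    apply: Rle_trans (Rabs_triang _ _) _; apply: Rplus_le_compat.
      apply: Rle_trans (Rabs_triang _ _) _; apply: Rplus_le_compat.
        rewrite Rabs_mult (Rabs_pos_eq (sigma _)); last by lra.
        have : Rabs (INR m - q) <= 1 by apply/Rabs_le; lra.
        have := Rabs_pos (INR m - q); nra.
      rewrite Rabs_mult (Rabs_pos_eq (INR m)); last by lra.
      by apply: Rmult_le_compat => //; [lra|exact: Rabs_pos].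
    rewrite Rabs_mult (Rabs_pos_eq (INR m)); last by lra.
    by apply: Rmult_le_compat; [lra|exact: Rabs_pos|lra|exact: Rle_refl].
  have HT2 := Hth n.
  have := Rabs_triang (goodcount bad n * ln (INR n) - rsum1 n (fun p => goodp bad p * (ln (INR p) * goodcount bad (n %/ p))))
    (rsum1 n (fun p => goodp bad p * (ln (INR p) * goodcount bad (n %/ p))) - INR n * rsum1 n (fun p => goodp bad p * (ln (INR p) / INR p) * sigma (t - tp p))).
  set X := Rabs (_ + _).
  have -> : X = Rabs (goodcount bad n * ln (INR n) - INR n * rsum1 n (fun p => goodp bad p * (ln (INR p) / INR p) * sigma (t - tp p))).
    by rewrite /X; congr Rabs; ring.
  lra.
have HmerN : mertens n <= (U + / 4) * T.
  have /Rabs_le_between H1 := Hmern n Hn.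
  have : (C3 + C4) <= / 4 * T by apply/Rle_div_l.
  lra.
have HsE : rsum1 n (fun p => b2r (prime p) * (ln (INR p) / INR p) * E (n %/ p)%N)
   <= c * err * mertens n + 4 * kk * err * mertens (nfloor (Rpower y (/ 2))).
  set m0 := nfloor _.
  have Hm0n : (m0 <= n)%N.
    apply: INR_leq_inv; have := @nfloor_spec (Rpower y (/ 2)); rewrite -/m0 => H.
    have H' : INR m0 <= Rpower y (/ 2) by apply H; exact/Rlt_le/exp_pos.
    apply: Rle_trans H' _; apply: Rle_trans (Rlt_le _ _ Hyn).
    rewrite -{2}(Rpower_1 y) //; apply: Rle_Rpower; last by lra.
    by rewrite -(exp_ln y) // -/T; have := exp_ineq1_le T; lra.
  rewrite {2}/mertens (@rsum1_trunc m0 n) // /mertens -!rsum1_scal -rsum1_plus.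
  apply: rsum1_le => p Hp.
  have Hw : 0 <= ln (INR p) / INR p.
    by apply: Rdiv_le_0_compat; [exact: ln_INR_ge0|apply: lt_0_INR1; lia].
  case: (boolP (prime p)) => Pp; last by rewrite [b2r false]/= !Rmult_0_l !Rmult_0_r; lra.
  have := HE p Hp Pp; rewrite -/m0 [b2r true]/= !Rmult_1_l; nra.
have Hhalf : mertens (nfloor (Rpower y (/ 2))) <= (/ 2 + / 4) * T.
  have Hp1 : 1 <= Rpower y (/ 2).
    apply: Rpower_ge1; last by lra.
    by rewrite -(exp_ln y) // -/T; have := exp_ineq1_le T; lra.
  have /Rabs_le_between := Hmer _ Hp1; rewrite ln_Rpower -/T => H1.
  have : (C3 + C4) <= / 4 * T by apply/Rle_div_l.
  lra.
have Hyn' : y < INR n <= Rpower y U by split.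
have H4 := Hs4 n Hn Hyn'; rewrite -/t in H4.
set Sg := rsum1 n (fun p => goodp bad p * (ln (INR p) / INR p) * sigma (t - tp p)) in Hmain H4.
have Hstep1 : Rabs (t * (goodcount bad n / INR n) - Sg / T) <= (C1 + C2) / T + e2 * (U + / 4) + c * err * (U + / 4) + 4 * kk * err * (/ 2 + / 4).
  have -> : t * (goodcount bad n / INR n) - Sg / T = (goodcount bad n * ln (INR n) - INR n * Sg) * (/ INR n * / T).
    by rewrite /t; field; lra.
  have HnT : 0 < / INR n * / T by nra.
  rewrite Rabs_mult (Rabs_pos_eq (/ INR n * / T)); last by lra.
  apply: Rle_trans (Rmult_le_compat_r _ _ _ (Rlt_le _ _ HnT) Hmain) _.
  set SE := rsum1 n _ in HsE *.
  have -> : ((C1 + C2) * INR n + INR n * e2 * mertens n + INR n * SE) * (/ INR n * / T) =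
     (C1 + C2) / T + (e2 * mertens n + SE) * / T by field; lra.
  suff : (e2 * mertens n + SE) * / T <= e2 * (U + / 4) + c * err * (U + / 4) + 4 * kk * err * (/ 2 + / 4) by lra.
  apply/Rle_div_l => //.
  have : e2 * mertens n <= e2 * ((U + / 4) * T) by apply: Rmult_le_compat_l.
  have : c * err * mertens n <= c * err * ((U + / 4) * T) by apply: Rmult_le_compat_l => //; nra.
  have : 4 * kk * err * mertens (nfloor (Rpower y (/ 2))) <= 4 * kk * err * ((/ 2 + / 4) * T) by apply: Rmult_le_compat_l => //; nra.
  lra.
have Hstep2 : t * E n <= (C1 + C2) / T + e2 * (U + / 4) + c * err * (U + / 4) + 4 * kk * err * (/ 2 + / 4) + e1.
  have -> : t * E n = Rabs (t * (goodcount bad n / INR n) - t * sigma t).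
    by rewrite /E -/t -{1}(Rabs_pos_eq t); [rewrite -Rabs_mult; congr Rabs; ring|lra].
  have -> : t * (goodcount bad n / INR n) - t * sigma t = (t * (goodcount bad n / INR n) - Sg / T) + (Sg / T - t * sigma t) by ring.
  apply: Rle_trans (Rabs_triang _ _) _; lra.
have HEn : 0 <= E n by exact: Rabs_pos.
have HCT : (C1 + C2) / T <= (C1 + C2) * err.
  by apply: Rmult_le_compat_l; [lra|rewrite /err; lra].
have He2e : e2 * (U + / 4) <= (U + / 4) * err by rewrite /err; nra.
have He1e : e1 <= err by rewrite /err; lra.
have Hce : c * err * (U + / 4) <= (U + 1) * c * err by nra.
have : E n <= t * E n by nra.
have : kk * err = (C1 + C2) * err + 2 * err + U * err + (U + 1) * c * err by rewrite /kk; ring.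
nra.
Qed.

(** * Sums over good primes *)

(** Summation by parts for [b], then backwards for [beta]: as [w] decreases, each partial sum of [b]
    has the nonnegative coefficient [w n - w n.+1] and may be replaced by [eta] times that of
    [beta]. The last term is what remains at the lower end. *)
Lemma abel_bound (b beta w : nat -> R) a c eta : (a <= c)%N -> 0 <= eta ->
  (forall n, (a <= n <= c)%N -> Rabs (rsum1 n b) <= eta * rsum1 n beta) ->
  (forall n, (a <= n < c)%N -> w n.+1 <= w n) ->
  (forall n, (a <= n <= c)%N -> 0 <= w n) ->
  Rabs (rsum1 c (fun p => b p * w p) - rsum1 a (fun p => b p * w p)) <=
  eta * (rsum1 c (fun p => beta p * w p) - rsum1 a (fun p => beta p * w p)
    + 2 * rsum1 a beta * w a).
Proof.
move=> Hac Heta HD Hw Hw0.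
have H : forall n, (a <= n <= c)%N ->
  Rabs (rsum1 n (fun p => b p * w p) - rsum1 a (fun p => b p * w p) - rsum1 n b * w n)
  <= eta * (rsum1 n (fun p => beta p * w p) - rsum1 a (fun p => beta p * w p)
      - rsum1 n beta * w n + 2 * rsum1 a beta * w a).
  elim=> [|n IH] Hn.
    have -> : a = 0%N by lia.
    by rewrite !rsum10; have -> : 0 - 0 - 0 * w 0%N = 0 by [ring]; rewrite Rabs_R0; lra.
  case: (eqVneq a n.+1) => [E|Hne].
    rewrite -E; have Haa : (a <= a <= c)%N by lia.
    have H1 := HD a Haa; have H2 := Hw0 a Haa.
    have -> : rsum1 a (fun p => b p * w p) - rsum1 a (fun p => b p * w p) - rsum1 a b * w a = - (rsum1 a b * w a) by ring.
    rewrite Rabs_Ropp Rabs_mult (Rabs_pos_eq (w a)) //.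
    have := Rmult_le_compat_r _ _ _ H2 H1; lra.
  have Hn' : (a <= n <= c)%N by lia.
  have IH' := IH Hn'; have H1 := HD n Hn'.
  have H2 : w n.+1 <= w n by apply: Hw; lia.
  rewrite !rsum1S.
  have -> : rsum1 n (fun p => b p * w p) + b n.+1 * w n.+1 - rsum1 a (fun p => b p * w p) - (rsum1 n b + b n.+1) * w n.+1
   = (rsum1 n (fun p => b p * w p) - rsum1 a (fun p => b p * w p) - rsum1 n b * w n) + rsum1 n b * (w n - w n.+1) by ring.
  apply: Rle_trans (Rabs_triang _ _) _.
  rewrite Rabs_mult (Rabs_pos_eq (w n - w n.+1)); last by lra.
  have H3 : 0 <= w n - w n.+1 by lra.
  have := Rmult_le_compat_r _ _ _ H3 H1; lra.
have Hcc : (a <= c <= c)%N by lia.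
have H1 := H c Hcc; have H2 := HD c Hcc; have H3 := Hw0 c Hcc.
have -> : rsum1 c (fun p => b p * w p) - rsum1 a (fun p => b p * w p) =
  (rsum1 c (fun p => b p * w p) - rsum1 a (fun p => b p * w p) - rsum1 c b * w c) + rsum1 c b * w c by ring.
apply: Rle_trans (Rabs_triang _ _) _.
rewrite (Rabs_mult (rsum1 c b)) (Rabs_pos_eq (w c)) //.
have := Rmult_le_compat_r _ _ _ H3 H2; lra.
Qed.

Lemma ln_div_decr n : (3 <= n)%N -> ln (INR n.+1) / INR n.+1 <= ln (INR n) / INR n.
Proof.
move=> Hn; have H3 : 3 <= INR n by have := @INR_leq 3 n Hn; rewrite /=; lra.
have Hl : 1 <= ln (INR n).
  by rewrite -(ln_exp 1); apply: ln_le; [exact: exp_pos|have := exp_le_3; lra].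
rewrite S_INR; set a := INR n in H3 Hl *.
have Hd : 0 < (a + 1) / a by apply: Rdiv_lt_0_compat; lra.
have := ln_le_sub1 Hd; rewrite ln_div; try lra.
have -> : (a + 1) / a - 1 = / a by field; lra.
move=> H; apply/Rle_div_l; first by lra.
have -> : ln a / a * (a + 1) = ln a + ln a * / a by field; lra.
have : / a <= ln a * / a.
  have : 0 < / a by apply: Rinv_0_lt_compat; lra.
  nra.
lra.
Qed.

Definition goodmert (bad : pred nat) (n : nat) : R :=
  rsum1 n (fun p => goodp bad p * (ln (INR p) / INR p)).

Lemma RInt_near_const f a b c w : a <= b -> ex_RInt f a b ->
  (forall t, a < t < b -> Rabs (f t - c) <= w) ->
  Rabs (RInt f a b - c * (b - a)) <= w * (b - a).
Proof.
move=> Hab Hf H.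
have H1 : RInt f a b <= RInt (fun=> c + w) a b.
  apply: RInt_le => //; first exact: ex_RInt_const.
  by move=> t /H /Rabs_le_between; lra.
have H2 : RInt (fun=> c - w) a b <= RInt f a b.
  apply: RInt_le => //; first exact: ex_RInt_const.
  by move=> t /H /Rabs_le_between; lra.
move: H1 H2; rewrite !RInt_const /scal /= /mult /= => H1 H2.
apply/Rabs_le; nra.
Qed.

Lemma ex_RInt_cont f a b : (forall t, continuous f t) -> ex_RInt (V := R_CompleteNormedModule) f a b.
Proof. by move=> H; apply: ex_RInt_continuous => t _; exact: H. Qed.

(** On a short block [chi] is nearly [chi s], so good primes are counted by [chi s] times all
    primes; [abel_bound] turns counts into sums of [ln p / p]. The window for [chi] starts at
    [s - / ln y] because the floor of [y^s] can lose up to 1 in the logarithm. *)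
Lemma goodmert_block : exists2 C, 0 < C &
  forall (y : R) bad (chi : R -> R) eta w s s', 2 <= ln y -> 1 <= s -> s <= s' ->
  0 <= eta -> 0 <= w ->
  (forall n, (0 < n)%N -> INR n <= Rpower y s' ->
    Rabs (rsum1 n (goodp bad) - chi (ln (INR n) / ln y) * rsum1 n (fun p => b2r (prime p)))
      <= eta * rsum1 n (fun p => b2r (prime p))) ->
  (forall t, s - / ln y <= t <= s' -> Rabs (chi t - chi s) <= w) ->
  Rabs (goodmert bad (nfloor (Rpower y s')) - goodmert bad (nfloor (Rpower y s))
     - chi s * (mertens (nfloor (Rpower y s')) - mertens (nfloor (Rpower y s))))
  <= (eta + w) * (mertens (nfloor (Rpower y s')) - mertens (nfloor (Rpower y s)) + C).
Proof.
have [C HC Hpi] := pi_ln_le; exists (2 * C); first by lra.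
move=> y bad chi eta w s s' Hy Hs Hss Heta Hw Hcnt Hmod.
have Hy0 : 0 < y by apply: ln_gt0_pos; lra.
have HT : 0 < ln y by lra.
have Hi := Rinv_0_lt_compat _ HT.
have Hy3 : 3 <= y by rewrite -(exp_ln y) //; have := exp_ineq1_le (ln y); lra.
have Hys : 3 <= Rpower y s.
  by have := @Rle_Rpower y 1 s; rewrite Rpower_1 //; lra.
have Hyss : Rpower y s <= Rpower y s' by apply: Rle_Rpower; lra.
set a := nfloor (Rpower y s); set c := nfloor (Rpower y s').
have Ha := @nfloor_spec (Rpower y s); have Hc := @nfloor_spec (Rpower y s').
rewrite -/a in Ha; rewrite -/c in Hc.
have {}Ha : INR a <= Rpower y s < INR a + 1 by apply: Ha; lra.
have {}Hc : INR c <= Rpower y s' < INR c + 1 by apply: Hc; lra.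
have Hac : (a <= c)%N by apply/nfloor_leP; lra.
have Ha3 : (3 <= a)%N by apply/nfloor_leP; rewrite /=; lra.
have Hlna : s * ln y - 1 <= ln (INR a).
  by have := @ln_nfloor (Rpower y s); rewrite ln_Rpower -/a; lra.
pose b p := goodp bad p - chi s * b2r (prime p).
have HD : forall n, (a <= n <= c)%N -> Rabs (rsum1 n b) <= (eta + w) * rsum1 n (fun p => b2r (prime p)).
  move=> n Hn; have Hn0 : (0 < n)%N by lia.
  have Hn1 := lt_0_INR1 Hn0.
  have HnU : INR n <= Rpower y s' by apply: Rle_trans (proj1 Hc); apply: INR_leq; lia.
  have H1 := Hcnt n Hn0 HnU.
  have H2 : s - / ln y <= ln (INR n) / ln y <= s'.
    split; last by apply/Rle_div_l => //; exact: (proj1 (le_Rpower_ln y s' Hn1)).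
    apply/Rle_div_r => //.
    have : ln (INR a) <= ln (INR n) by apply: ln_le; [apply: lt_0_INR1; lia|apply: INR_leq; lia].
    have -> : (s - / ln y) * ln y = s * ln y - 1 by field; lra.
    lra.
  have H3 := Hmod _ H2.
  set P := rsum1 n (fun p => b2r (prime p)) in H1 *.
  have HP : 0 <= P by apply: rsum1_ge0 => p _; exact: b2r_ge0.
  rewrite /b rsum1_minus rsum1_scal -/P.
  set x := chi (ln (INR n) / ln y) in H1 H3.
  change (rsum1 n (fun i => goodp bad i)) with (rsum1 n (goodp bad)).
  have -> : rsum1 n (goodp bad) - chi s * P = (rsum1 n (goodp bad) - x * P) + (x - chi s) * P by ring.
  apply: Rle_trans (Rabs_triang _ _) _; rewrite (Rabs_mult _ P) (Rabs_pos_eq P) //.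
  have := Rmult_le_compat_r _ _ _ HP H3; lra.
have Heta' : 0 <= eta + w by lra.
have := @abel_bound b (fun p => b2r (prime p)) (fun p => ln (INR p) / INR p) a c (eta + w) Hac Heta' HD.
have X1 : forall n, (a <= n < c)%N -> ln (INR n.+1) / INR n.+1 <= ln (INR n) / INR n.
  by move=> n Hn; apply: ln_div_decr; lia.
have X2 : forall n, (a <= n <= c)%N -> 0 <= ln (INR n) / INR n.
  by move=> n Hn; apply: Rdiv_le_0_compat; [exact: ln_INR_ge0|apply: lt_0_INR1; lia].
move=> /(_ X1 X2).
have E : forall n, rsum1 n (fun p => b p * (ln (INR p) / INR p)) = goodmert bad n - chi s * mertens n.
  move=> n; rewrite /goodmert /mertens -rsum1_scal -rsum1_minus; apply: rsum1_ext => p _.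
  by rewrite /b; ring.
rewrite !E.
have -> : goodmert bad c - chi s * mertens c - (goodmert bad a - chi s * mertens a) =
  goodmert bad c - goodmert bad a - chi s * (mertens c - mertens a) by ring.
rewrite -/(mertens c) -/(mertens a) => H; apply: Rle_trans H _.
apply: Rmult_le_compat_l => //; apply: Rplus_le_compat_l.
have Ha0 : 0 < INR a by apply: lt_0_INR1; lia.
have := Hpi a; set P := rsum1 a _ => H.
have -> : 2 * P * (ln (INR a) / INR a) = 2 * (P * ln (INR a) / INR a) by field; lra.
suff : P * ln (INR a) / INR a <= C by lra.
by apply/Rle_div_l.
Qed.

(** Up to [tau = 1] all primes are good and Mertens' theorem applies directly; the rest is cut into
    [K] blocks. Each block costs [O(1 / ln y)], which is why [K] must stay fixed while [y] grows. *)
Lemma goodmert_estimate : exists2 C, 0 < C &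
  forall U (y : R) bad (chi : R -> R) eta w (K : nat), 1 < U -> (0 < K)%N -> 2 <= ln y ->
  0 <= eta <= 1 -> 0 <= w <= 1 -> / ln y <= U / INR K ->
  (forall p, prime p -> INR p <= y -> ~~ bad p) ->
  (forall t, continuous chi t) -> (forall t, t <= 1 -> chi t = 1) ->
  (forall t, t <= U -> 0 <= chi t <= 1) ->
  (forall a b, a <= U -> b <= U -> Rabs (a - b) <= 2 * U / INR K -> Rabs (chi a - chi b) <= w) ->
  (forall n, (0 < n)%N -> y < INR n <= Rpower y U ->
    Rabs (rsum1 n (goodp bad) - chi (ln (INR n) / ln y) * rsum1 n (fun p => b2r (prime p)))
      <= eta * rsum1 n (fun p => b2r (prime p))) ->
  forall tau, 0 <= tau <= U ->
  Rabs (goodmert bad (nfloor (Rpower y tau)) / ln y - RInt chi 0 tau) <=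
    (INR K + 1) * C / ln y + (eta + 2 * w) * U.
Proof.
have [C1 HC1 Hblk] := goodmert_block; have [C3 HC3 Hmer] := mertens_real.
exists (6 * C3 + 2 * C1); first by lra.
move=> U y bad chi eta w K HU HK Hy Heta Hw HTK Hbad Hcont Hchi1 Hchi Hmod Hcnt tau Htau.
have HK0 := lt_0_INR1 HK.
have Hy0 : 0 < y by apply: ln_gt0_pos; lra.
set T := ln y in Hy HTK Hcnt *.
have HT : 0 < T by lra.
have Hi := Rinv_0_lt_compat _ HT.
have Hy1 : 1 <= y by rewrite -(exp_ln y) // -/T; have := exp_ineq1_le T; lra.
have Hcnt' : forall n, (0 < n)%N -> INR n <= Rpower y U ->
    Rabs (rsum1 n (goodp bad) - chi (ln (INR n) / T) * rsum1 n (fun p => b2r (prime p)))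
      <= eta * rsum1 n (fun p => b2r (prime p)).
  move=> n Hn HnU; case: (Rlt_dec y (INR n)) => Hyn; first by apply: Hcnt.
  have -> : rsum1 n (goodp bad) = rsum1 n (fun p => b2r (prime p)).
    apply: rsum1_ext => p Hp; rewrite /goodp; case: (boolP (prime p)) => //= Pp.
    by rewrite Hbad //; apply: (@Rle_trans _ (INR n)); [apply: INR_leq; lia|lra].
  rewrite Hchi1; last first.
    by apply/Rle_div_l => //; rewrite Rmult_1_l; apply: ln_le; [exact: lt_0_INR1|lra].
  rewrite Rmult_1_l Rminus_diag Rabs_R0; apply: Rmult_le_pos; first by lra.
  by apply: rsum1_ge0 => p _; exact: b2r_ge0.
have Hsmall : forall s, 0 <= s <= 1 -> Rabs (goodmert bad (nfloor (Rpower y s)) / T - RInt chi 0 s) <= C3 / T.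
  move=> s Hs.
  have Hp1 : 1 <= Rpower y s by apply: Rpower_ge1; lra.
  have -> : goodmert bad (nfloor (Rpower y s)) = mertens (nfloor (Rpower y s)).
    apply: rsum1_ext => p Hp; congr (_ * _); rewrite /goodp.
    case: (boolP (prime p)) => //= Pp; rewrite Hbad //.
    have : INR p <= Rpower y s by apply/nfloor_leP; [lra|lia].
    have : Rpower y s <= Rpower y 1 by apply: Rle_Rpower; lra.
    rewrite Rpower_1 //; lra.
  have -> : RInt chi 0 s = s.
    rewrite (RInt_ext _ (fun=> 1)); first by rewrite RInt_const /scal /= /mult /=; ring.
    by move=> t; rewrite Rmax_right; [|lra]; move=> Ht; apply: Hchi1; lra.
  have := Hmer _ Hp1; rewrite ln_Rpower -/T => H.
  have -> : mertens (nfloor (Rpower y s)) / T - s = (mertens (nfloor (Rpower y s)) - s * T) * / T by field; lra.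
  rewrite Rabs_mult (Rabs_pos_eq (/ T)); last by lra.
  by apply: Rmult_le_compat_r => //; lra.
case: (Rle_dec tau 1) => Ht1.
  have Hin : 0 <= tau <= 1 by lra.
  apply: Rle_trans (Hsmall tau Hin) _.
  have : C3 / T <= (INR K + 1) * (6 * C3 + 2 * C1) / T.
    by apply: Rmult_le_compat_r; [lra|nra].
  nra.
(* A block has length at most [U / K], and so has the overlap [/ ln y]; together they fit in the
   window [2 * U / K] of the modulus. *)
pose h := (tau - 1) / INR K.
have Hh : 0 <= h by apply: Rdiv_le_0_compat; lra.
have HhK : h <= U / INR K by apply: Rmult_le_compat_r; [apply/Rlt_le/Rinv_0_lt_compat|lra].
have Hind : forall j : nat, (j <= K)%N ->
  Rabs (goodmert bad (nfloor (Rpower y (1 + INR j * h))) / T - RInt chi 0 (1 + INR j * h)) <=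
   C3 / T + INR j * ((6 * C3 + 2 * C1) / T + (eta + 2 * w) * h).
  elim=> [|j IH] Hj.
    rewrite [INR 0]/= !Rmult_0_l !Rplus_0_r; apply: Hsmall; lra.
  have Hj0 := pos_INR j.
  have HjK : INR j.+1 * h <= tau - 1.
    have -> : tau - 1 = INR K * h by rewrite /h; field; lra.
    by apply: Rmult_le_compat_r => //; exact: INR_leq.
  rewrite S_INR in HjK *.
  set s := 1 + INR j * h in IH *; have -> : 1 + (INR j + 1) * h = s + h by rewrite /s; ring.
  have Hs1 : 1 <= s by rewrite /s; nra.
  have HsU : s + h <= U by rewrite /s; lra.
  have IH' : Rabs (goodmert bad (nfloor (Rpower y s)) / T - RInt chi 0 s) <= C3 / T + INR j * ((6 * C3 + 2 * C1) / T + (eta + 2 * w) * h) by apply: IH; lia.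
  have Hm : forall t, s - / T <= t <= s + h -> Rabs (chi t - chi s) <= w.
    move=> t Ht; apply: Hmod; try lra.
    have -> : 2 * U / INR K = U / INR K + U / INR K by field; lra.
    by apply/Rabs_le; lra.
  have Hc : forall n, (0 < n)%N -> INR n <= Rpower y (s + h) ->
    Rabs (rsum1 n (goodp bad) - chi (ln (INR n) / T) * rsum1 n (fun p => b2r (prime p)))
      <= eta * rsum1 n (fun p => b2r (prime p)).
    move=> n Hn Hns; apply: Hcnt' => //; apply: Rle_trans Hns _; apply: Rle_Rpower; lra.
  have Hsh : s <= s + h by lra.
  have HB := Hblk y bad chi eta w s (s + h) Hy Hs1 Hsh (proj1 Heta) (proj1 Hw) Hc Hm.
  have P1 : 1 <= Rpower y s by apply: Rpower_ge1; lra.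
  have P2 : 1 <= Rpower y (s + h) by apply: Rpower_ge1; lra.
  have /Rabs_le_between M1 := Hmer _ P1; have /Rabs_le_between M2 := Hmer _ P2.
  rewrite !ln_Rpower -/T in M1 M2.
  set g1 := goodmert bad (nfloor (Rpower y s)) in IH' HB *.
  set g2 := goodmert bad (nfloor (Rpower y (s + h))) in HB *.
  set m1 := mertens (nfloor (Rpower y s)) in HB M1; set m2 := mertens (nfloor (Rpower y (s + h))) in HB M2.
  have Hcs : 0 <= chi s <= 1 by apply: Hchi; lra.
  have HI : Rabs (RInt chi s (s + h) - chi s * (s + h - s)) <= w * (s + h - s).
    apply: RInt_near_const; [lra|exact: ex_RInt_cont|].
    by move=> t Ht; apply: Hm; lra.
  have HCh : RInt chi 0 (s + h) = RInt chi 0 s + RInt chi s (s + h).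
    by rewrite -(RInt_Chasles chi 0 s (s + h)) //; exact: ex_RInt_cont.
  have Hdm : Rabs (m2 - m1 - h * T) <= 2 * C3 by apply/Rabs_le; lra.
  have Hstep : Rabs ((g2 - g1) / T - chi s * h) <= (6 * C3 + 2 * C1) / T + (eta + w) * h.
    have -> : (g2 - g1) / T - chi s * h = ((g2 - g1 - chi s * (m2 - m1)) + chi s * (m2 - m1 - h * T)) * / T by field; lra.
    rewrite Rabs_mult (Rabs_pos_eq (/ T)); last by lra.
    have -> : (6 * C3 + 2 * C1) / T + (eta + w) * h = (6 * C3 + 2 * C1 + (eta + w) * (h * T)) * / T by field; lra.
    apply: Rmult_le_compat_r; first by lra.
    apply: Rle_trans (Rabs_triang _ _) _.
    rewrite (Rabs_mult (chi s)) (Rabs_pos_eq (chi s)); last by lra.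
    have A1 : chi s * Rabs (m2 - m1 - h * T) <= 2 * C3 by have := Rabs_pos (m2 - m1 - h * T); nra.
    have A2 : (eta + w) * (m2 - m1 + C1) <= (eta + w) * (h * T + 2 * C3 + C1) by apply: Rmult_le_compat_l; lra.
    have A3 : (eta + w) * (2 * C3 + C1) <= 2 * (2 * C3 + C1) by apply: Rmult_le_compat_r; lra.
    lra.
  rewrite HCh.
  have -> : g2 / T - (RInt chi 0 s + RInt chi s (s + h)) = (g1 / T - RInt chi 0 s) + ((g2 - g1) / T - chi s * h) - (RInt chi s (s + h) - chi s * (s + h - s)) by field; lra.
  move: IH' Hstep HI => /Rabs_le_between I1 /Rabs_le_between I2 /Rabs_le_between I3.
  apply/Rabs_le; lra.
have := Hind K (leqnn K).
have -> : 1 + INR K * h = tau by rewrite /h; field; lra.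
move=> H; apply: Rle_trans H _.
have E1 : INR K * h = tau - 1 by rewrite /h; field; lra.
have -> : INR K * ((6 * C3 + 2 * C1) / T + (eta + 2 * w) * h) = INR K * ((6 * C3 + 2 * C1) / T) + (eta + 2 * w) * (tau - 1) by rewrite -E1; ring.
have E2 : C3 / T <= (6 * C3 + 2 * C1) / T by apply: Rmult_le_compat_r; lra.
have E3 : (eta + 2 * w) * (tau - 1) <= (eta + 2 * w) * U by apply: Rmult_le_compat_l; lra.
have -> : (INR K + 1) * (6 * C3 + 2 * C1) / T = INR K * ((6 * C3 + 2 * C1) / T) + (6 * C3 + 2 * C1) / T by field; lra.
lra.
Qed.

(** A Riemann-Stieltjes sum on the scale [tau = ln p / ln y]: the distribution function of [a] is
    within [eta] of the primitive of [chi]. [phi] is frozen on [K] intervals; each increment is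
    known within [2 * eta]. *)
Lemma riemann_sum (y : R) (a : nat -> R) (phi chi : R -> R) b (K : nat) w eta :
  1 < y -> 0 < b -> (0 < K)%N -> (forall p, 0 <= a p) -> a 1%N = 0 ->
  (forall t, continuous phi t) -> (forall t, continuous chi t) ->
  (forall t, 0 <= t <= b -> 0 <= phi t <= 1) -> (forall t, 0 <= t <= b -> 0 <= chi t <= 1) ->
  (forall s t, 0 <= s <= b -> 0 <= t <= b -> Rabs (s - t) <= b / INR K -> Rabs (phi s - phi t) <= w) ->
  (forall tau, 0 <= tau <= b -> Rabs (rsum1 (nfloor (Rpower y tau)) a - RInt chi 0 tau) <= eta) ->
  Rabs (rsum1 (nfloor (Rpower y b)) (fun p => a p * phi (ln (INR p) / ln y)) - RInt (fun t => phi t * chi t) 0 b)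
   <= w * (rsum1 (nfloor (Rpower y b)) a + b) + 2 * eta * INR K.
Proof.
move=> Hy Hb HK Ha Ha1 Cphi Cchi Bphi Bchi Hmod HA.
have HK0 := lt_0_INR1 HK.
have HT : 0 < ln y by rewrite -ln_1; apply: ln_increasing; lra.
pose h := b / INR K.
have Hh : 0 < h by apply: Rdiv_lt_0_compat.
have HhK : INR K * h = b by rewrite /h; field; lra.
have Cpc : forall t, continuous (fun t => phi t * chi t) t by move=> t; apply: continuous_mult.
have Hw : 0 <= w.
  have H0 : 0 <= 0 <= b by lra.
  have := Hmod 0 0 H0 H0; rewrite Rminus_diag Rabs_R0 => H.
  apply: Rle_trans (H _); [exact: Rabs_pos|by rewrite -/h; lra].
have Hind : forall j : nat, (j <= K)%N ->
  Rabs (rsum1 (nfloor (Rpower y (INR j * h))) (fun p => a p * phi (ln (INR p) / ln y)) - RInt (fun t => phi t * chi t) 0 (INR j * h))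
   <= w * (rsum1 (nfloor (Rpower y (INR j * h))) a + INR j * h) + 2 * eta * INR j; last first.
  by have := Hind K (leqnn K); rewrite HhK.
elim=> [|j IH] Hj.
  rewrite [INR 0]/= Rmult_0_l RInt_point Rpower_O; last by lra.
  (* At [tau = 0] the sum still contains the index 1, which [a 1 = 0] removes. *)
  have -> : nfloor 1 = 1%N by rewrite -(nfloor_INR 1).
  rewrite !rsum1S !rsum10 Ha1 /zero /= !Rmult_0_l Rplus_0_l Rminus_diag Rabs_R0; lra.
have Hj0 := pos_INR j.
have IH' := IH (ltnW Hj).
have HjK : INR j.+1 * h <= b by rewrite -HhK; apply: Rmult_le_compat_r; [lra|exact: INR_leq].
rewrite S_INR in HjK *.
set s := INR j * h in IH' *; have -> : (INR j + 1) * h = s + h by rewrite /s; ring.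
have Hs0 : 0 <= s by rewrite /s; nra.
have Hsb : s + h <= b by rewrite /s; lra.
set n1 := nfloor (Rpower y s) in IH' *; set n2 := nfloor (Rpower y (s + h)).
have Hp : forall x, 0 <= Rpower y x by move=> x; exact/Rlt_le/exp_pos.
have Hn12 : (n1 <= n2)%N.
  apply/nfloor_leP => //; apply: Rle_trans (proj1 (nfloor_spec (Hp s))) _.
  by apply: Rle_Rpower; lra.
have Is : 0 <= s <= b by lra.
have Ish : 0 <= s + h <= b by lra.
have A1 := HA s Is; have A2 := HA (s + h) Ish.
rewrite -/n1 in A1; rewrite -/n2 in A2.
have Bs := Bphi s Is.
have Hblock : Rabs (rsum1 n2 (fun p => a p * phi (ln (INR p) / ln y)) - rsum1 n1 (fun p => a p * phi (ln (INR p) / ln y))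
     - phi s * (rsum1 n2 a - rsum1 n1 a)) <= w * (rsum1 n2 a - rsum1 n1 a).
  rewrite !(rsum1_trunc _ Hn12) -!rsum1_minus -!rsum1_scal -rsum1_minus.
  apply: Rle_trans (rsum1_abs _ _) _; apply: rsum1_le => p Hp12.
  case: (leqP p n1) => Hp1.
    rewrite /= !Rmult_1_l !Rminus_diag !Rmult_0_r Rminus_diag Rabs_R0; lra.
  rewrite /= !Rmult_0_l !Rminus_0_r.
  have -> : a p * phi (ln (INR p) / ln y) - phi s * a p = a p * (phi (ln (INR p) / ln y) - phi s) by ring.
  rewrite Rabs_mult (Rabs_pos_eq (a p)) // Rmult_comm; apply: Rmult_le_compat_r => //.
  have Hp0 : 0 < INR p by apply: lt_0_INR1; lia.
  have L1 : INR p <= Rpower y (s + h) by apply/nfloor_leP => //; rewrite -/n2; lia.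
  have L2 : Rpower y s <= INR p.
    have : INR n1.+1 <= INR p by exact: INR_leq.
    by have := proj2 (nfloor_spec (Hp s)); rewrite S_INR -/n1; lra.
  have L3 : ln (INR p) / ln y <= s + h by apply/Rle_div_l => //; apply/le_Rpower_ln.
  have L4 : s <= ln (INR p) / ln y.
    apply: (Rmult_le_reg_r (ln y)) => //.
    have -> : ln (INR p) / ln y * ln y = ln (INR p) by field; lra.
    have : ln (Rpower y s) <= ln (INR p) by apply: ln_le => //; exact: exp_pos.
    by rewrite ln_Rpower.
  apply: Hmod; [lra|lra|rewrite -/h; apply/Rabs_le; lra].
have HCh : RInt (fun t => phi t * chi t) 0 (s + h) = RInt (fun t => phi t * chi t) 0 s + RInt (fun t => phi t * chi t) s (s + h).
  by rewrite -(RInt_Chasles (fun t => phi t * chi t) 0 s (s + h)) //; exact: ex_RInt_cont.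
have HCh2 : RInt chi 0 (s + h) = RInt chi 0 s + RInt chi s (s + h).
  by rewrite -(RInt_Chasles chi 0 s (s + h)) //; exact: ex_RInt_cont.
have HI : Rabs (RInt (fun t => phi t * chi t) s (s + h) - phi s * RInt chi s (s + h)) <= w * h.
  have -> : phi s * RInt chi s (s + h) = RInt (fun t => phi s * chi t) s (s + h).
    by rewrite -[LHS]/(scal (phi s) (RInt chi s (s + h))) -RInt_scal //; exact: ex_RInt_cont.
  rewrite -[_ - _]/(minus (RInt (fun t => phi t * chi t) s (s + h)) (RInt (fun t => phi s * chi t) s (s + h))).
  have Cs : forall t, continuous (fun t => phi s * chi t) t.
    by move=> t; apply: continuous_mult => //; exact: continuous_const.
  rewrite -RInt_minus; try exact: ex_RInt_cont.
  have := @RInt_near_const (fun t => minus (phi t * chi t) (phi s * chi t)) s (s + h) 0 w.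
  have -> : 0 * (s + h - s) = 0 by ring.
  have -> : w * (s + h - s) = w * h by ring.
  rewrite Rminus_0_r; apply; first by lra.
  - apply: ex_RInt_cont => t; exact: continuous_minus.
  - move=> t Ht; rewrite Rminus_0_r.
    have It : 0 <= t <= b by lra.
    have -> : minus (phi t * chi t) (phi s * chi t) = (phi t - phi s) * chi t by rewrite /minus /plus /opp /=; ring.
    rewrite Rabs_mult (Rabs_pos_eq (chi t)); last by have := Bchi t It; lra.
    have : Rabs (phi t - phi s) <= w by apply: Hmod => //; rewrite -/h; apply/Rabs_le; lra.
    have := Bchi t It; have := Rabs_pos (phi t - phi s); nra.
rewrite HCh2 in A2; rewrite HCh.
set X := rsum1 n2 (fun p => a p * phi (ln (INR p) / ln y)) in Hblock *.
set X1 := rsum1 n1 (fun p => a p * phi (ln (INR p) / ln y)) in IH' Hblock *.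
set J := RInt (fun t => phi t * chi t) s (s + h) in HI *.
set J0 := RInt (fun t => phi t * chi t) 0 s in IH' *.
have Hd : Rabs (phi s * (rsum1 n2 a - rsum1 n1 a - RInt chi s (s + h))) <= 2 * eta.
  rewrite Rabs_mult (Rabs_pos_eq (phi s)); last by lra.
  have : Rabs (rsum1 n2 a - rsum1 n1 a - RInt chi s (s + h)) <= 2 * eta.
    move: A1 A2 => /Rabs_le_between A1 /Rabs_le_between A2; apply/Rabs_le; lra.
  have := Rabs_pos (rsum1 n2 a - rsum1 n1 a - RInt chi s (s + h)); nra.
move: IH' Hblock HI Hd => /Rabs_le_between I1 /Rabs_le_between I2 /Rabs_le_between I3 /Rabs_le_between I4.
apply/Rabs_le; lra.
Qed.

(** * The functions sigma_k *)

Lemma cont_pt (f : R -> R) x : continuous f x -> continuity_pt f x.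
Proof. by move=> H; apply/continuity_pt_filterlim. Qed.

Lemma cont_max (f : R -> R) a b : a <= b -> (forall t, continuous f t) ->
  exists2 m, a <= m <= b & forall t, a <= t <= b -> f t <= f m.
Proof.
move=> Hab Hf; have [m Hm] := continuity_ab_maj f a b Hab (fun t _ => cont_pt (Hf t)).
by exists m; tauto.
Qed.

Lemma cont_min (f : R -> R) a b : a <= b -> (forall t, continuous f t) ->
  exists2 m, a <= m <= b & forall t, a <= t <= b -> f m <= f t.
Proof.
move=> Hab Hf; have [m Hm] := continuity_ab_min f a b Hab (fun t _ => cont_pt (Hf t)).
by exists m; tauto.
Qed.

(** Functions are continued by 1 to the negative axis: continuity then holds on the whole line, and
    arguments slightly below 0 need no separate treatment. *)
Definition normalized (f : R -> R) : Prop :=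
  (forall t, continuous f t) /\ (forall t, t <= 1 -> f t = 1).

Definition renewal (chi sigma : R -> R) : Prop :=
  forall u, 1 <= u -> u * sigma u = RInt (fun t => sigma (u - t) * chi t) 0 u.

Lemma normalized_unif f U e : normalized f -> 0 < e -> exists2 d, 0 < d &
  forall a b, a <= U -> b <= U -> Rabs (a - b) <= d -> Rabs (f a - f b) <= e.
Proof.
move=> [Hc H1] He.
have [d Hd] := Heine_cor2 (f := f) (a := 0) (b := Rmax 0 U) (fun t _ => cont_pt (Hc t)) (mkposreal e He).
exists (d / 2); first by have := cond_pos d; lra.
have Hcl : forall a, f a = f (Rmax 0 a).
  by move=> a; rewrite /Rmax; case: Rle_dec => // H; rewrite !H1; lra.
move=> a b Ha Hb Hab; rewrite (Hcl a) (Hcl b); left; apply: Hd.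
- by split; [exact: Rmax_l|apply: Rle_max_compat_l].
- by split; [exact: Rmax_l|apply: Rle_max_compat_l].
- have := cond_pos d => Hp; move/Rabs_le_between: Hab => Hab.
  apply: (@Rle_lt_trans _ (d / 2)); last by lra.
  by apply/Rabs_le; rewrite /Rmax; do 2 case: Rle_dec => ?; lra.
Qed.

Lemma cont_rev (f : R -> R) u t : (forall t, continuous f t) -> continuous (fun t => f (u - t)) t.
Proof.
move=> H; apply: (continuous_comp (fun t => u - t) f) => //.
by apply: (continuous_minus (V := R_NormedModule) (fun=> u)); [exact: continuous_const|exact: continuous_id].
Qed.

Lemma cont_conv (f g : R -> R) u t : (forall t, continuous f t) -> (forall t, continuous g t) ->
  continuous (fun t => f (u - t) * g t) t.
Proof. by move=> Hf Hg; apply: continuous_mult => //; exact: cont_rev. Qed.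

Lemma RInt_le_const (f : R -> R) a b c : a <= b -> (forall t, continuous f t) ->
  (forall t, a < t < b -> f t <= c) -> RInt f a b <= c * (b - a).
Proof.
move=> Hab Hf H; have : RInt f a b <= RInt (fun=> c) a b.
  by apply: RInt_le => //; [exact: ex_RInt_cont|exact: ex_RInt_const].
by rewrite RInt_const /scal /= /mult /=; lra.
Qed.

Lemma RInt_ge_const (f : R -> R) a b c : a <= b -> (forall t, continuous f t) ->
  (forall t, a < t < b -> c <= f t) -> c * (b - a) <= RInt f a b.
Proof.
move=> Hab Hf H; have : RInt (fun=> c) a b <= RInt f a b.
  by apply: RInt_le => //; [exact: ex_RInt_const|exact: ex_RInt_cont].
by rewrite RInt_const /scal /= /mult /=; lra.
Qed.

Lemma RInt_split (f : R -> R) a b c : (forall t, continuous f t) ->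
  RInt f a c = RInt f a b + RInt f b c :> R.
Proof. by move=> H; rewrite -(RInt_Chasles f a b c) //; exact: ex_RInt_cont. Qed.

(** At a maximum point [m > 1] with value above 1, the equation gives
    [m * sigma m <= (m - 1) * sigma m + 1], since [sigma (m - t) = 1] on the last unit of the range;
    hence [sigma m <= 1]. *)
Lemma renewal_le1 chi sigma : normalized chi -> normalized sigma ->
  (forall t, 0 < chi t <= 1) -> renewal chi sigma -> forall t, sigma t <= 1.
Proof.
move=> [Cc C1] [Sc S1] Hchi Hr t.
case: (Rle_dec t 1) => Ht; first by rewrite S1 //; lra.
have H0t : 0 <= t by lra.
have [m Hm Hmax] := cont_max H0t Sc.
have Htm : sigma t <= sigma m by apply: Hmax; lra.
apply: Rle_trans Htm _.
case: (Rle_dec m 1) => Hm1; first by rewrite S1 //; lra.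
case: (Rle_dec (sigma m) 1) => // /Rnot_le_lt HM.
have Hm1' : 1 <= m by lra.
have Hc : forall t : R, continuous (fun t : R => sigma (m - t) * chi t) t by move=> ?; exact: cont_conv.
have := Hr m Hm1'; rewrite (RInt_split 0 (m - 1) m Hc) => E.
have A1 : RInt (fun t => sigma (m - t) * chi t) 0 (m - 1) <= sigma m * (m - 1 - 0).
  apply: RInt_le_const => //; first by lra.
  move=> s Hs; have := Hchi s; have : sigma (m - s) <= sigma m by apply: Hmax; lra.
  nra.
have A2 : RInt (fun t => sigma (m - t) * chi t) (m - 1) m <= 1 * (m - (m - 1)).
  apply: RInt_le_const => //; first by lra.
  by move=> s Hs; rewrite S1; [have := Hchi s; lra|lra].
lra.
Qed.

(** At a minimum point [m > 1] with value at most 0, the range up to [m - 1] contributes at least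
    [(m - 1) * sigma m], and the last unit, where [sigma (m - t) = 1], contributes strictly more
    than 0. *)
Lemma renewal_pos chi sigma : normalized chi -> normalized sigma ->
  (forall t, 0 < chi t <= 1) -> renewal chi sigma -> forall t, 0 < sigma t.
Proof.
move=> [Cc C1] [Sc S1] Hchi Hr t.
case: (Rle_dec t 1) => Ht; first by rewrite S1 //; lra.
have H0t : 0 <= t by lra.
have [m Hm Hmin] := cont_min H0t Sc.
have Htm : sigma m <= sigma t by apply: Hmin; lra.
apply: Rlt_le_trans Htm.
case: (Rle_dec m 1) => Hm1; first by rewrite S1 //; lra.
case: (Rlt_dec 0 (sigma m)) => // /Rnot_lt_le HM.
have Hm1' : 1 <= m by lra.
have Hc : forall t : R, continuous (fun t : R => sigma (m - t) * chi t) t by move=> ?; exact: cont_conv.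
have := Hr m Hm1'; rewrite (RInt_split 0 (m - 1) m Hc) => E.
have A1 : sigma m * (m - 1 - 0) <= RInt (fun t => sigma (m - t) * chi t) 0 (m - 1).
  apply: RInt_ge_const => //; first by lra.
  move=> s Hs; have := Hchi s; have : sigma m <= sigma (m - s) by apply: Hmin; lra.
  nra.
have A2 : 0 < RInt (fun t => sigma (m - t) * chi t) (m - 1) m.
  apply: RInt_gt_0; [lra| |by move=> s _; exact: Hc].
  by move=> s Hs; rewrite S1; [have := Hchi s; lra|lra].
nra.
Qed.

(** * The Dickman function: integral form, bounds and positivity *)

Section Dickman.

Variable rho : R -> R.
Hypothesis rhoN : normalized rho.
Hypothesis rhoD : forall u, 1 < u -> is_derive rho u (- rho (u - 1) / u).

Lemma is_derive_RInt_cont (f : R -> R) u : (forall t, continuous f t) -> is_derive (fun u => RInt f 0 u) u (f u).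
Proof.
move=> Hf; apply: is_derive_RInt; last exact: Hf.
by apply: filter_forall => x; apply: RInt_correct; exact: ex_RInt_cont.
Qed.

(** The difference of the two sides has derivative 0 beyond 1 by the delay equation, is continuous,
    and vanishes at 1. *)
Lemma dickman_RInt u : 1 <= u -> u * rho u = RInt rho (u - 1) u.
Proof.
move=> Hu; have [Cc C1] := rhoN.
pose F v := v * rho v - (RInt rho 0 v - RInt rho 0 (v - 1)).
have HF : forall v, 1 < v -> is_derive F v 0.
  move=> v Hv; rewrite /F.
  suff : is_derive F v ((1 * rho v + v * (- rho (v - 1) / v)) - (rho v - 1 * rho (v - 1))).
    by have -> : (1 * rho v + v * (- rho (v - 1) / v)) - (rho v - 1 * rho (v - 1)) = 0 by field; lra.
  apply: (is_derive_minus (V := R_NormedModule)).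
    apply: (is_derive_mult (fun v => v) rho v 1 (- rho (v - 1) / v)) => //; last by move=> *; exact: Rmult_comm.
      exact: is_derive_id.
    exact: rhoD.
  apply: (is_derive_minus (V := R_NormedModule)).
    exact: is_derive_RInt_cont.
  apply: (is_derive_comp (fun v => RInt rho 0 v) (fun v => v - 1)); first exact: is_derive_RInt_cont.
  by auto_derive => //; ring.
have CI : forall v, continuous (fun v => RInt rho 0 v) v.
  by move=> v; apply: ex_derive_continuous; exists (rho v); exact: is_derive_RInt_cont.
have CF : forall v, continuous F v.
  move=> v; apply: (continuous_minus (V := R_NormedModule)).
    by apply: continuous_mult => //; exact: continuous_id.
  apply: (continuous_minus (V := R_NormedModule)) => //.
  apply: (continuous_comp (fun v => v - 1)) => //.
  by apply: (continuous_minus (V := R_NormedModule)); [exact: continuous_id|exact: continuous_const].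
have F1 : F 1 = 0.
  rewrite /F C1; last by lra.
  rewrite Rminus_diag RInt_point (RInt_ext _ (fun=> 1)).
    by rewrite RInt_const /scal /= /mult /zero /=; ring.
  by move=> t; rewrite Rmax_right; [|lra]; move=> Ht; apply: C1; lra.
have [c [Hc E]] := MVT_gen F 1 u (fun=> 0) (fun v Hv => HF v ltac:(rewrite Rmin_left in Hv; lra)) (fun v _ => cont_pt (CF v)).
have : F u = 0 by lra.
rewrite /F; have := RInt_split 0 (u - 1) u Cc; lra.
Qed.

Lemma dickman_le1 t : rho t <= 1.
Proof.
have [Cc C1] := rhoN.
case: (Rle_dec t 1) => Ht; first by rewrite C1 //; lra.
have H0t : 0 <= t by lra.
have [m Hm Hmax] := cont_max H0t Cc.
have Htm : rho t <= rho m by apply: Hmax; lra.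
apply: Rle_trans Htm _.
case: (Rle_dec m 1) => Hm1; first by rewrite C1 //; lra.
have Hm1' : 1 <= m by lra.
have E := dickman_RInt Hm1'.
have : RInt rho (m - 1) m <= rho m * (m - (m - 1)).
  apply: RInt_le_const => //; first by lra.
  by move=> s Hs; apply: Hmax; lra.
nra.
Qed.

Lemma dickman_ge0 t : 0 <= rho t.
Proof.
have [Cc C1] := rhoN.
case: (Rle_dec t 1) => Ht; first by rewrite C1 //; lra.
have H0t : 0 <= t by lra.
have [m Hm Hmin] := cont_min H0t Cc.
have Htm : rho m <= rho t by apply: Hmin; lra.
apply: Rle_trans _ Htm.
case: (Rle_dec m 1) => Hm1; first by rewrite C1 //; lra.
have Hm1' : 1 <= m by lra.
have E := dickman_RInt Hm1'.
have : rho m * (m - (m - 1)) <= RInt rho (m - 1) m.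
  apply: RInt_ge_const => //; first by lra.
  by move=> s Hs; apply: Hmin; lra.
nra.
Qed.

Lemma dickman_pos t : 0 < rho t.
Proof.
have [Cc C1] := rhoN.
(* Steps of one half: the window [(u - 1, u)] then meets the range already treated in an interval of
   positive length. *)
have H : forall n : nat, forall u, u <= 1 + INR n / 2 -> 0 < rho u.
  elim=> [|n IH] u Hu; first by rewrite C1; [lra|move: Hu; rewrite [INR 0]/=; lra].
  rewrite S_INR in Hu; set v := 1 + INR n / 2 in IH.
  case: (Rle_dec u v) => Huv; first exact: IH.
  have Hv1 : 1 <= v by rewrite /v; have := pos_INR n; lra.
  have Hu1 : 1 <= u by lra.
  have E := dickman_RInt Hu1; rewrite (RInt_split (u - 1) v u Cc) in E.
  have P1 : 0 < RInt rho (u - 1) v.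
    apply: RInt_gt_0; [rewrite /v in Huv *; lra| |by move=> s _; exact: Cc].
    by move=> s Hs; apply: IH; lra.
  have P2 : 0 * (u - v) <= RInt rho v u.
    by apply: RInt_ge_const => //; [lra|move=> s _; exact: dickman_ge0].
  have : 0 < u * rho u by lra.
  by move=> H; apply: (Rmult_lt_reg_l u); lra.
have [n Hn] := INR_unbounded (2 * t); apply: (H n); lra.
Qed.

Lemma dickman_conv u : 1 <= u -> u * rho u = RInt (fun t => rho (u - t)) 0 1.
Proof.
move=> Hu; have [Cc C1] := rhoN; rewrite dickman_RInt //.
have := RInt_comp_lin rho (-1) u 1 0.
have -> : -1 * 1 + u = u - 1 by ring.
have -> : -1 * 0 + u = u by ring.
move=> <-; last exact: ex_RInt_cont.
rewrite -(opp_RInt_swap (V := R_CompleteNormedModule)); last first.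
  apply: ex_RInt_cont => t; apply: (continuous_scal_r (V := R_NormedModule)).
  apply: (continuous_comp (fun t => -1 * t + u)) => //.
  apply: (continuous_plus (V := R_NormedModule)); last exact: continuous_const.
  by apply: continuous_mult; [exact: continuous_const|exact: continuous_id].
rewrite -RInt_opp; last first.
  apply: ex_RInt_cont => t; apply: (continuous_scal_r (V := R_NormedModule)).
  apply: (continuous_comp (fun t => -1 * t + u)) => //.
  apply: (continuous_plus (V := R_NormedModule)); last exact: continuous_const.
  by apply: continuous_mult; [exact: continuous_const|exact: continuous_id].
apply: RInt_ext => t _; rewrite /opp /scal /= /mult /=.
have -> : -1 * t + u = u - t by ring.
by ring.
Qed.

End Dickman.

(** [rho] and [sigma] are prescribed only for nonnegative arguments and continuous only at positive
    ones. This replaces their arbitrary values on the negative axis so that [normalized] holds. *)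
Definition extend1 (f : R -> R) (t : R) : R := if Rle_dec t 1 then 1 else f t.

Lemma extend1E f t : (forall u, 0 <= u <= 1 -> f u = 1) -> 0 <= t -> extend1 f t = f t.
Proof. by move=> H Ht; rewrite /extend1; case: Rle_dec => // H1; rewrite H. Qed.

Lemma extend1_normalized (f : R -> R) : (forall u, 0 < u -> continuous f u) ->
  (forall u, 0 <= u <= 1 -> f u = 1) -> normalized (extend1 f).
Proof.
move=> Hc H1; split=> t; last by rewrite /extend1; case: Rle_dec.
case: (Rlt_dec 0 t) => Ht.
  apply: (continuous_ext_loc _ f); last exact: Hc.
  exists (mkposreal t Ht) => x /= Hx.
  rewrite extend1E //; move: Hx; rewrite /ball /= /AbsRing_ball /= /abs /minus /plus /opp /= => /Rabs_lt_between; lra.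
apply: (continuous_ext_loc _ (fun=> 1)); last exact: continuous_const.
have H : 0 < 1 by lra.
exists (mkposreal 1 H) => x /=; rewrite /ball /= /AbsRing_ball /= /abs /minus /plus /opp /= => /Rabs_lt_between Hx.
by rewrite /extend1; case: Rle_dec => // H2; exfalso; apply: H2; move: (Rnot_lt_le _ _ Ht) => Ht'; lra.
Qed.

Section Family.

Variables (rho : R -> R) (sigma : nat -> R -> R).
Hypothesis Hrho : is_dickman rho.
Hypothesis Hsig : is_sigma_family rho sigma.

Definition sg (k : nat) : R -> R := extend1 (sigma k).

Lemma sigma1 k u : 0 <= u <= 1 -> sigma k u = 1.
Proof.
have [S0 [_ [S1 _]]] := Hsig; have [_ [R1 _]] := Hrho.
by case: k => [|k] Hu; [rewrite S0 ?R1 //; lra|exact: S1].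
Qed.

Lemma sgE k u : 0 <= u -> sg k u = sigma k u.
Proof. by apply: extend1E => v; exact: sigma1. Qed.

Lemma sg_normalized k : normalized (sg k).
Proof.
have [_ [Sc _]] := Hsig.
by apply: extend1_normalized => u Hu; [exact: Sc|exact: sigma1].
Qed.

Lemma sg_renewal k : renewal (sg k) (sg k.+1).
Proof.
move=> u Hu; have [_ [_ [_ Seq]]] := Hsig.
rewrite sgE; last by lra.
rewrite Seq //; apply: RInt_ext => t; rewrite Rmin_left ?Rmax_right; try lra.
by move=> Ht; rewrite !sgE //; lra.
Qed.

Lemma sg0_derive u : 1 < u -> is_derive (sg 0) u (- sg 0 (u - 1) / u).
Proof.
move=> Hu; have [S0 _] := Hsig; have [_ [_ Rd]] := Hrho.
rewrite sgE; last by lra.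
rewrite S0; last by lra.
apply: (is_derive_ext_loc rho); last exact: Rd.
have Hu0 : 0 < u by lra.
exists (mkposreal u Hu0) => x; rewrite /ball /= /AbsRing_ball /= /abs /minus /plus /opp /= => /Rabs_lt_between Hx.
by rewrite sgE ?S0 //; lra.
Qed.

Lemma sg_bounds k t : 0 < sg k t <= 1.
Proof.
elim: k t => [|k IH] t.
  have N0 := sg_normalized 0.
  by split; [apply: (dickman_pos N0)|apply: (dickman_le1 N0)]; exact: sg0_derive.
split; first by apply: (renewal_pos (chi := sg k)) => //; [exact: sg_normalized|exact: sg_normalized|exact: sg_renewal].
by apply: (renewal_le1 (chi := sg k)) => //; [exact: sg_normalized|exact: sg_normalized|exact: sg_renewal].
Qed.

Lemma sg0_conv u : 1 <= u -> u * sg 0 u = RInt (fun t => sg 0 (u - t)) 0 1.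
Proof. by apply: dickman_conv; [exact: sg_normalized|exact: sg0_derive]. Qed.

End Family.

(** * Density of integers without bad factors *)

Lemma ex_nat_ge (x : R) : exists2 K : nat, (0 < K)%N & x <= INR K.
Proof.
have [n Hn] := INR_unbounded x; exists n.+1 => //.
by rewrite S_INR; lra.
Qed.

Lemma div_nat_le U d : 0 < U -> 0 < d -> exists2 K : nat, (0 < K)%N & U / INR K <= d.
Proof.
move=> HU Hd; have [K HK HK1] := ex_nat_ge (U / d); exists K => //.
have HK0 := lt_0_INR1 HK.
apply/Rle_div_l => //; rewrite Rmult_comm; exact/(Rle_div_l U).
Qed.

Lemma ev_inv_ln d : 0 < d -> ev (fun y => / ln y <= d).
Proof.
move=> Hd; apply: ev_imp (ev_ln (/ d)) => y Hy.
by rewrite -(Rinv_inv d); apply: Rinv_le_contravar => //; exact: Rinv_0_lt_compat.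
Qed.

Lemma ev_div_ln c d : 0 <= c -> 0 < d -> ev (fun y => c / ln y <= d).
Proof.
move=> Hc Hd; have Hp : 0 < d / (c + 1) by apply: Rdiv_lt_0_compat; lra.
apply: ev_imp (ev_and (ev_inv_ln Hp) (ev_ln 1)) => y [H H1].
have Hi : 0 < / ln y by apply: Rinv_0_lt_compat; lra.
apply: (@Rle_trans _ ((c + 1) * / ln y)); first by rewrite /Rdiv; nra.
apply: Rle_trans (Rmult_le_compat_l _ _ _ _ H) _; first by lra.
by right; field; lra.
Qed.

Section Convergence.

Variable sigma : R -> R.
Hypothesis sigmaN : normalized sigma.
Hypothesis sigmaB : forall t, 0 < sigma t <= 1.

Definition conv_sum (y : R) (bad : pred nat) (n : nat) : R :=
  rsum1 n (fun p => goodp bad p * (ln (INR p) / INR p) * sigma (ln (INR n) / ln y - ln (INR p) / ln y)) / ln y.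

Lemma density_of_conv U e : 1 < U -> 0 < e -> exists2 e1, 0 < e1 &
  ev (fun y => forall bad : pred nat,
    (forall p, prime p -> INR p <= y -> ~~ bad p) ->
    (forall n, (0 < n)%N -> y < INR n <= Rpower y U ->
       Rabs (conv_sum y bad n - ln (INR n) / ln y * sigma (ln (INR n) / ln y)) <= e1) ->
    forall n, (0 < n)%N -> INR n <= Rpower y U ->
      Rabs (goodcount bad n / INR n - sigma (ln (INR n) / ln y)) <= e).
Proof.
move=> HU He; have [C0 HC0 Hst] := renewal_stability.
have [c Hc {}Hst] := Hst U HU.
pose e' := e / (3 * c); have He' : 0 < e' by apply: Rdiv_lt_0_compat; lra.
exists e' => //.
have [d Hd Hmod] := normalized_unif U sigmaN He'.
have := ev_and (ev_ln C0) (ev_and (ev_inv_ln Hd) (ev_inv_ln He')).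
apply: ev_imp => y [Hy [Hyd Hye]] bad Hbad Hcv n Hn HnU.
apply: Rle_trans (Hst y bad sigma e' e' Hy _ _ Hbad _ _ _ Hcv n Hn HnU) _; try lra.
- by case: sigmaN.
- by move=> t _; have := sigmaB t; lra.
- by move=> a b Ha Hb Hab; apply: Hmod => //; lra.
apply: (@Rle_trans _ (c * (3 * e'))); first by apply: Rmult_le_compat_l; lra.
by right; rewrite /e'; field; lra.
Qed.

(** The upper limit [b] is left free: it is [ln n / ln y] for a general kernel, and 1 in the Dickman
    case, where no prime above [y] is good. *)
Lemma conv_sum_estimate (chi : R -> R) U e : (forall t : R, continuous chi t) ->
  (forall t, 0 <= chi t <= 1) -> 1 < U -> 0 < e -> exists2 ea, 0 < ea &
  forall (y : R) (bad : pred nat) (n : nat) b, 1 < ln y -> 0 < b <= U ->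
   ln (INR n) / ln y <= U ->
   (forall tau, 0 <= tau <= b ->
      Rabs (goodmert bad (nfloor (Rpower y tau)) / ln y - RInt chi 0 tau) <= ea) ->
   Rabs (rsum1 (nfloor (Rpower y b)) (fun p => goodp bad p * (ln (INR p) / INR p) * sigma (ln (INR n) / ln y - ln (INR p) / ln y)) / ln y
      - RInt (fun t => sigma (ln (INR n) / ln y - t) * chi t) 0 b) <= e.
Proof.
move=> Hcc Hcb HU He; have [Sc S1] := sigmaN.
pose w := e / (2 * (2 * U + 1)); have Hw : 0 < w by apply: Rdiv_lt_0_compat; lra.
have [d Hd Hmod] := normalized_unif U sigmaN Hw.
have HU0 : 0 < U by lra.
have [K HK HKd] := div_nat_le HU0 Hd.
have HK0 := lt_0_INR1 HK.
pose ea := Rmin 1 (e / (4 * INR K)).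
have Hea : 0 < ea by apply: Rmin_pos; [lra|apply: Rdiv_lt_0_compat; lra].
have Hea1 : ea <= 1 by exact: Rmin_l.
have Hea2 : ea * (4 * INR K) <= e.
  have : ea <= e / (4 * INR K) by exact: Rmin_r.
  by move=> H; apply/Rle_div_r => //; lra.
exists ea => // y bad n b Hy Hb HtU HA.
set t := ln (INR n) / ln y in HtU *.
have Hy0 : 0 < y by apply: ln_gt0_pos; lra.
have Hy1 : 1 < y.
  by rewrite -(exp_ln y) //; have := exp_ineq1 (ln y); lra.
have HT : 0 < ln y by lra.
pose a p := goodp bad p * (ln (INR p) / INR p) * / ln y.
have Ea : forall m, rsum1 m a = goodmert bad m / ln y.
  by move=> m; rewrite /a rsum1_scalr.
have -> : rsum1 (nfloor (Rpower y b)) (fun p => goodp bad p * (ln (INR p) / INR p) * sigma (t - ln (INR p) / ln y)) / ln y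
  = rsum1 (nfloor (Rpower y b)) (fun p => a p * (fun s => sigma (t - s)) (ln (INR p) / ln y)).
  by rewrite /Rdiv -rsum1_scalr; apply: rsum1_ext => p _; rewrite /a /Rdiv; ring.
apply: Rle_trans (@riemann_sum y a (fun s => sigma (t - s)) chi b K w ea Hy1 _ HK _ _ _ Hcc _ _ _ _) _.
- by lra.
- move=> p; apply: Rmult_le_pos; last by apply/Rlt_le/Rinv_0_lt_compat.
  apply: Rmult_le_pos; first exact: goodp_ge0.
  case: p => [|p]; first by rewrite /Rdiv [INR 0]/= Rinv_0; lra.
  by apply: Rdiv_le_0_compat; [exact: ln_INR_ge0|exact: lt_0_INR1].
- by rewrite /a /goodp /=; ring.
- by move=> s; exact: cont_rev.
- by move=> s _; have := sigmaB (t - s); lra.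
- by move=> s _.
- move=> s s' Hs Hs' Hss; apply: Hmod; try lra.
  have -> : t - s - (t - s') = - (s - s') by ring.
  rewrite Rabs_Ropp; apply: Rle_trans Hss _; apply: Rle_trans HKd.
  by apply: Rmult_le_compat_r; [apply/Rlt_le/Rinv_0_lt_compat|lra].
- by move=> tau Htau; rewrite Ea; exact: HA.
have HAb : rsum1 (nfloor (Rpower y b)) a <= U + 1.
  have Hbb : 0 <= b <= b by lra.
  have := HA b Hbb; rewrite -Ea => /Rabs_le_between H.
  have : RInt chi 0 b <= 1 * (b - 0).
    by apply: RInt_le_const => //; [lra|move=> s _; have := Hcb s; lra].
  lra.
have : w * (rsum1 (nfloor (Rpower y b)) a + b) <= w * (2 * U + 1) by apply: Rmult_le_compat_l; lra.
have -> : w * (2 * U + 1) = e / 2 by rewrite /w; field; lra.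
lra.
Qed.

(** Counts of good primes give their sums of [ln p / p], these turn the convolution sum into the
    integral of the renewal equation, and stability concludes. [eta] and the number of blocks are
    fixed before [y]. *)
Lemma density_of_primes (chi : R -> R) U e : normalized chi -> (forall t, 0 < chi t <= 1) ->
  renewal chi sigma -> 1 < U -> 0 < e -> exists2 eta, 0 < eta &
  ev (fun y => forall bad : pred nat,
    (forall p, prime p -> INR p <= y -> ~~ bad p) ->
    (forall n, (0 < n)%N -> y < INR n <= Rpower y U ->
      Rabs (rsum1 n (goodp bad) - chi (ln (INR n) / ln y) * rsum1 n (fun p => b2r (prime p)))
      <= eta * rsum1 n (fun p => b2r (prime p))) ->
    forall n, (0 < n)%N -> INR n <= Rpower y U ->
      Rabs (goodcount bad n / INR n - sigma (ln (INR n) / ln y)) <= e).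
Proof.
move=> chiN chiB Hren HU He; have [Cc C1] := chiN.
have [e1 He1 Hden] := density_of_conv HU He.
have chiB' : forall t, 0 <= chi t <= 1 by move=> t; have := chiB t; lra.
have [ea Hea Hcs] := conv_sum_estimate Cc chiB' HU He1.
have [C HC Hgm] := goodmert_estimate.
have HU0 : 0 < U by lra.
pose eta := Rmin 1 (ea / (4 * U)).
have Heta : 0 < eta by apply: Rmin_pos; [lra|apply: Rdiv_lt_0_compat; lra].
pose w := Rmin 1 (ea / (8 * U)).
have Hw : 0 < w by apply: Rmin_pos; [lra|apply: Rdiv_lt_0_compat; lra].
have Heta1 : eta <= 1 by exact: Rmin_l.
have Hw1 : w <= 1 by exact: Rmin_l.
have Heta2 : eta * U <= ea / 4.
  have : eta <= ea / (4 * U) by exact: Rmin_r.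
  move/(Rmult_le_compat_r U _ _ (Rlt_le _ _ HU0)).
  by have -> : ea / (4 * U) * U = ea / 4 by field; lra.
have Hw2 : 2 * w * U <= ea / 4.
  have : w <= ea / (8 * U) by exact: Rmin_r.
  move/(Rmult_le_compat_r U _ _ (Rlt_le _ _ HU0)).
  have -> : ea / (8 * U) * U = ea / 8 by field; lra.
  lra.
have [d Hd Hmod] := normalized_unif U chiN Hw.
have H2U : 0 < 2 * U by lra.
have [K HK HKd] := div_nat_le H2U Hd.
have HK0 := lt_0_INR1 HK.
exists eta => //.
have HUK : 0 < U / INR K by exact: Rdiv_lt_0_compat.
have Hc0 : 0 <= (INR K + 1) * C by nra.
have Hea2 : 0 < ea / 2 by lra.
have := ev_and Hden (ev_and (ev_ln 2) (ev_and (ev_inv_ln HUK) (ev_div_ln Hc0 Hea2))).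
apply: ev_imp => y [{}Hden [Hy [HyK HyC]]] bad Hbad Hcnt.
apply: Hden => // n Hn HnU.
have Hn0 := lt_0_INR1 Hn.
have Hy0 : 0 < y by apply: ln_gt0_pos; lra.
have HT : 0 < ln y by lra.
set t := ln (INR n) / ln y.
have Ht1 : 1 <= t.
  apply: (Rmult_le_reg_r (ln y)) => //.
  have -> : t * ln y = ln (INR n) by rewrite /t; field; lra.
  by rewrite Rmult_1_l; apply: ln_le; lra.
have HtU : t <= U by apply/Rle_div_l => //; apply/le_Rpower_ln => //; lra.
have Hyt : Rpower y t = INR n.
  by rewrite /Rpower /t; have -> : ln (INR n) / ln y * ln y = ln (INR n) by [field; lra]; rewrite exp_ln.
have Hly : 1 < ln y by lra.
have Hb : 0 < t <= U by lra.
have := Hcs y bad n t Hly Hb HtU; rewrite Hyt nfloor_INR -/t => H.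
rewrite (Hren t Ht1); apply: H => tau Htau.
apply: Rle_trans (Hgm U y bad chi eta w K HU HK Hy _ _ HyK Hbad Cc C1 _ _ Hcnt tau _) _; try lra.
- by move=> s _; have := chiB s; lra.
- by move=> a b' Ha Hb' Hab; apply: Hmod => //; lra.
Qed.

Lemma density_dickman U e : (forall u, 1 <= u -> u * sigma u = RInt (fun t => sigma (u - t)) 0 1) ->
  1 < U -> 0 < e ->
  ev (fun y => forall bad : pred nat,
    (forall p, prime p -> bad p = ~~ (p <= nfloor y)%N) ->
    forall n, (0 < n)%N -> INR n <= Rpower y U ->
      Rabs (goodcount bad n / INR n - sigma (ln (INR n) / ln y)) <= e).
Proof.
move=> Hconv HU He.
have [e1 He1 Hden] := density_of_conv HU He.
have [ea Hea Hcs] := @conv_sum_estimate (fun=> 1) U e1 (fun t => continuous_const _ _) (fun=> conj Rle_0_1 (Rle_refl 1)) HU He1.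
have [C HC Hmer] := mertens_real.
have := ev_and Hden (ev_and (ev_ln 2) (ev_div_ln (Rlt_le _ _ HC) Hea)).
apply: ev_imp => y [{}Hden [Hy HyC]] bad Hbad.
have Hy0 : 0 < y by apply: ln_gt0_pos; lra.
have HT : 0 < ln y by lra.
have Hi := Rinv_0_lt_compat _ HT.
have Hy1 : 1 <= y by rewrite -(exp_ln y) //; have := exp_ineq1_le (ln y); lra.
apply: Hden.
  by move=> p Pp Hp; rewrite Hbad // negbK; apply/nfloor_leP => //; lra.
move=> n Hn HnU; have Hn0 := lt_0_INR1 Hn.
set t := ln (INR n) / ln y.
have Ht1 : 1 <= t.
  apply: (Rmult_le_reg_r (ln y)) => //.
  have -> : t * ln y = ln (INR n) by rewrite /t; field; lra.
  by rewrite Rmult_1_l; apply: ln_le; lra.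
have HtU : t <= U by apply/Rle_div_l => //; apply/le_Rpower_ln => //; lra.
have Hly : 1 < ln y by lra.
have Hb : 0 < 1 <= U by lra.
have := Hcs y bad n 1 Hly Hb HtU; rewrite -/t Rpower_1 // => H.
rewrite (Hconv t Ht1) /conv_sum -/t.
rewrite (@rsum1_extend (nfloor y) n); first last.
- move=> p Hp; rewrite /goodp; case: (boolP (prime p)) => Pp; last by rewrite /=; ring.
  by rewrite Hbad // negbK; have -> : (p <= nfloor y)%N = false by [lia]; rewrite /=; ring.
- by apply: INR_leq_inv; have := @nfloor_spec y; lra.
rewrite (RInt_ext (fun t0 => sigma (t - t0)) (fun t0 => sigma (t - t0) * 1)); last by move=> s _; rewrite Rmult_1_r.
apply: H => tau Htau.
have Hp1 : 1 <= Rpower y tau by apply: Rpower_ge1; lra.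
have Hpy : Rpower y tau <= y by have := @Rle_Rpower y tau 1; rewrite Rpower_1 //; lra.
have -> : goodmert bad (nfloor (Rpower y tau)) = mertens (nfloor (Rpower y tau)).
  apply: rsum1_ext => p Hp; congr (_ * _); rewrite /goodp.
  case: (boolP (prime p)) => //= Pp; rewrite Hbad // negbK.
  have -> // : (p <= nfloor y)%N.
  apply/nfloor_leP; first by lra.
  by apply: Rle_trans Hpy; apply/nfloor_leP; [lra|lia].
rewrite RInt_const /scal /= /mult /= Rminus_0_r Rmult_1_r.
have := Hmer _ Hp1; rewrite ln_Rpower => HM.
have -> : mertens (nfloor (Rpower y tau)) / ln y - tau = (mertens (nfloor (Rpower y tau)) - tau * ln y) * / ln y by field; lra.
rewrite Rabs_mult (Rabs_pos_eq (/ ln y)); last by lra.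
by apply: Rle_trans HyC; apply: Rmult_le_compat_r; lra.
Qed.

End Convergence.

(* [p] is bad of level [k] when a chain of [k] steps [p -> q], [q] a prime factor of [p - 1],
   leads from [p] to a prime above [y]. *)
Fixpoint badp (y : R) (k p : nat) : bool :=
  if k is k'.+1 then has (badp y k') (primes p.-1) else ~~ (p <= nfloor y)%N.

Lemma badp_gt y k p : prime p -> badp y k p -> (nfloor y < p)%N.
Proof.
elim: k p => [|k IH] p Hp /=; first by lia.
move=> /hasP[q]; rewrite mem_primes => /and3P[Pq Hp1 Dq] /(IH q Pq).
have := dvdn_leq Hp1 Dq; lia.
Qed.

Lemma goodp_badS y k p : prime p -> goodp (badp y k.+1) p = b2r (good (badp y k) p.-1).
Proof. by move=> Hp; rewrite /goodp Hp /good /= -all_predC. Qed.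

Lemma avoids_good bad n m : (1 <= m <= n)%N ->
  avoids [seq p <- iota 1 n | prime p && bad p] m = good bad m.
Proof.
move=> Hm; apply/allP/allP => H p.
  rewrite mem_primes => /and3P[Pp Hm0 Dp]; apply/negP => Bp.
  have : p \in [seq p <- iota 1 n | prime p && bad p].
    rewrite mem_filter Pp Bp mem_iota prime_gt0 //=.
    by have := dvdn_leq Hm0 Dp; lia.
  by move/H; rewrite Dp.
rewrite mem_filter => /andP[/andP[Pp Bp] _]; apply/negP => Dp.
have : p \in primes m by rewrite mem_primes Pp Dp; case/andP: Hm => ->.
by move/H; rewrite Bp.
Qed.

(** Induction on the level: a prime [p] is good of level [k + 1] exactly when [p - 1] is good of
    level [k], so the density of integers at level [k] passes through [EH_transfer] to primes, and
    through [density_of_primes] to integers at level [k + 1]. *)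
Lemma goodcount_limit (rho : R -> R) sigma : EH_hypothesis -> is_dickman rho -> is_sigma_family rho sigma ->
  forall k U e, 1 < U -> 0 < e ->
  ev (fun y => forall n, (0 < n)%N -> INR n <= Rpower y U ->
    Rabs (goodcount (badp y k) n / INR n - sg sigma k (ln (INR n) / ln y)) <= e).
Proof.
move=> EH Hrho Hsig; elim=> [|k IH] U e HU He.
  have := density_dickman (sg_normalized Hrho Hsig 0) (sg_bounds Hrho Hsig 0) (sg0_conv Hrho Hsig) HU He.
  by apply: ev_imp => y H; apply: H.
have [eta Heta Hden] := density_of_primes (sg_normalized Hrho Hsig k.+1) (sg_bounds Hrho Hsig k.+1)
   (sg_normalized Hrho Hsig k) (sg_bounds Hrho Hsig k) (@sg_renewal _ _ Hrho Hsig k) HU He.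
have Heta2 : 0 < eta / 2 by lra.
(* [EH_transfer] asks for an exponent at least 4. Enlarging [U] only lowers the threshold [n^(1/U)],
   which stays below [y] and hence below every bad prime. *)
have HU4 : 4 <= Rmax 4 U by exact: Rmax_l.
have [X HX] := EH_transfer EH HU4 Heta2.
have := ev_and Hden (ev_and (IH U (eta / 2) HU Heta2) (ev_and (ev_ge X) (ev_ge 2))).
apply: ev_imp => y [{}Hden [Hk [HyX Hy2]]].
have Hbad : forall p, prime p -> INR p <= y -> ~~ badp y k.+1 p.
  move=> p Pp Hp; apply/negP => /(badp_gt Pp).
  by have : (p <= nfloor y)%N by [apply/nfloor_leP => //; lra]; lia.
apply: Hden => // n Hn [Hyn HnU].
have Hn0 := lt_0_INR1 Hn.
have Hn2 : (2 <= n)%N by apply: INR_leq_inv; have -> : INR 2 = 2 by []; lra.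
have Hpi := prime_pi_pos Hn2.
have HXn : X <= INR n by lra.
set L := [seq p <- iota 1 n | prime p && badp y k p].
have Lu : uniq L by exact: filter_uniq (iota_uniq _ _).
have Lp : all prime L by apply/allP => p; rewrite mem_filter => /andP[/andP[]].
have LY : all (fun p => (nfloor (Rpower (INR n) (1 / Rmax 4 U)) < p)%N) L.
  apply/allP => p; rewrite mem_filter => /andP[/andP[Pp Bp] _].
  apply: leq_ltn_trans (badp_gt Pp Bp).
  apply/nfloor_leP; first by lra.
  have := @nfloor_spec (Rpower (INR n) (1 / Rmax 4 U)) (Rlt_le _ _ (exp_pos _)).
  suff : Rpower (INR n) (1 / Rmax 4 U) <= y by lra.
  have HM := Rmax_r 4 U.
  have H1 : INR n <= Rpower y (Rmax 4 U) by apply: Rle_trans HnU _; apply: Rle_Rpower; lra.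
  have -> : y = Rpower (Rpower y (Rmax 4 U)) (1 / Rmax 4 U).
    rewrite Rpower_mult; have -> : Rmax 4 U * (1 / Rmax 4 U) = 1 by field; lra.
    by rewrite Rpower_1 //; lra.
  apply: Rle_Rpower_l; last by lra.
  by apply/Rlt_le/Rdiv_lt_0_compat; lra.
have HT := HX _ HXn n erefl L Lu Lp LY.
have E1 : rsum1 n (fun m => b2r (avoids L m)) = goodcount (badp y k) n.
  by apply: rsum1_ext => m Hm; rewrite /L avoids_good.
have E2 : rsum1 n (fun m => b2r (avoids L m) * primew n m) = rsum1 n (goodp (badp y k.+1)) / prime_pi (INR n).
  rewrite (primew_sum n (fun m => b2r (avoids L m))); congr (_ / _); apply: rsum1_ext => p Hp.
  case: (boolP (prime p)) => Pp; last by rewrite /goodp (negbTE Pp) /=; ring.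
  have Hp1 := prime_gt1 Pp.
  rewrite goodp_badS // /L avoids_good; last by lia.
  by rewrite /=; ring.
rewrite E1 E2 in HT.
have HK := Hk n Hn HnU.
rewrite -prime_pi_INR; set P := prime_pi (INR n) in Hpi HT *.
set G := rsum1 n _ in HT *; set s := sg sigma k _ in HK *; set q := goodcount _ _ / _ in HT HK.
have -> : G - s * P = (G / P - s) * P by field; lra.
rewrite Rabs_mult (Rabs_pos_eq P); last by lra.
apply: Rmult_le_compat_r; first by lra.
move: HT HK => /Rabs_le_between H1 /Rabs_le_between H2; apply/Rabs_le; lra.
Qed.

(** * Repeated prime factors of iterated totients *)

Lemma prod_prime_dvd (s : seq nat) (F : nat -> nat) q : prime q ->
  q %| \prod_(p <- s) F p -> exists2 p, p \in s & q %| F p.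
Proof.
move=> Hq; elim: s => [|p s IH]; first by rewrite big_nil Euclid_dvd1.
rewrite big_cons Euclid_dvdM // => /orP[H|/IH [r Hr Hd]]; first by exists p; rewrite ?inE ?eqxx.
by exists r => //; rewrite inE Hr orbT.
Qed.

Lemma prod_square_dvd (s : seq nat) (F : nat -> nat) r : prime r -> uniq s ->
  r ^ 2 %| \prod_(p <- s) F p ->
  (exists2 p, p \in s & r ^ 2 %| F p) \/
  (exists p q, [/\ p \in s, q \in s, p <> q, r %| F p & r %| F q]).
Proof.
move=> Hr; elim: s => [|p s IH] /=.
  rewrite big_nil dvdn1 => _ /eqP E; have := prime_gt1 Hr.
  by have : (r ^ 2 = r * r)%N by []; rewrite E; nia.
move=> /andP[Hps Hu]; rewrite big_cons => Hd.
case: (boolP (r ^ 2 %| F p)) => Hp; first by left; exists p; rewrite ?inE ?eqxx.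
case: (boolP (r %| F p)) => Hp1.
  right; have Hr0 := prime_gt0 Hr.
  have : r %| \prod_(j <- s) F j.
    move: Hd Hp; rewrite -(divnK Hp1); set a := (F p %/ r)%N.
    have -> : (r ^ 2 = r * r)%N by [].
    rewrite -mulnA [(r * \prod_(j <- s) F j)%N]mulnC mulnA dvdn_pmul2r // dvdn_pmul2r //.
    by rewrite Euclid_dvdM // => /orP[->|].
  move=> /(prod_prime_dvd Hr)[q Hq Hqd].
  exists p, q; split=> //; rewrite ?inE ?eqxx ?Hq ?orbT //.
  by move=> E; move: Hps; rewrite E Hq.
have Hd' : r ^ 2 %| \prod_(j <- s) F j.
  move: Hd; rewrite Gauss_dvdr // coprimeXl // prime_coprime //.
case: (IH Hu Hd') => [[q Hq Hqd]|[q [q' [H1 H2 H3 H4 H5]]]].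
  by left; exists q; rewrite // inE Hq orbT.
by right; exists q, q'; split; rewrite ?inE ?H1 ?H2 ?orbT.
Qed.

Lemma dvd_totient_of_pred m p q : (0 < m)%N -> prime p -> p %| m -> q %| p.-1 -> q %| totient m.
Proof.
move=> Hm Hp Hpm Hq; rewrite totientE //.
have Hin : p \in primes m by rewrite mem_primes Hp Hm.
rewrite (big_rem p) //=; apply: dvdn_mulr; exact: dvdn_mulr.
Qed.

Lemma prime_dvd_totient m q : (0 < m)%N -> prime q -> q %| totient m ->
  q ^ 2 %| m \/ exists2 p, prime p & p %| m /\ q %| p.-1.
Proof.
move=> Hm Hq; rewrite totientE // => /(prod_prime_dvd Hq)[p].
rewrite mem_primes => /and3P[Pp _ Dp]; rewrite Euclid_dvdM // => /orP[H|].
  by right; exists p.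
rewrite Euclid_dvdX // dvdn_prime2 // => /andP[/eqP E Hl]; left.
rewrite pfactor_dvdn // E; lia.
Qed.

(** Since [r] divides [m] at most once, the prime power parts of the totient are coprime to [r]; the
    square has to come from the factors [p - 1]. *)
Lemma square_dvd_totient m r : (0 < m)%N -> prime r -> ~~ (r ^ 2 %| m) -> r ^ 2 %| totient m ->
  (exists2 p, prime p & p %| m /\ r ^ 2 %| p.-1) \/
  (exists p q, [/\ prime p, prime q, p <> q & [/\ p %| m, q %| m, r %| p.-1 & r %| q.-1]]).
Proof.
move=> Hm Hr Hsq; rewrite totientE // => Hd.
have Hlog : (logn r m <= 1)%N by move: Hsq; rewrite pfactor_dvdn //; lia.
have Hpow : forall p, prime p -> p %| m -> coprime r (p ^ (logn p m).-1).
  move=> p Pp Dp; case: (eqVneq p r) => [->|Hne].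
    by have -> : (logn r m).-1 = 0%N by [lia]; rewrite expn0 coprimen1.
  by rewrite coprimeXr // prime_coprime // dvdn_prime2 // eq_sym.
case: (prod_square_dvd Hr (primes_uniq m) Hd) => [[p]|[p [q [Hp Hq Hne Dp Dq]]]].
  rewrite mem_primes => /and3P[Pp _ Dp] H; left; exists p => //; split=> //.
  by move: H; rewrite Gauss_dvdl // coprimeXl // Hpow.
right; exists p, q; move: Hp Hq; rewrite !mem_primes => /and3P[Pp _ Ep] /and3P[Pq _ Eq].
split=> //; split=> //.
  by move: Dp; rewrite Gauss_dvdl // Hpow.
by move: Dq; rewrite Gauss_dvdl // Hpow.
Qed.

Lemma totient_leq m : (totient m <= m)%N.
Proof.
rewrite totient_count_coprime.
apply: leq_trans (_ : \sum_(0 <= i < m) 1 <= m)%N; last by rewrite big_const_nat iter_addn subn0 mul1n addn0.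
by apply: leq_sum => i _; case: coprime.
Qed.

Lemma phi_iter_bounds k n : (0 < n)%N -> (0 < phi_iter k n <= n)%N.
Proof.
move=> Hn; elim: k => [|k IH] /=; first by rewrite Hn leqnn.
rewrite totient_gt0; have := totient_leq (phi_iter k n); lia.
Qed.

Definition sqbad (y : nat) (j n : nat) : bool :=
  has (fun r => (y < r)%N && (r ^ 2 %| phi_iter j n)) (primes (phi_iter j n)).

Definition nosq (y : nat) (j n : nat) : bool := all (fun i => ~~ sqbad y i n) (iota 0 j).

Lemma nosqS y j n : nosq y j.+1 n = nosq y j n && ~~ sqbad y j n.
Proof. by rewrite /nosq -addn1 iotaD all_cat /= andbT add0n. Qed.

Lemma nosq_dvd y j n r : (0 < n)%N -> prime r -> (y < r)%N -> ~~ sqbad y j n -> ~~ (r ^ 2 %| phi_iter j n).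
Proof.
move=> Hn Hr Hy; apply: contra => Hd; apply/hasP; exists r; last by rewrite Hy.
rewrite mem_primes Hr /=; have := phi_iter_bounds j Hn => /andP[-> _] /=.
by apply: dvdn_trans Hd; rewrite expnS dvdn_mulr.
Qed.

Lemma badp_phi_iter y i j n p : (0 < n)%N -> prime p -> p %| phi_iter i n -> badp y j p ->
  exists2 q, prime q & (nfloor y < q)%N /\ q %| phi_iter (i + j) n.
Proof.
move=> Hn; elim: j i p => [|j IH] i p Hp Hd /=.
  by move=> Hb; exists p => //; rewrite addn0; split=> //; lia.
move=> /hasP[q]; rewrite mem_primes => /and3P[Pq _ Dq] Hb.
rewrite -addSnnS; apply: (IH i.+1 q) => //=.
by apply: (dvd_totient_of_pred (p := p)) => //; case/andP: (phi_iter_bounds i Hn).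
Qed.

(** Climbing back one iteration: [q] divides [totient m] while [q ^ 2] does not divide [m], so [q]
    divides [p - 1] for a prime [p] dividing [m], and [p] is bad of the next level. *)
Lemma phi_iter_badp y i j n q : (0 < n)%N -> prime q -> q %| phi_iter i n -> badp y j q ->
  nosq (nfloor y) i n -> exists2 p, prime p & p %| n /\ badp y (i + j) p.
Proof.
move=> Hn; elim: i j q => [|i IH] j q Hq Hd Hb; first by exists q.
rewrite nosqS => /andP[Hns Hsq].
have Hy := badp_gt Hq Hb.
have Hm : (0 < phi_iter i n)%N by case/andP: (phi_iter_bounds i Hn).
case: (prime_dvd_totient Hm Hq Hd) => [H|[p Pp [Dp Dq]]].
  by have := nosq_dvd Hn Hq Hy Hsq; rewrite H.
rewrite addSnnS; apply: (IH j.+1 p) => //=.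
apply/hasP; exists q => //; rewrite mem_primes Hq Dq andbT /=.
by have := prime_gt1 Pp; lia.
Qed.

(** Smooth implies good for every [n], because a bad prime always pushes a prime above [y] down into
    [phi_iter k n]. The converse relies on the absence of squares. *)
Lemma smooth_good k y n : 0 <= y -> (0 < n)%N ->
  Rabs (b2r (smooth_phi_k k y n) - b2r (good (badp y k) n)) <= b2r (~~ nosq (nfloor y) k n).
Proof.
move=> Hy Hn.
have Hm : (0 < phi_iter k n)%N by case/andP: (phi_iter_bounds k Hn).
have A : smooth_phi_k k y n -> good (badp y k) n.
  move=> /allP Hs; apply/allP => p; rewrite mem_primes => /and3P[Pp _ Dp].
  apply/negP => /(badp_phi_iter (i := 0) Hn Pp Dp)[q Pq [Hq Dq]].
  have /Hs : q \in primes (phi_iter k n) by rewrite mem_primes Pq Hm.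
  by case: Rle_dec => // Hle _; have := proj2 (nfloor_leP q Hy) Hle; lia.
have B : nosq (nfloor y) k n -> good (badp y k) n -> smooth_phi_k k y n.
  move=> Hns /allP Hg; apply/allP => q; rewrite mem_primes => /and3P[Pq _ Dq].
  case: Rle_dec => // Hqy; exfalso.
  have Hb : badp y 0 q by rewrite /=; apply/negP => /(nfloor_leP q Hy).
  have [p Pp [Dp]] := phi_iter_badp Hn Pq Dq Hb Hns; rewrite addn0 => Bp.
  have /Hg : p \in primes n by rewrite mem_primes Pp Hn.
  by rewrite Bp.
move: A B; case: (smooth_phi_k k y n); case: (good (badp y k) n); case: (nosq _ _ _) => A B //=.
all: try by have := A isT.
all: try by have := B isT isT.
all: by apply/Rabs_le; lra.
Qed.

(** * Counting integers whose iterated totients have a large square factor *)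

Section Squares.

Variables (N y : nat).
Hypothesis N_gt0 : (0 < N)%N.
Let L := 1 + ln (INR N).

Let L_ge1 : 1 <= L.
Proof. by rewrite /L; have := ln_INR_ge0 N; lra. Qed.

Let N_pos : 0 < INR N. Proof. exact: lt_0_INR1. Qed.

(** Primality of [c] is discarded: [c - 1] runs through multiples of [d], a harmonic sum. The
    logarithm lost at each use is negligible against the final saving of a factor [y]. *)
Lemma recip_ap d : (0 < d)%N ->
  rsum1 N (fun c => b2r (prime c && (d %| c.-1)) * / INR c) <= L / INR d.
Proof.
move=> Hd; have Hd0 := lt_0_INR1 Hd.
rewrite rsum1_shift; last by rewrite /=; ring.
apply: (@Rle_trans _ (rsum1 N (fun n => b2r (d %| n) * / INR n))).
  apply: rsum1_le => n Hn.
  have Hn0 : 0 < INR n by apply: lt_0_INR1; lia.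
  have Hi := Rinv_0_lt_compat _ Hn0.
  have Hi' : 0 < / INR n.+1 <= / INR n.
    split; first by apply/Rinv_0_lt_compat/lt_0_INR1.
    by apply: Rinv_le_contravar => //; rewrite S_INR; lra.
  by case: (n.+1 <= N)%N; case: (prime n.+1); rewrite /=; case: (d %| n); rewrite /= ?S_INR /= in Hi' *; lra.
rewrite rsum1_dvd //.
apply: (@Rle_trans _ (rsum1 (N %/ d) (fun m => / INR d * / INR m))).
  by right; apply: rsum1_ext => m Hm; rewrite INR_muln Rinv_mult.
rewrite rsum1_scal Rmult_comm; apply: Rmult_le_compat_r.
  by apply/Rlt_le/Rinv_0_lt_compat.
apply: Rle_trans (harmonic_le N); apply: rsum1_mono; first exact: leq_div.
by move=> i Hi; apply/Rlt_le/Rinv_0_lt_compat/lt_0_INR1; lia.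
Qed.

Definition cnt1 (i p : nat) : R := rsum1 N (fun n => b2r (nosq y i n && (p %| phi_iter i n))).

Definition cnt2 (i p q : nat) : R :=
  rsum1 N (fun n => b2r [&& nosq y i n, p %| phi_iter i n & q %| phi_iter i n]).

Lemma pred_factor i n q : (1 <= n <= N)%N -> prime q -> (y < q)%N -> nosq y i.+1 n ->
  q %| phi_iter i.+1 n ->
  exists2 c, (1 <= c <= N)%N & [/\ prime c, (y < c)%N, c %| phi_iter i n & q %| c.-1].
Proof.
move=> Hn Pq Hq; rewrite nosqS => /andP[Hns Hsq] Hd.
have Hn0 : (0 < n)%N by lia.
have /andP[Hm Hmn] := phi_iter_bounds i Hn0.
case: (prime_dvd_totient Hm Pq Hd) => [H|[p Pp [Dp Dq]]].
  by have := nosq_dvd Hn0 Pq Hq Hsq; rewrite H.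
have Hp1 := prime_gt1 Pp.
exists p; first by have := dvdn_leq Hm Dp; lia.
by split=> //; have : (q <= p.-1)%N by [apply: dvdn_leq => //; lia]; lia.
Qed.

Lemma pow_mono_L i j : (i <= j)%N -> L ^ i <= L ^ j.
Proof. by move=> H; apply: Rle_pow => //; apply/leP. Qed.

Lemma pow_L_ge0 i : 0 <= L ^ i.
Proof. by apply: pow_le; lra. Qed.

Definition ap (d c : nat) : R := b2r (prime c && (d %| c.-1)).

Definition hit1 (i c n : nat) : bool := (y < c)%N && (nosq y i n && (c %| phi_iter i n)).

Definition hit2 (i c e n : nat) : bool :=
  [&& (y < c)%N, (y < e)%N & c != e] && [&& nosq y i n, c %| phi_iter i n & e %| phi_iter i n].

Lemma cover1_le i d : (0 < d)%N ->
  (forall c, prime c -> (y < c)%N -> cnt1 i c <= INR N * L ^ i / INR c) ->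
  rsum1 N (fun n => rsum1 N (fun c => ap d c * b2r (hit1 i c n))) <= INR N * L ^ i * (L / INR d).
Proof.
move=> Hd Hcnt; have HLi := pow_L_ge0 i; rewrite rsum1_swap.
apply: Rle_trans (Rmult_le_compat_l _ _ _ _ (recip_ap Hd)); last by apply: Rmult_le_pos; lra.
rewrite -rsum1_scal; apply: rsum1_le => c Hc; have Hc0 : 0 < INR c by apply: lt_0_INR1; lia.
rewrite rsum1_scal -/(ap d c).
have -> : INR N * L ^ i * (ap d c * / INR c) = ap d c * (INR N * L ^ i / INR c) by rewrite /Rdiv; ring.
case: (boolP (prime c)) => Pc; last by rewrite /ap (negbTE Pc) /=; lra.
apply: Rmult_le_compat_l; first exact: b2r_ge0.
case: (ltnP y c) => Hyc.
  by apply: Rle_trans (Hcnt c Pc Hyc); right; apply: rsum1_ext => n _; rewrite /hit1 Hyc.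
rewrite rsum1_zero; first by apply: Rdiv_le_0_compat => //; apply: Rmult_le_pos; lra.
by move=> n _; rewrite /hit1 ltnNge Hyc.
Qed.

Lemma cover2_le i p q M : (0 < p)%N -> (0 < q)%N -> 0 <= M ->
  (forall c e, prime c -> prime e -> c <> e -> (y < c)%N -> (y < e)%N ->
     cnt2 i c e <= M / (INR c * INR e)) ->
  rsum1 N (fun n => rsum1 N (fun c => rsum1 N (fun e => ap p c * ap q e * b2r (hit2 i c e n))))
   <= M * (L / INR p * (L / INR q)).
Proof.
move=> Hp Hq HM Hcnt; have Hap : forall d c, 0 <= ap d c by move=> d c; exact: b2r_ge0.
have Hinv : forall c, (1 <= c <= N)%N -> 0 < / INR c.
  by move=> c Hc; apply/Rinv_0_lt_compat/lt_0_INR1; lia.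
apply: (@Rle_trans _ (M * (rsum1 N (fun c => ap p c * / INR c) * rsum1 N (fun e => ap q e * / INR e)))); last first.
  apply: Rmult_le_compat_l => //; apply: Rmult_le_compat; try exact: recip_ap.
    by apply: rsum1_ge0 => c /Hinv Hc; apply: Rmult_le_pos => //; lra.
  by apply: rsum1_ge0 => c /Hinv Hc; apply: Rmult_le_pos => //; lra.
rewrite rsum1_swap -rsum1_scalr -rsum1_scal; apply: rsum1_le => c Hc.
have -> : M * (ap p c * / INR c * rsum1 N (fun e => ap q e * / INR e)) =
  (M * (ap p c * / INR c)) * rsum1 N (fun e => ap q e * / INR e) by ring.
rewrite rsum1_swap -rsum1_scal; apply: rsum1_le => e He.
have Hc0 : 0 < INR c by apply: lt_0_INR1; lia.
have He0 : 0 < INR e by apply: lt_0_INR1; lia.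
have -> : M * (ap p c * / INR c) * (ap q e * / INR e) = ap p c * ap q e * (M / (INR c * INR e)) by field; lra.
rewrite rsum1_scal.
case: (boolP (prime c)) => Pc; last by rewrite {1 3}/ap (negbTE Pc) /=; lra.
case: (boolP (prime e)) => Pe; last by rewrite {2 4}/ap (negbTE Pe) /=; lra.
apply: Rmult_le_compat_l; first by apply: Rmult_le_pos.
case: (boolP [&& (y < c)%N, (y < e)%N & c != e]) => H.
  have /and3P[Hyc Hye /eqP Hce] := H.
  by apply: Rle_trans (Hcnt c e Pc Pe Hce Hyc Hye); right; apply: rsum1_ext => n _; rewrite /hit2 H.
rewrite rsum1_zero; first by apply: Rdiv_le_0_compat => //; nra.
by move=> n _; rewrite /hit2 (negbTE H).
Qed.

(** Without squares, [p] dividing the next totient comes from a prime [c = 1 mod p] dividing the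
    current iterate; summing [1/c] costs one factor [L] per level. *)
Lemma cnt1_le i p : prime p -> (y < p)%N -> cnt1 i p <= INR N * L ^ i / INR p.
Proof.
elim: i p => [|i IH] p Pp Hy.
  by rewrite /cnt1 /= Rmult_1_r; apply: count_dvd_le; exact: prime_gt0.
have Hp0 := lt_0_INR1 (prime_gt0 Pp).
have -> : INR N * L ^ i.+1 / INR p = INR N * L ^ i * (L / INR p) by rewrite /=; field; lra.
apply: Rle_trans (cover1_le (prime_gt0 Pp) IH).
apply: rsum1_le => n Hn.
have H0 : forall c, (1 <= c <= N)%N -> 0 <= ap p c * b2r (hit1 i c n).
  by move=> c _; apply: Rmult_le_pos; exact: b2r_ge0.
case: (boolP (nosq y i.+1 n && (p %| phi_iter i.+1 n))) => [/andP[Hns Hd]|_]; last exact: rsum1_ge0.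
have [c Hc [Pc Hyc Dc Dp]] := pred_factor Hn Pp Hy Hns Hd.
apply: Rle_trans (rsum1_ge_term Hc H0).
by move: Hns; rewrite nosqS => /andP[Hns _]; rewrite /ap /hit1 Pc Dp Hyc Hns Dc /=; lra.
Qed.

(* Both the pairs of primes and the squares at level [i + 1] come from level [i],
   through one prime [c = 1 mod d] or two primes [c = 1 mod p], [e = 1 mod q]. *)
Lemma cover_le (P : pred nat) i d p q : (0 < p)%N -> (0 < q)%N -> d = (p * q)%N ->
  (forall c e, prime c -> prime e -> c <> e -> (y < c)%N -> (y < e)%N ->
     cnt2 i c e <= INR i.+1 * INR N * L ^ (2 * i) / (INR c * INR e)) ->
  (forall n, (1 <= n <= N)%N -> P n ->
     (exists2 c, (1 <= c <= N)%N & [/\ prime c, d %| c.-1 & hit1 i c n]) \/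
     (exists c e, [/\ (1 <= c <= N)%N, (1 <= e <= N)%N, prime c, prime e &
        [/\ p %| c.-1, q %| e.-1 & hit2 i c e n]])) ->
  rsum1 N (fun n => b2r (P n)) <= INR i.+2 * INR N * L ^ (2 * i.+1) / (INR p * INR q).
Proof.
move=> Hp Hq Ed Hcnt HP; have Hp0 := lt_0_INR1 Hp; have Hq0 := lt_0_INR1 Hq.
have Hd : (0 < d)%N by rewrite Ed muln_gt0 Hp Hq.
set M := INR i.+1 * INR N * L ^ (2 * i) in Hcnt.
have HM : 0 <= M.
  by apply: Rmult_le_pos; [apply: Rmult_le_pos; [exact: pos_INR|lra]|exact: pow_L_ge0].
have T1 := cover1_le Hd (@cnt1_le i); have T2 := cover2_le Hp Hq HM Hcnt.
rewrite Ed INR_muln in T1.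
apply: Rle_trans (Rle_trans _ _ _ (Rplus_le_compat _ _ _ _ T1 T2) _); last first.
  have -> : INR i.+2 * INR N * L ^ (2 * i.+1) / (INR p * INR q) =
    INR N * L ^ (2 * i.+1) * / (INR p * INR q) + INR i.+1 * INR N * L ^ (2 * i.+1) * / (INR p * INR q).
    by rewrite (S_INR i.+1); field; lra.
  have E2 : L ^ (2 * i.+1) = L ^ (2 * i) * L * L.
    by have -> : (2 * i.+1 = (2 * i).+2)%N by [lia]; rewrite /=; ring.
  apply: Rplus_le_compat; last by right; rewrite E2 /M; field; lra.
  have -> : INR N * L ^ i * (L / (INR p * INR q)) = INR N * L ^ i.+1 * / (INR p * INR q) by rewrite /=; field; lra.
  apply: Rmult_le_compat_r; first by apply/Rlt_le/Rinv_0_lt_compat; nra.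
  by apply: Rmult_le_compat_l; [lra|apply: pow_mono_L; lia].
rewrite -rsum1_plus; apply: rsum1_le => n Hn; rewrite -Ed.
have H0 : forall c, (1 <= c <= N)%N -> 0 <= ap d c * b2r (hit1 i c n).
  by move=> c _; apply: Rmult_le_pos; exact: b2r_ge0.
have H1 : forall c e, (1 <= e <= N)%N -> 0 <= ap p c * ap q e * b2r (hit2 i c e n).
  by move=> c e _; apply: Rmult_le_pos; [apply: Rmult_le_pos|]; exact: b2r_ge0.
have H2 : forall c, (1 <= c <= N)%N -> 0 <= rsum1 N (fun e => ap p c * ap q e * b2r (hit2 i c e n)).
  by move=> c _; apply: rsum1_ge0; exact: H1.
have S0 := rsum1_ge0 H0; have S2 := rsum1_ge0 H2.
case: (boolP (P n)) => Pn; last exact: Rplus_le_le_0_compat.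
case: (HP n Hn Pn) => [[c Hc [Pc Dc Hh]]|[c [e [Hc He Pc Pe [Dc De Hh]]]]].
  by have := rsum1_ge_term Hc H0; rewrite {1}/ap Pc Dc Hh /=; lra.
have := rsum1_ge_term Hc H2; have := rsum1_ge_term He (H1 c).
by rewrite {1 2}/ap Pc Dc Pe De Hh /=; lra.
Qed.

(** The factor [i + 1] counts the possible histories of the two chains of primes leading to [p] and
    [q]: they share a prime from one of the [i] steps on, or never do. *)
Lemma cnt2_le i p q : prime p -> prime q -> p <> q -> (y < p)%N -> (y < q)%N ->
  cnt2 i p q <= INR i.+1 * INR N * L ^ (2 * i) / (INR p * INR q).
Proof.
elim: i p q => [|i IH] p q Pp Pq Hne Hyp Hyq.
  rewrite /cnt2 muln0 [INR 1]/= [L ^ 0]/= Rmult_1_l Rmult_1_r -INR_muln.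
  apply: Rle_trans (count_dvd_le N _); last by rewrite muln_gt0 !prime_gt0.
  right; apply: rsum1_ext => n _; rewrite /= Gauss_dvd //.
  by rewrite prime_coprime // dvdn_prime2 //; apply/eqP.
apply: (cover_le (prime_gt0 Pp) (prime_gt0 Pq) erefl IH) => n Hn /and3P[Hns Hd1 Hd2].
have [c Hc [Pc Hyc Dc Dp]] := pred_factor Hn Pp Hyp Hns Hd1.
have [e He [Pe Hye De Dq]] := pred_factor Hn Pq Hyq Hns Hd2.
move: Hns; rewrite nosqS => /andP[Hns _].
case: (eqVneq c e) => [E|Hce]; [left; exists c => //|right; exists c, e].
  split=> //; last by rewrite /hit1 Hyc Hns.
  by rewrite Gauss_dvd ?Dp ?E ?Dq // prime_coprime // dvdn_prime2 //; apply/eqP.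
by split=> //; split=> //; rewrite /hit2 Hyc Hye Hce Hns Dc.
Qed.

Lemma recip_sq_tail : (0 < y)%N -> rsum1 N (fun r => b2r (y < r)%N * / INR r ^ 2) <= / INR y.
Proof.
move=> Hy; have Hy0 := lt_0_INR1 Hy; have Hiy := Rinv_0_lt_compat _ Hy0.
suff H : forall M, (y <= M)%N -> rsum1 M (fun r => b2r (y < r)%N * / INR r ^ 2) <= / INR y - / INR M.
  case: (leqP y N) => HyN; first by have := H N HyN; have := Rinv_0_lt_compat _ N_pos; lra.
  rewrite rsum1_zero; first by lra.
  by move=> r Hr; have -> : (y < r)%N = false by [lia]; rewrite /=; ring.
elim=> [|M IH] HM; first by lia.
case: (eqVneq y M.+1) => [E|Hne].
  rewrite -E rsum1_zero; first by lra.
  by move=> r Hr; have -> : (y < r)%N = false by [lia]; rewrite /=; ring.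
have HyM : (y <= M)%N by lia.
rewrite rsum1S; have -> : (y < M.+1)%N by lia.
have HM0 : 0 < INR M by apply: lt_0_INR1; lia.
have := IH HyM; rewrite [b2r true]/= Rmult_1_l S_INR => H.
suff : / (INR M + 1) ^ 2 <= / INR M - / (INR M + 1) by lra.
have -> : / INR M - / (INR M + 1) = / (INR M * (INR M + 1)) by field; lra.
by apply: Rinv_le_contravar; nra.
Qed.

(** Counting at the first level where a square occurs keeps [nosq] available below it. For [j >= 1]
    the square is then covered like a pair with [p = q = r], and the sum of [1 / r^2] over [r > y]
    gives the factor [1 / y]. *)
Lemma first_square_le j : (0 < y)%N ->
  rsum1 N (fun n => b2r (nosq y j n && sqbad y j n)) <= INR j.+1 * INR N * L ^ (2 * j) / INR y.
Proof.
move=> Hy; have Hy0 := lt_0_INR1 Hy; have Hiy := Rinv_0_lt_compat _ Hy0.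
have HL0 : forall j, 0 <= L ^ j by move=> i; apply: pow_le; lra.
have Hj0 := pos_INR j.+1.
apply: (@Rle_trans _ (rsum1 N (fun r => b2r (y < r)%N * (INR j.+1 * INR N * L ^ (2 * j) * / INR r ^ 2)))); last first.
  rewrite (@rsum1_ext N _ (fun r => INR j.+1 * INR N * L ^ (2 * j) * (b2r (y < r)%N * / INR r ^ 2))); last by move=> r _; ring.
  rewrite rsum1_scal; apply: Rmult_le_compat_l; last exact: recip_sq_tail.
  by apply: Rmult_le_pos => //; apply: Rmult_le_pos => //; lra.
pose X r n := b2r (prime r && (y < r)%N) * b2r (nosq y j n && (r ^ 2 %| phi_iter j n)).
have HX0 : forall r n, 0 <= X r n by move=> r n; apply: Rmult_le_pos; exact: b2r_ge0.
apply: (@Rle_trans _ (rsum1 N (fun r => rsum1 N (X r)))).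
  rewrite rsum1_swap; apply: rsum1_le => n Hn.
  have Hn0 : (0 < n)%N by lia.
  have /andP[Hm Hmn] := phi_iter_bounds j Hn0.
  case: (boolP (nosq y j n && sqbad y j n)) => [/andP[Hns /hasP[r]]|_]; last by apply: rsum1_ge0.
  rewrite mem_primes => /and3P[Pr _ Dr] /andP[Hyr Hsq].
  have Hr : (1 <= r <= N)%N by rewrite prime_gt0 //=; have := dvdn_leq Hm Dr; lia.
  apply: Rle_trans (rsum1_ge_term (f := fun r => X r n) Hr (fun i _ => HX0 i n)).
  by rewrite /X Pr Hyr Hns Hsq /=; lra.
apply: rsum1_le => r Hr; have Hr0 : 0 < INR r by apply: lt_0_INR1; lia.
have Hir : 0 < / INR r ^ 2 by apply: Rinv_0_lt_compat; apply: pow_lt.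
rewrite /X rsum1_scal.
case: (boolP (prime r && (y < r)%N)) => [/andP[Pr Hyr]|_]; last first.
  rewrite /= Rmult_0_l; apply: Rmult_le_pos; first exact: b2r_ge0.
  by apply: Rmult_le_pos; [apply: Rmult_le_pos => //; apply: Rmult_le_pos => //; lra|rewrite /= in Hir; lra].
rewrite Hyr [b2r true]/= !Rmult_1_l.
have E2 : INR (r ^ 2) = INR r ^ 2 by rewrite expnS expn1 INR_muln /=; ring.
case: j {X HX0} Hj0 => [|j] Hj0.
  rewrite /= !Rmult_1_l Rmult_1_r -/(INR r ^ 2).
  apply: Rle_trans (count_dvd_le N _) _; first by rewrite expn_gt0; lia.
  by rewrite E2 /=; lra.
have -> : INR j.+2 * INR N * L ^ (2 * j.+1) * / INR r ^ 2 = INR j.+2 * INR N * L ^ (2 * j.+1) / (INR r * INR r).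
  by rewrite /Rdiv; congr (_ * / _); ring.
apply: (@cover_le _ j (r ^ 2)%N r r) => //; try exact: prime_gt0.
  exact: cnt2_le.
move=> n Hn /andP[Hns Hd]; have Hn0 : (0 < n)%N by lia.
have /andP[Hm Hmn] := phi_iter_bounds j Hn0.
move: Hns; rewrite nosqS => /andP[Hns Hsq].
have Hnd := nosq_dvd Hn0 Pr Hyr Hsq.
have Hbig : forall c, prime c -> c %| phi_iter j n -> r %| c.-1 -> (1 <= c <= N)%N /\ (y < c)%N.
  move=> c Pc Dc Drc; have Hc1 := prime_gt1 Pc; have := dvdn_leq Hm Dc.
  have : (r <= c.-1)%N by apply: dvdn_leq => //; lia.
  by move=> ? ?; split; lia.
case: (square_dvd_totient Hm Pr Hnd Hd) => [[c Pc [Dc Drc]]|[c [e [Pc Pe /eqP Hce [Dc De Drc Dre]]]]].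
  have Hrc : r %| c.-1 by apply: dvdn_trans Drc; rewrite expnS dvdn_mulr.
  have [Hc Hyc] := Hbig c Pc Dc Hrc.
  by left; exists c => //; split=> //; rewrite /hit1 Hyc Hns.
have [Hc Hyc] := Hbig c Pc Dc Drc; have [He Hye] := Hbig e Pe De Dre.
by right; exists c, e; split=> //; split=> //; rewrite /hit2 Hyc Hye Hce Hns Dc.
Qed.

(** The integers are sorted by the first level carrying a square; [k ^ 2] majorizes
    [1 + 2 + ... + k]. *)
Lemma square_count_le k : (0 < y)%N ->
  rsum1 N (fun n => b2r (~~ nosq y k n)) <= INR k ^ 2 * INR N * L ^ (2 * k) / INR y.
Proof.
move=> Hy; have Hy0 := lt_0_INR1 Hy; have Hiy := Rinv_0_lt_compat _ Hy0.
have HL0 : forall j, 0 <= L ^ j by move=> i; apply: pow_le; lra.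
elim: k => [|k IH].
  rewrite rsum1_zero; first by rewrite /= /Rdiv !Rmult_0_l; lra.
  by move=> n _; rewrite /nosq.
apply: (@Rle_trans _ (rsum1 N (fun n => b2r (~~ nosq y k n)) + rsum1 N (fun n => b2r (nosq y k n && sqbad y k n)))).
  rewrite -rsum1_plus; apply: rsum1_le => n _; rewrite nosqS.
  by case: (nosq y k n); case: (sqbad y k n) => /=; lra.
apply: Rle_trans (Rplus_le_compat _ _ _ _ IH (first_square_le k Hy)) _.
have -> : INR k ^ 2 * INR N * L ^ (2 * k) / INR y + INR k.+1 * INR N * L ^ (2 * k) / INR y = (INR k ^ 2 + INR k.+1) * INR N * / INR y * L ^ (2 * k) by rewrite /Rdiv; ring.
have -> : INR k.+1 ^ 2 * INR N * L ^ (2 * k.+1) / INR y = INR k.+1 ^ 2 * INR N * / INR y * L ^ (2 * k.+1) by rewrite /Rdiv; ring.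
have Hk := pos_INR k; have HS : INR k.+1 = INR k + 1 by exact: S_INR.
apply: Rmult_le_compat => //.
- apply: Rmult_le_pos; last by lra.
  by apply: Rmult_le_pos; [rewrite HS; nra|lra].
- apply: Rmult_le_compat_r; first by lra.
  by apply: Rmult_le_compat_r; [lra|rewrite HS; nra].
- by apply: pow_mono_L; lia.
Qed.

End Squares.

(** * The asymptotic formula for the count *)

Lemma Phi_count_goodcount k x y : 0 <= y -> (0 < nfloor x)%N -> (0 < nfloor y)%N ->
  Rabs (Phi_count k x y - goodcount (badp y k) (nfloor x)) <=
  INR k ^ 2 * INR (nfloor x) * (1 + ln (INR (nfloor x))) ^ (2 * k) / INR (nfloor y).
Proof.
move=> Hy HN HY.
apply: Rle_trans (square_count_le HN k HY).
rewrite /Phi_count count_rsum1 /goodcount -rsum1_minus; apply: Rle_trans (rsum1_abs _ _) _.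
by apply: rsum1_le => n Hn; apply: smooth_good => //; lia.
Qed.

Lemma Phi_count_asymp (rho : R -> R) sigma :
  EH_hypothesis -> is_dickman rho -> is_sigma_family rho sigma ->
  forall U, 1 < U -> forall k eps, 0 < eps ->
  exists X, forall x, X <= x -> forall u, 1 <= u <= U ->
    Rabs (Phi_count k x (Rpower x (1 / u)) - x * sigma k u) <= eps * (x * sigma k u).
Proof.
move=> EH Hrho Hsig U HU k eps Heps.
have [Sc S1] := sg_normalized Hrho Hsig k.
have HU1 : 1 <= U by lra.
have [m Hm Hmin] := cont_min HU1 Sc.
pose s0 := sg sigma k m.
have Hs0 : 0 < s0 by have := sg_bounds Hrho Hsig k m; rewrite /s0; lra.
(* The minimum [s0] on [[1, U]] converts absolute into relative error. The four shares go to the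
   density of good integers, to the squares, to the variation of [sg sigma k] and to the rounding of
   [x]. *)
pose e := eps * s0 / 4; have He : 0 < e by rewrite /e; nra.
have [d Hd Hmod] := normalized_unif U (sg_normalized Hrho Hsig k) He.
have HU0 : 0 <= U by lra.
have Hk2 : 0 < 2 * INR k ^ 2 + 1 by have := pow2_ge_0 (INR k); lra.
have Hek : 0 < e / (2 * INR k ^ 2 + 1) by exact: Rdiv_lt_0_compat.
(* Since [ln x <= U * ln y], the powers of [ln x] lost to the squares are powers of [ln y], beaten
   by [y]. *)
have Hpl := @ev_poly_ln (2 * k) U 1 _ HU0 Rlt_0_1 Hek.
have [Y HY] := ev_and (ev_and (goodcount_limit EH Hrho Hsig k HU He) Hpl)
   (ev_and (ev_ge 2) (ev_and (ev_ln 1) (ev_inv_ln Hd))).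
have HiU : 0 < 1 / U by apply: Rdiv_lt_0_compat; lra.
have [X HX] := ev_and (ev_Rpower Y HiU) (ev_and (ev_ge 1) (ev_ge (/ e))).
exists X => x /HX [HxY [Hx1 Hxe]] u Hu.
set y := Rpower x (1 / u).
have HyY : Y <= y.
  apply: Rle_trans HxY _; apply: Rle_Rpower => //.
  by rewrite /Rdiv !Rmult_1_l; apply: Rinv_le_contravar; lra.
have [[Hgc {}Hpl] [Hy2 [Hly Hyd]]] := HY y HyY.
have Hyx : Rpower y u = x.
  rewrite /y Rpower_mult; have -> : 1 / u * u = 1 by field; lra.
  by rewrite Rpower_1 //; lra.
have Hy0 : 0 <= y by lra.
have Hx0 : 0 <= x by lra.
have HN : (0 < nfloor x)%N by apply/nfloor_leP.
have HYn : (0 < nfloor y)%N by apply/nfloor_leP => //=; lra.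
have SN := nfloor_spec Hx0; have SY := nfloor_spec Hy0.
have HlN := ln_nfloor Hx1.
set N := nfloor x in HN SN HlN *.
have HN1 := INR_ge1 HN.
have Hlx : ln x = u * ln y by rewrite -{1}Hyx ln_Rpower.
have HNU : INR N <= Rpower y U.
  apply: Rle_trans (proj1 SN) _; rewrite -{1}Hyx; apply: Rle_Rpower; lra.
have HG := Hgc N HN HNU.
set t := ln (INR N) / ln y in HG.
have Ht : Rabs (t - u) <= / ln y.
  have -> : t - u = (ln (INR N) - ln x) * / ln y by rewrite /t Hlx; field; lra.
  have Hi : 0 < / ln y by apply: Rinv_0_lt_compat; lra.
  rewrite Rabs_mult (Rabs_pos_eq (/ ln y)); last by lra.
  rewrite -{2}[/ ln y]Rmult_1_l; apply: Rmult_le_compat_r; first by lra.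
  by apply/Rabs_le; lra.
have HtU : t <= U.
  by apply/Rle_div_l; [lra|apply/le_Rpower_ln => //; lra].
have HS : Rabs (sg sigma k t - sg sigma k u) <= e by apply: Hmod; lra.
have Hsu : s0 <= sg sigma k u by apply: Hmin.
have Hsb := sg_bounds Hrho Hsig k u; have Htb := sg_bounds Hrho Hsig k t.
rewrite -(sgE Hrho Hsig k (u := u)); last by lra.
have HP := @Phi_count_goodcount k x y Hy0 HN HYn.
rewrite -/N in HP.
have HP2 : INR k ^ 2 * INR N * (1 + ln (INR N)) ^ (2 * k) / INR (nfloor y) <= INR N * e.
  have Hpow : (1 + ln (INR N)) ^ (2 * k) <= (1 + U * ln y) ^ (2 * k).
    apply: pow_incr; have := ln_ge0 HN1 => H0; split; first by lra.
    by have : u * ln y <= U * ln y by [apply: Rmult_le_compat_r; lra]; lra.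
  have Hy1 : Rpower y 1 = y by rewrite Rpower_1 //; lra.
  rewrite Hy1 in Hpl.
  have HYpos := lt_0_INR1 HYn.
  apply/Rle_div_l => //.
  have Hk0 := pow2_ge_0 (INR k).
  have A1 : INR k ^ 2 * (1 + ln (INR N)) ^ (2 * k) <= INR k ^ 2 * (e / (2 * INR k ^ 2 + 1) * y).
    by apply: Rmult_le_compat_l => //; lra.
  have A2 : INR k ^ 2 * (e / (2 * INR k ^ 2 + 1) * y) <= e * INR (nfloor y).
    have -> : INR k ^ 2 * (e / (2 * INR k ^ 2 + 1) * y) = (INR k ^ 2 / (2 * INR k ^ 2 + 1)) * (e * y) by field; lra.
    have B1 : INR k ^ 2 / (2 * INR k ^ 2 + 1) <= / 2 by apply/Rle_div_l => //; lra.
    have B2 : 0 <= INR k ^ 2 / (2 * INR k ^ 2 + 1) by apply: Rdiv_le_0_compat.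
    have B3 : y <= 2 * INR (nfloor y) by have := INR_ge1 HYn; lra.
    have B4 : e * y <= e * (2 * INR (nfloor y)) by apply: Rmult_le_compat_l; lra.
    have B5 : INR k ^ 2 / (2 * INR k ^ 2 + 1) * (e * y) <= / 2 * (e * y) by apply: Rmult_le_compat_r; nra.
    lra.
  have -> : INR k ^ 2 * INR N * (1 + ln (INR N)) ^ (2 * k) = INR N * (INR k ^ 2 * (1 + ln (INR N)) ^ (2 * k)) by ring.
  have -> : INR N * e * INR (nfloor y) = INR N * (e * INR (nfloor y)) by ring.
  by apply: Rmult_le_compat_l; lra.
have HG2 : Rabs (goodcount (badp y k) N - INR N * sg sigma k t) <= INR N * e.
  have -> : goodcount (badp y k) N - INR N * sg sigma k t = INR N * (goodcount (badp y k) N / INR N - sg sigma k t) by field; lra.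
  rewrite Rabs_mult (Rabs_pos_eq (INR N)); last by lra.
  by apply: Rmult_le_compat_l; lra.
have Hxe1 : 1 <= x * e.
  by have := Rmult_le_compat_r e _ _ (Rlt_le _ _ He) Hxe; rewrite Rinv_l; lra.
have HNe : INR N * e <= x * e by apply: Rmult_le_compat_r; lra.
have HD : Rabs (INR N * sg sigma k t - x * sg sigma k u) <= 2 * (x * e).
  have -> : INR N * sg sigma k t - x * sg sigma k u = (INR N - x) * sg sigma k t + x * (sg sigma k t - sg sigma k u) by ring.
  apply: Rle_trans (Rabs_triang _ _) _; rewrite !Rabs_mult (Rabs_pos_eq x) // (Rabs_pos_eq (sg sigma k t)); last by lra.
  have C1 : Rabs (INR N - x) <= 1 by apply/Rabs_le; lra.
  have C2 : x * Rabs (sg sigma k t - sg sigma k u) <= x * e by apply: Rmult_le_compat_l.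
  have C3 := Rabs_pos (INR N - x).
  nra.
have Hfin : 4 * (x * e) <= eps * (x * sg sigma k u).
  have -> : 4 * (x * e) = eps * x * s0 by rewrite /e; field.
  rewrite -Rmult_assoc; apply: Rmult_le_compat_l => //; nra.
move: HP HG2 HD => /Rabs_le_between P1 /Rabs_le_between P2 /Rabs_le_between P3.
by apply/Rabs_le; lra.
Qed.

(** * Exponential comparison *)

Lemma cont_exp_lin s t : continuous (fun t : R => exp (s * t)) t.
Proof.
apply: continuous_exp_comp; apply: continuous_mult; [exact: continuous_const|exact: continuous_id].
Qed.

Lemma cont_exp_mul (f : R -> R) s t : (forall t : R, continuous f t) -> continuous (fun t : R => exp (s * t) * f t) t.
Proof. by move=> Hf; apply: continuous_mult; [exact: cont_exp_lin|exact: Hf]. Qed.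

Lemma RInt_Rscal (f : R -> R) c a b : (forall t : R, continuous f t) ->
  RInt (fun t => c * f t) a b = c * RInt f a b.
Proof.
by move=> Hf; rewrite -[RHS]/(scal c (RInt f a b)) -RInt_scal //; exact: ex_RInt_cont.
Qed.

Lemma cont_scal (f : R -> R) c t : (forall t : R, continuous f t) -> continuous (fun t : R => c * f t) t.
Proof. by move=> Hf; apply: continuous_mult; [exact: continuous_const|exact: Hf]. Qed.

Lemma RInt_le_cont (f g : R -> R) a b : a <= b -> (forall t : R, continuous f t) -> (forall t : R, continuous g t) ->
  (forall t, a < t < b -> f t <= g t) -> RInt f a b <= RInt g a b.
Proof. by move=> Hab Hf Hg H; apply: RInt_le => //; exact: ex_RInt_cont. Qed.

(** The integral is truncated because its convergence depends on decay of [chi] still to be proved;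
    bounds above are asked for all [T], bounds below for one [T]. *)
Definition laplace (chi : R -> R) (s T : R) : R := RInt (fun t => exp (s * t) * chi t) 0 T.

Lemma laplace_mono chi s T T' : (forall t : R, continuous chi t) -> (forall t, 0 < chi t <= 1) ->
  T <= T' -> laplace chi s T <= laplace chi s T'.
Proof.
move=> Hc Hb HT; rewrite /laplace (RInt_split 0 T T'); last by move=> t; exact: cont_exp_mul.
have : 0 * (T' - T) <= RInt (fun t => exp (s * t) * chi t) T T'.
  apply: RInt_ge_const => // [t|t _]; first exact: cont_exp_mul.
  by apply: Rmult_le_pos; [exact/Rlt_le/exp_pos|have := Hb t; lra].
lra.
Qed.

Section Renewal.

Variables (chi sigma : R -> R).
Hypothesis chiN : normalized chi.
Hypothesis sigmaN : normalized sigma.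
Hypothesis chiB : forall t, 0 < chi t <= 1.
Hypothesis sigmaB : forall t, 0 < sigma t <= 1.

(* The maximum of [sigma v * exp (s v)] on [[0, u]] cannot be attained beyond [H],
   where the renewal equation would make it smaller than itself. *)
Lemma renewal_upper s H u : renewal chi sigma -> 0 <= s -> 0 <= u ->
  (forall T, 0 <= T -> laplace chi s T < H) -> sigma u <= exp (s * H - s * u).
Proof.
move=> Hr Hs Hu HH; have [Cc C1] := chiN; have [Sc S1] := sigmaN.
have Hf : forall t : R, continuous (fun t => exp (s * t) * sigma t) t by move=> t; exact: cont_exp_mul.
have [m Hm Hmax] := cont_max Hu Hf; rewrite /= in Hmax.
suff Hmm : exp (s * m) * sigma m <= exp (s * H).
  have Huu : 0 <= u <= u by lra.
  have := Hmax u Huu => H1.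
  have E : exp (s * H - s * u) * exp (s * u) = exp (s * H) by rewrite -exp_plus; congr exp; ring.
  have Hp := exp_pos (s * u).
  by apply: (Rmult_le_reg_r (exp (s * u))) => //; lra.
have Hem := exp_pos (s * m); have Hsm := sigmaB m.
case: (Rle_dec m H) => HmH.
  have : exp (s * m) <= exp (s * H) by apply: exp_le_compat; nra.
  nra.
exfalso; case: (Rle_dec 1 m) => Hm1.
  have E := Hr m Hm1.
  have Hm0 : 0 <= m by lra.
  have HL := HH m Hm0.
  have : RInt (fun t => sigma (m - t) * chi t) 0 m <= sigma m * laplace chi s m.
    rewrite /laplace -RInt_Rscal; last by move=> t; exact: cont_exp_mul.
    apply: RInt_le_cont => //; try (move=> t; exact: cont_conv).
      by move=> t; apply: cont_scal => t'; exact: cont_exp_mul.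
    move=> t Ht; have := chiB t => Hct.
    rewrite -Rmult_assoc; apply: Rmult_le_compat_r; first by lra.
    have Hmt : 0 <= m - t <= u by lra.
    have := Hmax (m - t) Hmt => H1.
    have E1 : exp (s * m) = exp (s * (m - t)) * exp (s * t) by rewrite -exp_plus; congr exp; ring.
    have Hp := exp_pos (s * (m - t)).
    apply: (Rmult_le_reg_l (exp (s * (m - t)))) => //.
    by rewrite E1 in H1; lra.
  nra.
have Hm0 : 0 <= m by lra.
have := HH m Hm0.
have : 1 * (m - 0) <= laplace chi s m.
  apply: RInt_ge_const => // [t|t Ht]; first exact: cont_exp_mul.
  rewrite C1; last by lra.
  by rewrite Rmult_1_r -exp_0; apply: exp_le_compat; nra.
lra.
Qed.

(** Dual to [renewal_upper]: a minimum of [exp (s v) * sigma v] on [[0, u]] at [m > T] would give [m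
    * sigma m >= sigma m * laplace chi s T > u * sigma m], although [m <= u]. *)
Lemma renewal_lower s T c u : renewal chi sigma -> 0 <= s -> 1 <= T -> 0 <= u ->
  u < laplace chi s T -> (forall v, 0 <= v <= T -> c <= exp (s * v) * sigma v) ->
  c <= exp (s * u) * sigma u.
Proof.
move=> Hr Hs HT Hu HL Hc; have [Cc C1] := chiN; have [Sc S1] := sigmaN.
have Hf : forall t : R, continuous (fun t => exp (s * t) * sigma t) t by move=> t; exact: cont_exp_mul.
have [m Hm Hmin] := cont_min Hu Hf; rewrite /= in Hmin.
have Huu : 0 <= u <= u by lra.
apply: Rle_trans (Hmin u Huu).
case: (Rle_dec m T) => HmT; first by apply: Hc; lra.
exfalso; have Hm1 : 1 <= m by lra.
have E := Hr m Hm1; have Hsm := sigmaB m.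
have : sigma m * laplace chi s m <= RInt (fun t => sigma (m - t) * chi t) 0 m.
  rewrite /laplace -RInt_Rscal; last by move=> t; exact: cont_exp_mul.
  apply: RInt_le_cont; first by lra.
  - by move=> t; apply: cont_scal => t'; exact: cont_exp_mul.
  - by move=> t; exact: cont_conv.
  move=> t Ht; have := chiB t => Hct.
  rewrite -Rmult_assoc; apply: Rmult_le_compat_r; first by lra.
  have Hmt : 0 <= m - t <= u by lra.
  have := Hmin (m - t) Hmt => H1.
  have E1 : exp (s * m) = exp (s * (m - t)) * exp (s * t) by rewrite -exp_plus; congr exp; ring.
  have Hp := exp_pos (s * (m - t)).
  apply: (Rmult_le_reg_l (exp (s * (m - t)))) => //.
  by rewrite E1 in H1; lra.
have : laplace chi s T <= laplace chi s m by apply: laplace_mono => //; lra.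
nra.
Qed.

Lemma renewal_crude u : renewal chi sigma -> 0 <= u -> exp (- (2 * ln (2 * u + 2) * u)) <= sigma u.
Proof.
move=> Hr Hu; have [Cc C1] := chiN; have [Sc S1] := sigmaN.
(* On [[1/2, 1]] the integrand is at least [exp (s / 2) = 2 u + 2], so already the transform up to 1
   exceeds [u]. *)
set s := 2 * ln (2 * u + 2).
have Hs : 0 <= s by have := @ln_ge0 (2 * u + 2); rewrite /s; lra.
have HL : u < laplace chi s 1.
  have Hce : forall t : R, continuous (fun t : R => exp (s * t) * chi t) t by move=> t; exact: cont_exp_mul.
  rewrite /laplace (RInt_split 0 (/ 2) 1 Hce).
  have A1 : 0 * (/ 2 - 0) <= RInt (fun t => exp (s * t) * chi t) 0 (/ 2).
    apply: RInt_ge_const => // [|t _]; first by lra.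
    by apply: Rmult_le_pos; [exact/Rlt_le/exp_pos|have := chiB t; lra].
  have A2 : (2 * u + 2) * (1 - / 2) <= RInt (fun t => exp (s * t) * chi t) (/ 2) 1.
    apply: RInt_ge_const => // [|t Ht]; first by lra.
    rewrite C1; last by lra.
    rewrite Rmult_1_r -{1}(exp_ln (2 * u + 2)); last by lra.
    by apply: exp_le_compat; rewrite /s in Hs *; nra.
  lra.
have := @renewal_lower s 1 1 u Hr Hs (Rle_refl 1) Hu HL.
have H1 : forall v, 0 <= v <= 1 -> 1 <= exp (s * v) * sigma v.
  move=> v Hv; rewrite S1; last by lra.
  by rewrite Rmult_1_r -{1}exp_0; apply: exp_le_compat; apply: Rmult_le_pos; lra.
move=> /(_ H1) H.
rewrite exp_Ropp; have Hp := exp_pos (s * u).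
apply: (Rmult_le_reg_l (exp (s * u))) => //.
by rewrite Rinv_r; lra.
Qed.

(** [renewal_crude] supplies the starting value on [[0, T]]: there [2 v ln (2 v + 2) <= 2 v (2 v +
    1) <= 6 T^2]. *)
Lemma renewal_lower_full s T u : renewal chi sigma -> 0 <= s -> 1 <= T -> 0 <= u ->
  u < laplace chi s T -> exp (- (6 * T ^ 2) - s * u) <= sigma u.
Proof.
move=> Hr Hs HT Hu HL.
have H : exp (- (6 * T ^ 2)) <= exp (s * u) * sigma u.
  apply: (renewal_lower Hr Hs HT Hu HL) => v Hv.
  have Hv0 : 0 <= v by lra.
  have Hc := renewal_crude Hr Hv0.
  have H1 : 1 <= exp (s * v) by rewrite -exp_0; apply: exp_le_compat; nra.
  have Hp := exp_pos (- (2 * ln (2 * v + 2) * v)).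
  apply: (@Rle_trans _ (exp (- (2 * ln (2 * v + 2) * v)))); last by nra.
  apply: exp_le_compat.
  have Hl : ln (2 * v + 2) <= 2 * v + 1 by have := @ln_le_sub1 (2 * v + 2); lra.
  nra.
have Hp := exp_pos (s * u); apply: (Rmult_le_reg_r (exp (s * u))) => //.
rewrite -exp_plus; have -> : - (6 * T ^ 2) - s * u + s * u = - (6 * T ^ 2) by ring.
lra.
Qed.

End Renewal.

(** * The transform of the Dickman function *)

Lemma const_of_derive0 (F : R -> R) a b : a <= b -> (forall v, a < v < b -> is_derive F v 0) ->
  (forall v : R, continuous F v) -> F b = F a.
Proof.
move=> Hab HF CF.
have [c [Hc E]] := MVT_gen F a b (fun=> 0) (fun v Hv => HF v ltac:(rewrite Rmin_left ?Rmax_right in Hv; lra)) (fun v _ => cont_pt (CF v)).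
lra.
Qed.

Lemma laplace_derive_T chi s T : (forall t : R, continuous chi t) ->
  is_derive (fun T => laplace chi s T) T (exp (s * T) * chi T).
Proof. by move=> Hc; apply: (is_derive_RInt_cont (f := fun t => exp (s * t) * chi t)) => t; exact: cont_exp_mul. Qed.

Lemma laplace_derive_s chi s T : (forall t : R, continuous chi t) -> 0 <= T ->
  is_derive (fun s => laplace chi s T) s (laplace (fun t => t * chi t) s T).
Proof.
move=> Hc HT; rewrite /laplace.
have D : forall u v, is_derive (fun z : R => exp (z * v) * chi v) u (exp (u * v) * (v * chi v)).
  by move=> u v; auto_derive => //; ring.
have -> : RInt (fun t => exp (s * t) * (t * chi t)) 0 T = RInt (fun t => Derive (fun u => exp (u * t) * chi t) s) 0 T.
  by apply: RInt_ext => t _; rewrite (is_derive_unique _ _ _ (D s t)).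
apply: (is_derive_RInt_param (fun s t => exp (s * t) * chi t)).
- by apply: filter_forall => x t _; exists (exp (x * t) * (t * chi t)).
- move=> t _; apply: (continuity_2d_pt_ext (fun u v => exp (u * v) * (v * chi v))).
    by move=> u v; rewrite (is_derive_unique _ _ _ (D u v)).
  apply: continuity_2d_pt_mult.
    apply: (continuity_1d_2d_pt_comp exp (fun u v => u * v)).
      by apply: cont_pt; exact: continuous_exp.
    by apply: continuity_2d_pt_mult; [exact: continuity_2d_pt_id1|exact: continuity_2d_pt_id2].
  apply: continuity_2d_pt_mult; first exact: continuity_2d_pt_id2.
  apply: (continuity_1d_2d_pt_comp chi (fun u v => v)); last exact: continuity_2d_pt_id2.
  exact: cont_pt.
- by apply: filter_forall => x; apply: ex_RInt_cont => t; exact: cont_exp_mul.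
Qed.

Section DickmanLaplace.

Variable rho : R -> R.
Hypothesis rhoN : normalized rho.
Hypothesis rhoD : forall u, 1 < u -> is_derive rho u (- rho (u - 1) / u).

Let Cc : forall t : R, continuous rho t. Proof. by case: rhoN. Qed.
Let C1 : forall t, t <= 1 -> rho t = 1. Proof. by case: rhoN. Qed.
Let rhoB : forall t, 0 < rho t <= 1.
Proof. by move=> t; split; [exact: (dickman_pos rhoN rhoD)|exact: (dickman_le1 rhoN rhoD)]. Qed.

Let Ctr : forall t : R, continuous (fun t => t * rho t) t.
Proof. by move=> t; apply: continuous_mult => //; exact: continuous_id. Qed.

Lemma cont_laplace chi s v : (forall t : R, continuous chi t) -> continuous (fun T => laplace chi s T) v.
Proof. by move=> Hc; apply: ex_derive_continuous; exists (exp (s * v) * chi v); exact: laplace_derive_T. Qed.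

(** Integration by parts in the delay equation, verified by differentiating in [T]. The last term is
    the boundary term, which keeps the identity exact at finite [T]. *)
Lemma dickman_laplace_eq s T : 0 < s -> 1 <= T ->
  laplace (fun t => t * rho t) s T =
  (exp s * laplace rho s (T - 1) - laplace rho s T) / s + exp (s * T) * (T * rho T) / s.
Proof.
move=> Hs HT.
have Cm : forall v : R, continuous (fun T => T - 1) v.
  by move=> v; apply: (continuous_minus (V := R_NormedModule)); [exact: continuous_id|exact: continuous_const].
(* The delay equation is available only beyond 1, so the value at [T = 1] is computed separately
   from [rho = 1]. *)
have E1 : laplace (fun t => t * rho t) s 1 = - laplace rho s 1 / s + exp s / s.
  pose F1 T := laplace (fun t => t * rho t) s T + (laplace rho s T - exp (s * T) * T) * / s.
  have D1 : forall v, 0 < v < 1 -> is_derive F1 v 0.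
    move=> v Hv.
    suff : is_derive F1 v (exp (s * v) * (v * rho v) + (exp (s * v) * rho v - (s * exp (s * v) * v + exp (s * v) * 1)) * / s).
      have -> : exp (s * v) * (v * rho v) + (exp (s * v) * rho v - (s * exp (s * v) * v + exp (s * v) * 1)) * / s = 0 => //.
      by rewrite C1; [field; lra|lra].
    apply: (is_derive_plus (V := R_NormedModule)); first by apply: (laplace_derive_T (chi := fun t => t * rho t)).
    apply: (is_derive_ext (fun T => / s * (laplace rho s T - exp (s * T) * T))).
      by move=> t; exact: Rmult_comm.
    rewrite Rmult_comm; apply: is_derive_scal.
    apply: (is_derive_minus (V := R_NormedModule)); first exact: laplace_derive_T.
    by auto_derive => //; ring.
  have CF1 : forall v : R, continuous F1 v.
    move=> v; apply: (continuous_plus (V := R_NormedModule)); first exact: cont_laplace.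
    apply: continuous_mult; last exact: continuous_const.
    apply: (continuous_minus (V := R_NormedModule)); first exact: cont_laplace.
    by apply: continuous_mult; [exact: cont_exp_lin|exact: continuous_id].
  have := const_of_derive0 Rle_0_1 D1 CF1; rewrite /F1 /laplace !RInt_point /zero /= Rmult_0_r !Rmult_1_r.
  by move=> H; rewrite /Rdiv; lra.
pose F T := laplace (fun t => t * rho t) s T -
  ((exp s * laplace rho s (T - 1) - laplace rho s T) + exp (s * T) * (T * rho T)) * / s.
suff H : F T = F 1.
  move: H; rewrite /F Rminus_diag E1 Rmult_1_l (C1 (Rle_refl 1)).
  have -> : laplace rho s 0 = 0 by rewrite /laplace RInt_point.
  rewrite !Rmult_1_r Rmult_0_r /Rdiv; lra.
apply: const_of_derive0 => // v.
  move=> Hv.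
  suff : is_derive F v (exp (s * v) * (v * rho v) -
     / s * (exp s * (1 * (exp (s * (v - 1)) * rho (v - 1))) - exp (s * v) * rho v
       + (s * exp (s * v) * (v * rho v) + exp (s * v) * (1 * rho v + v * (- rho (v - 1) / v))))).
    have E : exp (s * v) = exp s * exp (s * (v - 1)) by rewrite -exp_plus; congr exp; ring.
    set X := exp (s * v) * (v * rho v) - _ * _.
    have -> // : X = 0.
    by rewrite /X E; field; lra.
  apply: (is_derive_minus (V := R_NormedModule)); first by apply: (laplace_derive_T (chi := fun t => t * rho t)).
  apply: (is_derive_ext (fun T => / s * ((exp s * laplace rho s (T - 1) - laplace rho s T) + exp (s * T) * (T * rho T)))).
    by move=> t; exact: Rmult_comm.
  apply: is_derive_scal.
  apply: (is_derive_plus (V := R_NormedModule)).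
    apply: (is_derive_minus (V := R_NormedModule)); last exact: laplace_derive_T.
    apply: is_derive_scal; apply: (is_derive_comp (fun T => laplace rho s T) (fun T => T - 1)).
      exact: laplace_derive_T.
    by auto_derive => //; ring.
  apply: (is_derive_mult (fun T => exp (s * T)) (fun T => T * rho T)); last by move=> *; exact: Rmult_comm.
    by auto_derive => //; ring.
  apply: (is_derive_mult (fun T => T) rho); last by move=> *; exact: Rmult_comm.
    exact: is_derive_id.
  by apply: rhoD; lra.
apply: (continuous_minus (V := R_NormedModule)); first exact: cont_laplace.
apply: continuous_mult; last exact: continuous_const.
apply: (continuous_plus (V := R_NormedModule)); last first.
  by apply: continuous_mult; [exact: cont_exp_lin|exact: Ctr].
apply: (continuous_minus (V := R_NormedModule)); last exact: cont_laplace.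
apply: cont_scal => t; apply: (continuous_comp (fun T => T - 1)) => //.
exact: cont_laplace.
Qed.

(** By [dickman_RInt] the boundary term is the integral of [exp (s T) * rho] over [[T - 1, T]],
    which lies between the last block of the transform and [exp s] times it. These two extremes give
    the two bounds. *)
Lemma dickman_laplace_deriv s T : 0 < s -> 1 <= T ->
  (exp s - 1) / s * laplace rho s (T - 1) <= laplace (fun t => t * rho t) s T
   <= (exp s - 1) / s * laplace rho s T.
Proof.
move=> Hs HT; rewrite dickman_laplace_eq //.
have Hi := Rinv_0_lt_compat _ Hs.
have Hce : forall t : R, continuous (fun t : R => exp (s * t) * rho t) t by move=> t; exact: cont_exp_mul.
have Hsp : laplace rho s T = laplace rho s (T - 1) + RInt (fun t => exp (s * t) * rho t) (T - 1) T.
  by rewrite /laplace (RInt_split 0 (T - 1) T Hce).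
rewrite (dickman_RInt rhoN rhoD HT) -RInt_Rscal //.
set J := RInt (fun t => exp (s * T) * rho t) (T - 1) T.
set I := RInt (fun t => exp (s * t) * rho t) (T - 1) T in Hsp.
have HJI : J <= exp s * I.
  rewrite /J /I -RInt_Rscal //; apply: RInt_le_cont; first by lra.
  - by move=> t; exact: cont_scal.
  - by move=> t; apply: cont_scal => t'; exact: cont_exp_mul.
  move=> t Ht; have := rhoB t => Hb; rewrite -Rmult_assoc -exp_plus; apply: Rmult_le_compat_r; first by lra.
  by apply: exp_le_compat; nra.
have HIJ : I <= J.
  apply: RInt_le_cont => //; first by lra.
    by move=> t; exact: cont_scal.
  move=> t Ht; have := rhoB t => Hb; apply: Rmult_le_compat_r; first by lra.
  by apply: exp_le_compat; nra.
rewrite /Rdiv Hsp; set H1 := laplace rho s (T - 1).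
have -> : (exp s * H1 - (H1 + I)) * / s + J * / s = (exp s * H1 - H1 - I + J) * / s by ring.
have -> : (exp s - 1) * / s * H1 = (exp s * H1 - H1) * / s by ring.
have -> : (exp s - 1) * / s * (H1 + I) = (exp s * H1 - H1 + exp s * I - I) * / s by ring.
by split; apply: Rmult_le_compat_r; lra.
Qed.

(** The argument of [renewal_upper] for the kernel equal to 1 on [[0, 1]] and 0 beyond, whose
    transform is at most [exp s]; the added 1 puts the maximum point where the equation holds. *)
Lemma dickman_decay s u : 0 <= s -> 0 <= u -> rho u <= exp (s * (exp s + 1) - s * u).
Proof.
move=> Hs Hu.
have Hf : forall t : R, continuous (fun t => exp (s * t) * rho t) t by move=> t; exact: cont_exp_mul.
have [m Hm Hmax] := cont_max Hu Hf; rewrite /= in Hmax.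
have Hes := exp_pos s; have Hem := exp_pos (s * m); have Hrm := rhoB m.
suff Hmm : exp (s * m) * rho m <= exp (s * (exp s + 1)).
  have Huu : 0 <= u <= u by lra.
  have := Hmax u Huu => H1.
  have E : exp (s * (exp s + 1) - s * u) * exp (s * u) = exp (s * (exp s + 1)) by rewrite -exp_plus; congr exp; ring.
  have Hp := exp_pos (s * u).
  by apply: (Rmult_le_reg_r (exp (s * u))) => //; lra.
case: (Rle_dec m (exp s + 1)) => HmH.
  have : exp (s * m) <= exp (s * (exp s + 1)) by apply: exp_le_compat; nra.
  nra.
exfalso; have Hm1 : 1 <= m by lra.
have E := dickman_conv rhoN rhoD Hm1.
have : RInt (fun t => rho (m - t)) 0 1 <= (exp s * rho m) * (1 - 0).
  apply: RInt_le_const; [lra|by move=> t; exact: cont_rev|].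
  move=> t Ht; have Hmt : 0 <= m - t <= u by lra.
  have := Hmax (m - t) Hmt => H1.
  have E1 : exp (s * m) = exp (s * (m - t)) * exp (s * t) by rewrite -exp_plus; congr exp; ring.
  have Hp := exp_pos (s * (m - t)).
  have H2 : rho (m - t) <= exp (s * t) * rho m.
    by apply: (Rmult_le_reg_l (exp (s * (m - t)))) => //; rewrite E1 in H1; lra.
  have : exp (s * t) <= exp s by apply: exp_le_compat; nra.
  nra.
nra.
Qed.

Lemma RInt_exp_neg d T : 0 < d -> 0 <= T -> RInt (fun t => exp (- d * t)) 0 T <= / d.
Proof.
move=> Hd HT.
have H := is_RInt_derive (fun t => - / d * exp (- d * t)) (fun t => exp (- d * t)) 0 T.
rewrite (is_RInt_unique _ _ _ _ (H _ _)).
- rewrite /minus /plus /opp /= Rmult_0_r exp_0.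
  have := exp_pos (- d * T); have := Rinv_0_lt_compat _ Hd; nra.
- by move=> t _; auto_derive => //; field; lra.
- by move=> t _; exact: cont_exp_lin.
Qed.

Lemma dickman_laplace_bounded s : 0 <= s -> exists2 C, 0 < C & forall T, 0 <= T -> laplace rho s T <= C.
Proof.
(* Using the decay with [s + 1] leaves the integrable factor [exp (- t)]. *)
move=> Hs; set s' := s + 1; set C := exp (s' * (exp s' + 1)).
exists C; first exact: exp_pos.
move=> T HT.
have HC : 0 < C by exact: exp_pos.
apply: (@Rle_trans _ (C * RInt (fun t => exp (- (1) * t)) 0 T)).
  rewrite -RInt_Rscal; last by move=> t; exact: cont_exp_lin.
  apply: RInt_le_cont => //.
  - by move=> t; exact: cont_exp_mul.
  - by move=> t; apply: cont_scal => t'; exact: cont_exp_lin.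
  move=> t Ht; have Ht0 : 0 <= t by lra.
  have Hs' : 0 <= s' by rewrite /s'; lra.
  have := dickman_decay Hs' Ht0 => H.
  have Hp := exp_pos (s * t).
  apply: Rle_trans (Rmult_le_compat_l _ _ _ (Rlt_le _ _ Hp) H) _.
  by rewrite /C -!exp_plus; apply: exp_le_compat; rewrite /s'; lra.
by have := @RInt_exp_neg 1 T Rlt_0_1 HT; rewrite Rinv_1; nra.
Qed.

Lemma monotone_of_derive (F dF : R -> R) a b : a <= b ->
  (forall v, a <= v <= b -> is_derive F v (dF v)) -> (forall v, a <= v <= b -> 0 <= dF v) -> F a <= F b.
Proof.
move=> Hab HF Hd.
have Hx : forall x, Rmin a b < x < Rmax a b -> is_derive F x (dF x).
  by move=> x; rewrite Rmin_left // Rmax_right // => Hx; apply: HF; lra.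
have Hc : forall x, Rmin a b <= x <= Rmax a b -> continuity_pt F x.
  move=> x; rewrite Rmin_left // Rmax_right // => Hx'; apply: cont_pt.
  by apply: ex_derive_continuous; exists (dF x); exact: HF.
have [c [Hcc E]] := MVT_gen F a b dF Hx Hc.
rewrite Rmin_left // Rmax_right // in Hcc.
have := Hd c Hcc; nra.
Qed.

Lemma laplace_exp_derive A s T : 0 < s -> 0 <= T ->
  is_derive (fun s => laplace rho s T * exp (- (A * (exp s / s)))) s
    ((laplace (fun t => t * rho t) s T - A * (exp s / s * (1 - / s)) * laplace rho s T) * exp (- (A * (exp s / s)))).
Proof.
move=> Hs HT.
suff : is_derive (fun s => laplace rho s T * exp (- (A * (exp s / s)))) s
    (laplace (fun t => t * rho t) s T * exp (- (A * (exp s / s))) +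
     laplace rho s T * (- (A * (exp s / s * (1 - / s))) * exp (- (A * (exp s / s))))).
  set X := _ + _; set Y := _ * exp _.
  by have -> : X = Y by rewrite /X /Y; ring.
apply: (is_derive_mult (fun s => laplace rho s T)); last by move=> *; exact: Rmult_comm.
  exact: laplace_derive_s.
auto_derive; first by lra.
by rewrite /Rdiv; field; lra.
Qed.

(** The logarithmic derivative of the transform is at most [(exp s - 1) / s], while that of
    [exp (A * (exp s / s))], with [A = 1 + eps], is [A * (1 - / s) * (exp s / s)]. From [S] on
    [A * (1 - / s) >= 1], so the quotient does not increase, and [C] bounds it at [S] for all [T] at
    once. *)
Lemma dickman_laplace_upper eps : 0 < eps -> exists2 C, 0 < C & ev (fun s => forall T, 0 <= T ->
  laplace rho s T <= C * exp ((1 + eps) * (exp s / s))).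
Proof.
move=> Heps; pose S := Rmax 1 ((1 + eps) / eps).
have HS1 : 1 <= S by exact: Rmax_l.
have HS2 : (1 + eps) / eps <= S by exact: Rmax_r.
have HS0 : 0 <= S by lra.
have [C HC HCb] := dickman_laplace_bounded HS0.
exists C => //; exists S => s Hs T HT.
have Hmain : forall T, 1 <= T -> laplace rho s T <= C * exp ((1 + eps) * (exp s / s)).
  move=> {HT}T HT; have HT0 : 0 <= T by lra.
  set A := 1 + eps.
  have HA : - (laplace rho S T * exp (- (A * (exp S / S)))) <= - (laplace rho s T * exp (- (A * (exp s / s)))).
    apply: (@monotone_of_derive (fun s => - (laplace rho s T * exp (- (A * (exp s / s)))))
      (fun s => - ((laplace (fun t => t * rho t) s T - A * (exp s / s * (1 - / s)) * laplace rho s T) * exp (- (A * (exp s / s))))) S s Hs).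
      move=> v Hv; apply: (is_derive_opp (V := R_NormedModule)); apply: laplace_exp_derive => //; lra.
    move=> v Hv; have Hv0 : 0 < v by lra.
    have Hiv := Rinv_0_lt_compat _ Hv0.
    have [_ Hd] := dickman_laplace_deriv Hv0 HT.
    have Hh : 0 <= laplace rho v T.
      have := @laplace_mono rho v 0 T Cc rhoB HT0; rewrite {1}/laplace RInt_point /zero /=; lra.
    have Hep := exp_pos v.
    have Hk : 1 <= A * (1 - / v).
      have Hiv2 : / v <= eps / (1 + eps).
        have -> : eps / (1 + eps) = / ((1 + eps) / eps) by field; lra.
        apply: Rinv_le_contravar; [apply: Rdiv_lt_0_compat; lra|lra].
      have : A * / v <= A * (eps / (1 + eps)) by apply: Rmult_le_compat_l => //; rewrite /A; lra.
      have -> : A * (eps / (1 + eps)) = eps by rewrite /A; field; lra.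
      rewrite /A; lra.
    have Hk2 : (exp v - 1) / v <= A * (exp v / v * (1 - / v)).
      have -> : A * (exp v / v * (1 - / v)) = (A * (1 - / v)) * (exp v / v) by ring.
      have Hev : 0 < exp v / v by apply: Rdiv_lt_0_compat.
      have : (exp v - 1) / v <= exp v / v by apply: Rmult_le_compat_r; lra.
      nra.
    have Hx := exp_pos (- (A * (exp v / v))).
    have : laplace (fun t => t * rho t) v T - A * (exp v / v * (1 - / v)) * laplace rho v T <= 0.
      have := Rmult_le_compat_r _ _ _ Hh Hk2; lra.
    nra.
  have HB := HCb T HT0.
  have Hx := exp_pos (A * (exp s / s)).
  have Hle1 : exp (- (A * (exp S / S))) <= 1.
    rewrite -exp_0; apply: exp_le_compat.
    have : 0 < exp S / S by apply: Rdiv_lt_0_compat; [exact: exp_pos|lra].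
    rewrite /A; nra.
  have Hpp := exp_pos (- (A * (exp S / S))).
  have Hfin : laplace rho s T * exp (- (A * (exp s / s))) <= C.
    have : laplace rho S T * exp (- (A * (exp S / S))) <= C * exp (- (A * (exp S / S))) by apply: Rmult_le_compat_r; lra.
    nra.
  have := Rmult_le_compat_r _ _ _ (Rlt_le _ _ Hx) Hfin.
  rewrite Rmult_assoc -exp_plus Rplus_opp_l exp_0; lra.
case: (Rle_dec 1 T) => HT1; first exact: Hmain.
apply: Rle_trans (Hmain 1 (Rle_refl 1)).
by apply: laplace_mono => //; lra.
Qed.

(** The derivative is bounded below through the transform up to [T - 1]. With [eta = eps / 2], the
    last block is at most [eta] and the transform at least 1, so the shift costs a factor [1 - eta];
    replacing [exp v - 1] by [exp v] costs another, and [(1 - eta)^2 >= 1 - eps]. *)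
Lemma dickman_laplace_lower eps : 0 < eps < 1 -> exists2 C, 0 < C & ev (fun s =>
  C * exp ((1 - eps) * (exp s / s)) <= laplace rho s (exp (2 * s))).
Proof.
move=> Heps; set eta := eps / 2; have Heta : 0 < eta < 1 by rewrite /eta; lra.
set A := 1 - eps; pose S := Rmax 1 (/ eta).
have HS1 : 1 <= S by exact: Rmax_l.
have HS2 : / eta <= S by exact: Rmax_r.
exists (exp (- (A * (exp S / S)))); first exact: exp_pos.
have Hev1 : ev (fun s => 1 + s <= / 8 * exp s).
  have H8 : 0 < / 8 by lra.
  have He : forall c, ev (fun s => c <= exp s).
    by move=> c; apply: ev_imp (ev_ge c) => s Hs; have := exp_ineq1_le s; lra.
  have := ev_comp He (@ev_poly_ln 1 1 1 _ Rle_0_1 Rlt_0_1 H8).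
  by apply: ev_imp => s; rewrite ln_exp /= !Rmult_1_r Rmult_1_l Rpower_1 //; exact: exp_pos.
apply: ev_imp (ev_and (ev_and (ev_ge S) (ev_ge (1 - ln eta))) Hev1) => s [[HsS Hse] Hs8].
(* [T] stays fixed while the variable runs over [[S, s]]. Being the square of [exp s], it dominates
   [(s + 1) * (exp (s + 1) + 1)], the exponent in [dickman_decay], which makes the last block
   small. *)
set T := exp (2 * s).
have Hs1 : 1 <= s by lra.
have HE : 1 + s <= exp s by exact: exp_ineq1_le.
have ET : T = exp s * exp s by rewrite /T -exp_plus; congr exp; ring.
have HT1 : 1 <= T by rewrite ET; nra.
have HT0 : 0 <= T by lra.
have Htail : forall v, S <= v <= s -> RInt (fun t => exp (v * t) * rho t) (T - 1) T <= eta.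
  move=> v Hv; set s' := s + 1.
  have Hs' : 0 <= s' by rewrite /s'; lra.
  have : RInt (fun t => exp (v * t) * rho t) (T - 1) T <= exp (s' * (exp s' + 1) - (T - 1)) * (T - (T - 1)).
    apply: RInt_le_const; [lra|by move=> t; exact: cont_exp_mul|].
    move=> t Ht; have Ht0 : 0 <= t by lra.
    have Hp := exp_pos (v * t).
    apply: Rle_trans (Rmult_le_compat_l _ _ _ (Rlt_le _ _ Hp) (dickman_decay Hs' Ht0)) _.
    rewrite -exp_plus; apply: exp_le_compat; rewrite /s'; nra.
  have -> : T - (T - 1) = 1 by ring.
  rewrite Rmult_1_r => H; apply: Rle_trans H _.
  rewrite -[X in _ <= X](exp_ln eta); last by lra.
  apply: exp_le_compat.
  have He1 : exp s' <= 3 * exp s by rewrite /s' exp_plus; have := exp_le_3; have := exp_pos s; nra.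
  have H4 : s' * (exp s' + 1) <= (1 + s) * (4 * exp s) by rewrite /s' in He1 *; nra.
  rewrite ET; nra.
have HA : laplace rho S T * exp (- (A * (exp S / S))) <= laplace rho s T * exp (- (A * (exp s / s))).
  apply: (@monotone_of_derive (fun s => laplace rho s T * exp (- (A * (exp s / s))))
    (fun s => (laplace (fun t => t * rho t) s T - A * (exp s / s * (1 - / s)) * laplace rho s T) * exp (- (A * (exp s / s)))) S s HsS).
    by move=> v Hv; apply: laplace_exp_derive => //; lra.
  move=> v Hv; have Hv0 : 0 < v by lra.
  have Hiv := Rinv_0_lt_compat _ Hv0.
  have [Hd _] := dickman_laplace_deriv Hv0 HT1.
  have Hce : forall t : R, continuous (fun t : R => exp (v * t) * rho t) t by move=> t; exact: cont_exp_mul.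
  have Hsp : laplace rho v T = laplace rho v (T - 1) + RInt (fun t => exp (v * t) * rho t) (T - 1) T.
    by rewrite /laplace (RInt_split 0 (T - 1) T Hce).
  have Ht := Htail v Hv.
  have Hh1 : 1 <= laplace rho v T.
    apply: Rle_trans (@laplace_mono rho v 1 T Cc rhoB HT1).
    have : 1 * (1 - 0) <= laplace rho v 1.
      apply: RInt_ge_const => // [|t Htt]; first by lra.
      rewrite C1; last by lra.
      by rewrite Rmult_1_r -{1}exp_0; apply: exp_le_compat; nra.
    lra.
  set h := laplace rho v T in Hsp Hh1 *; set h1 := laplace rho v (T - 1) in Hd Hsp.
  have Hh2 : (1 - eta) * h <= h1 by nra.
  have Hev : 0 < exp v / v by apply: Rdiv_lt_0_compat => //; exact: exp_pos.
  have Hav : (1 - eta) * (exp v / v) <= (exp v - 1) / v.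
    have -> : (1 - eta) * (exp v / v) = ((1 - eta) * exp v) / v by field; lra.
    apply: Rmult_le_compat_r; first by lra.
    have H1 : eta * / eta <= eta * exp v.
      by apply: Rmult_le_compat_l; [lra|have := exp_ineq1_le v; lra].
    rewrite Rinv_r in H1; lra.
  have Hprod : (1 - eta) * (exp v / v) * ((1 - eta) * h) <= (exp v - 1) / v * h1.
    by apply: Rmult_le_compat => //; nra.
  have HAe : A <= (1 - eta) * (1 - eta) by rewrite /A /eta; nra.
  have HA0 : 0 < A by rewrite /A; lra.
  have Hfin : A * (exp v / v * (1 - / v)) * h <= laplace (fun t => t * rho t) v T.
    apply: Rle_trans Hd; apply: Rle_trans Hprod.
    have -> : (1 - eta) * (exp v / v) * ((1 - eta) * h) = ((1 - eta) * (1 - eta)) * (exp v / v * h) by ring.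
    have -> : A * (exp v / v * (1 - / v)) * h = A * (1 - / v) * (exp v / v * h) by ring.
    apply: Rmult_le_compat_r; first by nra.
    nra.
  apply: Rmult_le_pos; [lra|exact/Rlt_le/exp_pos].
have HS : 1 <= laplace rho S T.
  apply: Rle_trans (@laplace_mono rho S 1 T Cc rhoB HT1).
  have : 1 * (1 - 0) <= laplace rho S 1.
    apply: RInt_ge_const => // [|t|t Htt]; first by lra.
      exact: cont_exp_mul.
    rewrite C1; last by lra.
    by rewrite Rmult_1_r -{1}exp_0; apply: exp_le_compat; nra.
  lra.
have Hp := exp_pos (- (A * (exp S / S))).
have H1 : exp (- (A * (exp S / S))) <= laplace rho s T * exp (- (A * (exp s / s))) by nra.
have Hx := exp_pos (A * (exp s / s)).
have := Rmult_le_compat_r _ _ _ (Rlt_le _ _ Hx) H1.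
have E : exp (- (A * (exp s / s))) * exp (A * (exp s / s)) = 1 by rewrite -exp_plus Rplus_opp_l exp_0.
by rewrite (Rmult_assoc (laplace rho s T)) E Rmult_1_r.
Qed.

End DickmanLaplace.

(** * Rate of decay *)

Lemma ev_logk k c : ev (fun u => c <= logk k u).
Proof.
elim: k c => [|k IH] c; first exact: ev_ge.
exact: (ev_comp IH (ev_ln c)).
Qed.

Lemma logk_ln k u : logk k (ln u) = logk k.+1 u.
Proof. by rewrite /logk iterSr. Qed.

(** For large [u], the logarithm of [logk k u * logk k.+1 u]; the claimed decay says that
    [- ln (sigma k u) / u] is [gk k u + o(1)]. *)
Definition gk (k : nat) (u : R) : R := logk k.+1 u + logk k.+2 u.

Lemma gk_ln k u : gk k (ln u) = gk k.+1 u.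
Proof. by rewrite /gk !logk_ln. Qed.

Lemma ev_gk k c : ev (fun u => c <= gk k u).
Proof.
apply: ev_imp (ev_and (ev_logk k.+1 c) (ev_logk k.+2 0)) => u [H1 H2].
by rewrite /gk; lra.
Qed.

Lemma logk_mono k : ev (fun u => forall v, u <= v -> logk k u <= logk k v).
Proof.
elim: k => [|k IH]; first by exists 0.
apply: ev_imp (ev_and IH (ev_logk k 1)) => u [H1 H2] v Huv.
by have := H1 v Huv => H; rewrite /logk !iterS -/(logk k u) -/(logk k v); apply: ln_le; lra.
Qed.

Lemma gk_mono k : ev (fun u => forall v, u <= v -> gk k u <= gk k v).
Proof.
apply: ev_imp (ev_and (logk_mono k.+1) (logk_mono k.+2)) => u [H1 H2] v Huv.
by rewrite /gk; have := H1 v Huv; have := H2 v Huv; lra.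
Qed.

Lemma ln_lip a b : 1 <= a -> 1 <= b -> Rabs (ln a - ln b) <= Rabs (a - b).
Proof.
have H : forall a b, 1 <= a -> 1 <= b -> b <= a -> Rabs (ln a - ln b) <= Rabs (a - b).
  move=> {}a {}b Ha Hb Hab; have Hl : ln b <= ln a by apply: ln_le; lra.
  rewrite !Rabs_pos_eq; try lra.
  have Hq : 0 < a / b by apply: Rdiv_lt_0_compat; lra.
  have := ln_le_sub1 Hq; rewrite ln_div; try lra.
  have : a / b - 1 <= a - b.
    have -> : a / b - 1 = (a - b) * / b by field; lra.
    have : / b <= 1 by rewrite -Rinv_1; apply: Rinv_le_contravar; lra.
    nra.
  lra.
move=> Ha Hb; case: (Rle_dec b a) => Hab; first exact: H.
by rewrite Rabs_minus_sym (Rabs_minus_sym a); apply: H => //; lra.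
Qed.

Lemma ev_scal c M : 0 < c -> ev (fun w => M <= c * w).
Proof.
move=> Hc; apply: ev_imp (ev_ge (M / c)) => w Hw.
by have := Rmult_le_compat_l c _ _ (Rlt_le _ _ Hc) Hw; have -> : c * (M / c) = M by [field; lra]; lra.
Qed.

Lemma logk_lip k c : 0 < c -> ev (fun w => Rabs (logk k.+1 (c * w) - logk k.+1 w) <= Rabs (ln c)).
Proof.
move=> Hc; elim: k => [|k IH].
  apply: ev_imp (ev_ge 1) => w Hw; rewrite /logk /= ln_mult; try lra.
  by have -> : ln c + ln w - ln w = ln c by [ring]; lra.
have Hs : forall M, ev (fun w => M <= c * w) by move=> M; exact: ev_scal.
apply: ev_imp (ev_and IH (ev_and (ev_logk k.+1 1) (ev_comp Hs (ev_logk k.+1 1)))) => w [H1 [H2 H3]].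
apply: Rle_trans H1; rewrite /logk (iterS k.+1) (iterS k.+1) -/(logk k.+1 w) -/(logk k.+1 (c * w)).
exact: ln_lip.
Qed.

(** A power becomes a dilation after one logarithm and a bounded shift after two. Hence knowing the
    relevant [t] only up to an exponent [1 + o(1)] is enough. *)
Lemma gk_pow k c : 0 < c -> ev (fun v => Rabs (gk k.+1 (Rpower v c) - gk k.+1 v) <= 2 * Rabs (ln c)).
Proof.
move=> Hc; have H := ev_comp ev_ln (ev_and (logk_lip k Hc) (logk_lip k.+1 Hc)).
apply: ev_imp H => v [H1 H2]; rewrite /gk -!(logk_ln k.+1) -!(logk_ln k.+2) ln_Rpower.
move/Rabs_le_between: H1 => H1; move/Rabs_le_between: H2 => H2; apply/Rabs_le; lra.
Qed.

Lemma logk_le_ln j : ev (fun v => logk j.+1 v <= ln v).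
Proof.
elim: j => [|j IH]; first by exists 0 => v _; exact: Rle_refl.
apply: ev_imp (ev_and IH (ev_logk j.+1 1)) => v [H1 H2].
rewrite /logk (iterS j.+1) -/(logk j.+1 v).
by have := @ln_le_sub1 (logk j.+1 v); lra.
Qed.

Definition decay_rate (k : nat) (sigma : R -> R) : Prop := forall d, 0 < d ->
  ev (fun u => exp (- (u * (gk k u + d))) <= sigma u <= exp (- (u * (gk k u - d)))).

Lemma ev_poly_exp m c C d : 0 <= c < 1 -> 0 < C -> 0 < d ->
  ev (fun u => C * (1 + ln u) ^ m * exp (c * ln u) <= d * u).
Proof.
move=> Hc HC Hd.
have He : 0 < 1 - c by lra.
have HdC : 0 < d / C by exact: Rdiv_lt_0_compat.
apply: ev_imp (ev_and (@ev_poly_ln m 1 (1 - c) _ Rle_0_1 He HdC) (ev_ge 1)) => u [H H1].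
rewrite Rmult_1_l in H.
have Hp := exp_pos (c * ln u).
have E : Rpower u (1 - c) * exp (c * ln u) = u.
  rewrite /Rpower -exp_plus; have -> : (1 - c) * ln u + c * ln u = ln u by ring.
  by rewrite exp_ln //; lra.
have : C * (1 + ln u) ^ m <= C * (d / C * Rpower u (1 - c)) by apply: Rmult_le_compat_l; lra.
have -> : C * (d / C * Rpower u (1 - c)) = d * Rpower u (1 - c) by field; lra.
move/(Rmult_le_compat_r _ _ _ (Rlt_le _ _ Hp)).
by rewrite (Rmult_assoc d) E.
Qed.

(** * Decay rate of [sigma] from that of its kernel *)

Section Step.

Variables (chi sigma : R -> R).
Hypothesis chiN : normalized chi.
Hypothesis sigmaN : normalized sigma.
Hypothesis chiB : forall t, 0 < chi t <= 1.
Hypothesis sigmaB : forall t, 0 < sigma t <= 1.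
Hypothesis Hren : renewal chi sigma.

Let Cc : forall t : R, continuous chi t. Proof. by case: chiN. Qed.

(** With [v = ln u] and [T1 = v^c], [c] slightly below 1, the part of the transform up to [T1] is at
    most [v * u^(1/2)] and the rest at most [1 / d]. So the transform is [o(u / s)] and
    [renewal_upper] loses only [d * u]. *)
Lemma decay_step_upper k d : 0 < d -> decay_rate k.+1 chi ->
  ev (fun u => sigma u <= exp (- (u * (gk k.+2 u - 5 * d)))).
Proof.
move=> Hd Hrate; set c := exp (- d).
have Hc : 0 < c by exact: exp_pos.
have Hc1 : c < 1 by rewrite -exp_0; apply: exp_increasing; lra.
have Hlc : ln c = - d by rewrite /c ln_exp.
have Hpow : forall M, ev (fun v => M <= Rpower v c) by move=> M; exact: ev_Rpower.
have [t0 Ht0] := Hrate d Hd.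
have H1c : 0 < 1 - c by lra.
have H4 : 0 < / 4 by lra.
have Ev : ev (fun v => [/\ t0 <= Rpower v c, (forall t, Rpower v c <= t -> gk k.+1 (Rpower v c) <= gk k.+1 t),
    Rabs (gk k.+1 (Rpower v c) - gk k.+1 v) <= 2 * Rabs (ln c) & 4 * d <= gk k.+1 v] /\
    [/\ logk k.+2 v <= ln v, logk k.+3 v <= ln v, 1 + ln v <= / 4 * Rpower v (1 - c) & 1 <= v]).
  have A1 := ev_and (ev_comp Hpow (ev_ge t0)) (ev_comp Hpow (gk_mono k.+1)).
  have A2 := ev_and (gk_pow k Hc) (ev_gk k.+1 (4 * d)).
  have A3 := ev_and (logk_le_ln k.+1) (logk_le_ln k.+2).
  have A4 := ev_and (@ev_poly_ln 1 1 (1 - c) _ Rle_0_1 H1c H4) (ev_ge 1).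
  apply: ev_imp (ev_and (ev_and A1 A2) (ev_and A3 A4)) => v [[[B1 B2] [B3 B4]] [[B5 B6] [B7 B8]]].
  by move: B7; rewrite /= Rmult_1_r Rmult_1_l => B7; split; split.
have Hid := Rinv_0_lt_compat _ Hd.
have HC : 0 < 2 * (/ d + 2) by lra.
have H12 : 0 <= / 2 < 1 by lra.
have := ev_and (ev_comp ev_ln Ev) (ev_and (ev_poly_exp 2 H12 HC Hd) (ev_ge 1)).
apply: ev_imp => u [[[B1 B2 B3 B4] [B5 B6 B7 B8]] [Hp Hu1]].
rewrite -gk_ln; set v := ln u in B1 B2 B3 B4 B5 B6 B7 B8 Hp *.
set g := gk k.+1 v in B3 B4 *; set T1 := Rpower v c in B1 B2 B3.
have HT1 : 1 <= T1 by apply: Rpower_ge1; lra.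
have HT1v : T1 <= v by have := @Rle_Rpower v c 1; rewrite Rpower_1 -/T1; lra.
(* Moving from [v] to [v^c] costs [2 d], the rate of [chi] costs [d], and the last [d] leaves the
   integrable [exp (- d t)] beyond [T1]. *)
set s := g - 4 * d.
have Hs : 0 <= s by rewrite /s; lra.
have Hg2 : g <= 2 * ln v by rewrite /g /gk; lra.
have Hlv : 0 <= ln v by exact: ln_ge0.
have Hlvv : ln v <= v by have := @ln_le_sub1 v; lra.
rewrite Hlc Rabs_Ropp (Rabs_pos_eq d) in B3; last by lra.
move/Rabs_le_between: B3 => B3.
pose H := T1 * exp (s * T1) + / d + 1.
(* [T1] is [v] divided by [v^(1-c)], a power that beats [s <= 2 ln v]. *)
have HsT : s * T1 <= / 2 * v.
  have E : T1 * Rpower v (1 - c) = v.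
    rewrite /T1 -Rpower_plus; have -> : c + (1 - c) = 1 by ring.
    by rewrite Rpower_1 //; lra.
  have : 2 * ln v * T1 <= / 2 * v by rewrite -{2}E; nra.
  rewrite /s; nra.
have HH : forall T, 0 <= T -> laplace chi s T < H.
  have H1 : laplace chi s T1 <= T1 * exp (s * T1).
    have : laplace chi s T1 <= exp (s * T1) * (T1 - 0).
      apply: RInt_le_const; [lra|by move=> t; exact: cont_exp_mul|].
      move=> t Ht; have := chiB t; have : exp (s * t) <= exp (s * T1) by apply: exp_le_compat; nra.
      have := exp_pos (s * t); nra.
    lra.
  move=> T HT; case: (Rle_dec T T1) => HTT.
    by have := laplace_mono s Cc chiB HTT; rewrite /H; lra.
  have Hce : forall t : R, continuous (fun t : R => exp (s * t) * chi t) t by move=> t; exact: cont_exp_mul.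
  have Hed : forall t : R, continuous (fun t : R => exp (- d * t)) t by move=> t; exact: cont_exp_lin.
  have E1 : laplace chi s T = laplace chi s T1 + RInt (fun t => exp (s * t) * chi t) T1 T.
    by rewrite /laplace (RInt_split 0 T1 T Hce).
  have H2 : RInt (fun t => exp (s * t) * chi t) T1 T <= RInt (fun t => exp (- d * t)) T1 T.
    apply: RInt_le_cont => //; first by lra.
    move=> t Ht; have Htt : t0 <= t by lra.
    have HT1t : T1 <= t by lra.
    have [_ Hr] := Ht0 t Htt; have Hgt := B2 t HT1t.
    have Hpt := exp_pos (s * t).
    apply: Rle_trans (Rmult_le_compat_l _ _ _ (Rlt_le _ _ Hpt) Hr) _.
    rewrite -exp_plus; apply: exp_le_compat; rewrite /s; nra.
  have H3 := RInt_exp_neg Hd HT; rewrite (RInt_split 0 T1 T Hed) in H3.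
  have H5 : 0 * (T1 - 0) <= RInt (fun t => exp (- d * t)) 0 T1.
    by apply: RInt_ge_const => //; [lra|move=> t _; exact/Rlt_le/exp_pos].
  rewrite E1 /H; lra.
have Hu0 : 0 <= u by lra.
have := renewal_upper chiN sigmaN chiB sigmaB Hren Hs Hu0 HH => Hup.
apply: Rle_trans Hup _; apply: exp_le_compat.
suff : s * H <= d * u by rewrite /s; nra.
apply: Rle_trans Hp.
have Hx := exp_pos (/ 2 * v).
have Hex : exp (s * T1) <= exp (/ 2 * v) by exact: exp_le_compat.
have Hx1 : 1 <= exp (/ 2 * v) by rewrite -exp_0; apply: exp_le_compat; lra.
have HHle : H <= (v + / d + 1) * exp (/ 2 * v).
  have : T1 * exp (s * T1) <= v * exp (/ 2 * v).
    by apply: Rmult_le_compat; [lra|exact/Rlt_le/exp_pos|lra|lra].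
  rewrite /H; nra.
have Hs2 : s <= 2 * v by rewrite /s; lra.
have HH0 : 0 <= H by have := exp_pos (s * T1); rewrite /H; nra.
apply: (@Rle_trans _ (2 * v * ((v + / d + 1) * exp (/ 2 * v)))).
  by apply: Rmult_le_compat.
rewrite -Rmult_assoc; apply: Rmult_le_compat_r; first by lra.
rewrite /=; nra.
Qed.

(** Now [c] is slightly above 1 and [s = g + 4 d], so on [[T - 1, T]] with [T = v^c] the integrand
    is at least [exp (d t)]. As [d * (T - 1) > v = ln u], this unit interval alone pushes the
    transform past [u], and [6 T^2] is only a power of [ln u]. *)
Lemma decay_step_lower k d : 0 < d -> decay_rate k.+1 chi ->
  ev (fun u => exp (- (u * (gk k.+2 u + 5 * d))) <= sigma u).
Proof.
move=> Hd Hrate; set c := exp d.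
have Hc : 0 < c by exact: exp_pos.
have Hc1 : 1 < c by rewrite -exp_0; apply: exp_increasing; lra.
have Hlc : ln c = d by rewrite /c ln_exp.
have Hpow : forall M, ev (fun v => M <= Rpower v c) by move=> M; exact: ev_Rpower.
have [t0 Ht0] := Hrate d Hd; have [t1 Ht1] := gk_mono k.+1.
have H1c : 0 < c - 1 by lra.
have Ev : ev (fun v => [/\ t0 + 1 <= Rpower v c, t1 + 1 <= Rpower v c,
    Rabs (gk k.+1 (Rpower v c) - gk k.+1 v) <= 2 * Rabs (ln c) & 0 <= gk k.+1 v] /\
    [/\ 2 / d <= Rpower v (c - 1), 2 <= Rpower v c & d + 1 <= v]).
  have A1 := ev_and (Hpow (t0 + 1)) (Hpow (t1 + 1)).
  have A2 := ev_and (gk_pow k Hc) (ev_gk k.+1 0).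
  have A3 := ev_and (ev_Rpower (2 / d) H1c) (ev_and (Hpow 2) (ev_ge (d + 1))).
  by apply: ev_imp (ev_and (ev_and A1 A2) A3) => v [[[B1 B2] [B3 B4]] [B5 [B6 B7]]].
have [m Hm0 Hm] := ex_nat_ge (2 * c).
have H01 : 0 <= 0 < 1 by lra.
have H60 : 0 < 6 by lra.
have := ev_and (ev_comp ev_ln Ev) (ev_and (ev_poly_exp m H01 H60 Hd) (ev_ge 1)).
apply: ev_imp => u [[[B1 B2 B3 B4] [B5 B6 B7]] [Hp Hu1]].
rewrite -gk_ln; set v := ln u in B1 B2 B3 B4 B5 B6 B7 Hp *.
set g := gk k.+1 v in B3 B4 *; set T := Rpower v c in B1 B2 B3 B6.
rewrite Hlc (Rabs_pos_eq d) in B3; last by lra.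
move/Rabs_le_between: B3 => B3.
set s := g + 4 * d.
have Hs : 0 <= s by rewrite /s; lra.
have Hu0 : 0 <= u by lra.
have HT1 : 1 <= T by lra.
have HdT : v < d * (T - 1).
  have E : T = v * Rpower v (c - 1).
    have E1 : Rpower v 1 * Rpower v (c - 1) = T.
      by rewrite -Rpower_plus /T; have -> : 1 + (c - 1) = c by ring.
    by rewrite Rpower_1 in E1; lra.
  have : v * (2 / d) <= T by rewrite E; apply: Rmult_le_compat_l; lra.
  move/(Rmult_le_compat_l d _ _ (Rlt_le _ _ Hd)).
  have -> : d * (v * (2 / d)) = 2 * v by field; lra.
  lra.
have HL : u < laplace chi s T.
  have Hce : forall t : R, continuous (fun t : R => exp (s * t) * chi t) t by move=> t; exact: cont_exp_mul.
  have E1 : laplace chi s T = laplace chi s (T - 1) + RInt (fun t => exp (s * t) * chi t) (T - 1) T.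
    by rewrite /laplace (RInt_split 0 (T - 1) T Hce).
  have P0 : 0 <= laplace chi s (T - 1).
    have HT0 : 0 <= T - 1 by lra.
    by have := laplace_mono s Cc chiB HT0; rewrite {1}/laplace RInt_point /zero /=; lra.
  have P1 : exp (d * (T - 1)) * (T - (T - 1)) <= RInt (fun t => exp (s * t) * chi t) (T - 1) T.
    apply: RInt_ge_const => //; first by lra.
    move=> t Ht; have Htt : t0 <= t by lra.
    have Htt1 : t1 <= t by lra.
    have HtT : t <= T by lra.
    have [Hr _] := Ht0 t Htt; have Hgt := Ht1 t Htt1 T HtT.
    have Hpt := exp_pos (s * t).
    apply: Rle_trans (Rmult_le_compat_l _ _ _ (Rlt_le _ _ Hpt) Hr).
    rewrite -exp_plus; apply: exp_le_compat; rewrite /s; nra.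
  have : exp v < exp (d * (T - 1)) by exact: exp_increasing.
  rewrite /v exp_ln; last by lra.
  lra.
have Hlow := renewal_lower_full chiN sigmaN chiB sigmaB Hren Hs HT1 Hu0 HL.
apply: Rle_trans Hlow; apply: exp_le_compat.
suff : 6 * T ^ 2 <= d * u by rewrite /s; lra.
apply: Rle_trans Hp.
rewrite Rmult_0_l exp_0 Rmult_1_r; apply: Rmult_le_compat_l; first by lra.
have -> : T ^ 2 = Rpower v (c * 2) by rewrite -Rpower_pow; [rewrite /T Rpower_mult|lra].
have Hv1 : 1 <= v by lra.
apply: (@Rle_trans _ (Rpower v (INR m))); first by apply: Rle_Rpower => //; lra.
rewrite Rpower_pow; last by lra.
by apply: pow_incr; lra.
Qed.

Lemma decay_step k : decay_rate k.+1 chi -> decay_rate k.+2 sigma.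
Proof.
move=> Hrate d Hd; have Hd5 : 0 < d / 5 by lra.
apply: ev_imp (ev_and (decay_step_lower Hd5 Hrate) (decay_step_upper Hd5 Hrate)) => u.
by have -> : 5 * (d / 5) = d by field.
Qed.

Hypothesis chiD : forall u, 1 < u -> is_derive chi u (- chi (u - 1) / u).

(** With [l = ln v] and [s = l + ln l - 2 d], [exp s = exp (- 2 d) * v * l] and [s >= l], so
    [exp s / s <= exp (- 2 d) * v]. Taking [1 + eps = exp d] bounds the transform by [C * u^c] with
    [c = exp (- d) < 1]. *)
Lemma decay_base_upper d : 0 < d -> ev (fun u => sigma u <= exp (- (u * (gk 1 u - 3 * d)))).
Proof.
move=> Hd; set c := exp (- d).
have Hc : 0 < c by exact: exp_pos.
have Hc1 : c < 1 by rewrite -exp_0; apply: exp_increasing; lra.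
have Heps : 0 < exp d - 1 by have := exp_ineq1 d; lra.
have [C HC [S HS]] := dickman_laplace_upper chiN chiD Heps.
have Hcc : 0 <= c < 1 by lra.
have HC2 : 0 < 2 * (C + 1) by lra.
have := ev_and (ev_and (ev_gk 1 (S + 2 * d)) (ev_and (ev_logk 2 1) (ev_logk 3 (2 * d))))
  (ev_and (ev_and (ev_logk 1 1) (ev_ge 1)) (ev_poly_exp 1 Hcc HC2 Hd)).
apply: ev_imp => u [[B1 [B2 B3]] [[B4 B5] Hp]].
move: B1 B2 B3 B4; rewrite /gk /logk !iterS /= => B1 B2 B3 B4.
set v := ln u in B1 B2 B3 B4 Hp *; set l := ln v in B1 B2 B3 *; set l2 := ln l in B1 B3 *.
set s := l + l2 - 2 * d.
have HsS : S <= s by rewrite /s; lra.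
have Hl2 : l2 <= l by have := @ln_le_sub1 l; rewrite -/l2; lra.
have Hlv : l <= v by have := @ln_le_sub1 v; rewrite -/l; lra.
have Hs1 : l <= s by rewrite /s; lra.
have Hs0 : 0 <= s by lra.
have Ees : exp s = exp (- (2 * d)) * (v * l).
  rewrite /s; have -> : l + l2 - 2 * d = - (2 * d) + (l + l2) by ring.
  have E1 : exp l = v by rewrite /l exp_ln; lra.
  have E2 : exp l2 = l by rewrite /l2 exp_ln; lra.
  by rewrite !exp_plus E1 E2.
have Hes : exp s / s <= exp (- (2 * d)) * v.
  apply/Rle_div_l; first by lra.
  have := exp_pos (- (2 * d)) => Hx; rewrite Ees.
  have : v * l <= v * s by apply: Rmult_le_compat_l; lra.
  by move=> H; rewrite Rmult_assoc; apply: Rmult_le_compat_l; lra.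
pose H := C * exp (c * v) + 1.
have HH : forall T, 0 <= T -> laplace chi s T < H.
  move=> T HT; have := HS s HsS T HT.
  have -> : 1 + (exp d - 1) = exp d by ring.
  move=> H1; apply: Rle_lt_trans H1 _.
  suff : exp (exp d * (exp s / s)) <= exp (c * v) by rewrite /H; nra.
  apply: exp_le_compat.
  have -> : c * v = exp d * (exp (- (2 * d)) * v).
    by rewrite -Rmult_assoc -exp_plus /c; congr (exp _ * _); ring.
  by apply: Rmult_le_compat_l => //; exact/Rlt_le/exp_pos.
have Hu0 : 0 <= u by lra.
have Hup := renewal_upper chiN sigmaN chiB sigmaB Hren Hs0 Hu0 HH.
apply: Rle_trans Hup _; apply: exp_le_compat.
suff : s * H <= d * u by rewrite /s; lra.
apply: Rle_trans Hp; rewrite pow_1.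
have Hx1 : 1 <= exp (c * v) by rewrite -exp_0; apply: exp_le_compat; nra.
have HHle : H <= (C + 1) * exp (c * v) by rewrite /H; nra.
have Hs2 : s <= 2 * (1 + v) by rewrite /s; lra.
have HH0 : 0 <= H by rewrite /H; nra.
apply: (@Rle_trans _ (2 * (1 + v) * ((C + 1) * exp (c * v)))); first by apply: Rmult_le_compat.
by right; ring.
Qed.

(** Now [s = l + ln l + 2 d], and eventually [s <= exp (d / 2) * l]. With [1 - eps = exp (- d / 2)]
    the exponent in the lower bound of the transform is at least [exp d * v], so the transform
    exceeds [u]; the truncation point [exp (2 s)] is a constant times [(v * l)^2]. *)
Lemma decay_base_lower d : 0 < d -> ev (fun u => exp (- (u * (gk 1 u + 3 * d))) <= sigma u).
Proof.
move=> Hd.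
have He1 : exp (- (d / 2)) < 1 by rewrite -exp_0; apply: exp_increasing; lra.
have He0 := exp_pos (- (d / 2)).
have Heps : 0 < 1 - exp (- (d / 2)) < 1 by lra.
have [C HC [S HS]] := dickman_laplace_lower chiN chiD Heps.
pose q := exp (d / 2) - 1.
have Hq : 0 < q by have := exp_ineq1 (d / 2); rewrite /q; lra.
have Hq2 : 0 < q / 2 by lra.
pose q2 := exp d - 1.
have Hqq : 0 < q2 by have := exp_ineq1 d; rewrite /q2; lra.
have H01 : 0 <= 0 < 1 by lra.
have H6 : 0 < 6 * exp (8 * d) by have := exp_pos (8 * d); lra.
have Hlog : ev (fun u => ln (logk 2 u) <= q / 2 * logk 2 u).
  have := ev_comp (ev_logk 2) (ev_and (@ev_poly_ln 1 1 1 _ Rle_0_1 Rlt_0_1 Hq2) (ev_ge 1)).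
  apply: ev_imp => u [H1 H2]; have H0 : 0 < logk 2 u by lra.
  by rewrite pow_1 Rmult_1_l Rpower_1 // in H1; lra.
have := ev_and (ev_and (ev_gk 1 S) (ev_and (ev_logk 2 (Rmax 1 (4 * d / q))) (ev_logk 3 0)))
  (ev_and (ev_and (ev_logk 1 (Rmax 1 ((1 - ln C) / q2))) (ev_and (ev_ge 1) Hlog)) (ev_poly_exp 8 H01 H6 Hd)).
apply: ev_imp => u [[B1 [B2 B3]] [[B4 [B5 B6]] Hp]].
move: B1 B2 B3 B4 B6; rewrite /gk /logk !iterS /= => B1 B2 B3 B4 B6.
set v := ln u in B1 B2 B3 B4 B6 Hp *; set l := ln v in B1 B2 B3 B6 *; set l2 := ln l in B1 B3 B6 *.
have Hl1 : 1 <= l by have := Rmax_l 1 (4 * d / q); lra.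
have Hlq : 4 * d <= q * l.
  have : 4 * d / q <= l by have := Rmax_r 1 (4 * d / q); lra.
  move/(Rmult_le_compat_l q _ _ (Rlt_le _ _ Hq)).
  by have -> : q * (4 * d / q) = 4 * d by [field; lra].
have Hv1 : 1 <= v by have := Rmax_l 1 ((1 - ln C) / q2); lra.
have Hvq : 1 - ln C <= q2 * v.
  have : (1 - ln C) / q2 <= v by have := Rmax_r 1 ((1 - ln C) / q2); lra.
  move/(Rmult_le_compat_l q2 _ _ (Rlt_le _ _ Hqq)).
  by have -> : q2 * ((1 - ln C) / q2) = 1 - ln C by [field; lra].
have Hlv : l <= v by have := @ln_le_sub1 v; rewrite -/l; lra.
set s := l + l2 + 2 * d.
have HsS : S <= s by rewrite /s; lra.
have Hs0 : 0 < s by rewrite /s; lra.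
have Hsl : s <= exp (d / 2) * l by rewrite /s; rewrite /q in Hlq B6; lra.
have Evl : exp (l + l2) = v * l.
  have E1 : exp l = v by rewrite /l exp_ln; lra.
  have E2 : exp l2 = l by rewrite /l2 exp_ln; lra.
  by rewrite exp_plus E1 E2.
have Ees : exp s = exp (2 * d) * (v * l) by rewrite /s Rplus_comm exp_plus Evl.
have Hes : exp d * v <= exp (- (d / 2)) * (exp s / s).
  have -> : exp (- (d / 2)) * (exp s / s) = exp (- (d / 2)) * exp s / s by rewrite /Rdiv; ring.
  apply: (proj1 (Rle_div_r _ _ _ Hs0)); rewrite Ees -!Rmult_assoc -exp_plus.
  have -> : - (d / 2) + 2 * d = d + d / 2 by field.
  rewrite exp_plus; have Hx := exp_pos d.
  have : exp d * v * s <= exp d * v * (exp (d / 2) * l) by apply: Rmult_le_compat_l => //; nra.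
  lra.
have HL : u < laplace chi s (exp (2 * s)).
  have := HS s HsS; have -> : 1 - (1 - exp (- (d / 2))) = exp (- (d / 2)) by ring.
  move=> H; apply: Rlt_le_trans H.
  rewrite -{1}(exp_ln u) -/v; last by lra.
  rewrite -{1}(exp_ln C) // -exp_plus; apply: exp_increasing.
  rewrite /q2 in Hvq; lra.
have HT1 : 1 <= exp (2 * s) by rewrite -exp_0; apply: exp_le_compat; lra.
have Hu0 : 0 <= u by lra.
have Hlow := renewal_lower_full chiN sigmaN chiB sigmaB Hren (Rlt_le _ _ Hs0) HT1 Hu0 HL.
apply: Rle_trans Hlow; apply: exp_le_compat.
suff : 6 * exp (2 * s) ^ 2 <= d * u by rewrite /s; lra.
apply: Rle_trans Hp; rewrite Rmult_0_l exp_0 Rmult_1_r.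
have -> : exp (2 * s) ^ 2 = exp s ^ 4.
  have -> : 2 * s = s + s by ring.
  by rewrite exp_plus; ring.
rewrite Ees Rpow_mult_distr.
have -> : exp (2 * d) ^ 4 = exp (8 * d) by rewrite /= !Rmult_1_r -!exp_plus; congr exp; ring.
rewrite -Rmult_assoc; apply: Rmult_le_compat_l; first by lra.
have H1 : 0 <= v * l <= (1 + v) ^ 2 by rewrite /=; nra.
have := pow_incr _ _ 4 H1 => H2; apply: Rle_trans H2 _.
by right; rewrite -pow_mult.
Qed.

Lemma decay_base : decay_rate 1 sigma.
Proof.
move=> d Hd; have Hd3 : 0 < d / 3 by lra.
apply: ev_imp (ev_and (decay_base_lower Hd3) (decay_base_upper Hd3)) => u.
by have -> : 3 * (d / 3) = d by field.
Qed.

End Step.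

Lemma sg_decay (rho : R -> R) sigma : is_dickman rho -> is_sigma_family rho sigma ->
  forall k, decay_rate k.+1 (sg sigma k.+1).
Proof.
move=> Hrho Hsig; elim=> [|k IH].
  apply: (decay_base (chi := sg sigma 0)); first [exact: (sg_normalized Hrho Hsig)|exact: (sg_bounds Hrho Hsig)|exact: (sg_renewal Hrho Hsig)|exact: (sg0_derive Hrho Hsig)].
apply: (decay_step (chi := sg sigma k.+1)) => //; first [exact: (sg_normalized Hrho Hsig)|exact: (sg_bounds Hrho Hsig)|exact: (sg_renewal Hrho Hsig)].
Qed.

(** Only the smallness of [eta] rests on the decay rate; the displayed equality is solved for [eta],
    using that [sigma k u] and the iterated logarithms are positive. *)
Lemma sigma_asymp (rho : R -> R) sigma : is_dickman rho -> is_sigma_family rho sigma ->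
  forall k : nat, (1 <= k)%N ->
  exists eta : R -> R,
    (forall delta, 0 < delta -> exists U0, forall u, U0 <= u -> Rabs (eta u) <= delta) /\
    (exists U1, forall u, U1 <= u ->
       sigma k u = Rpower ((1 + eta u) / (logk k u * logk k.+1 u)) u).
Proof.
move=> Hrho Hsig [|k] // _.
pose P u := logk k.+1 u * logk k.+2 u.
exists (fun u => Rpower (sigma k.+1 u) (1 / u) * P u - 1); split.
  (* [1 + eta u] is the exponential of a number in [[- d, d]], and
     [exp (- d) = 1 / (1 + delta) >= 1 - delta] handles the lower side. *)
  move=> delta Hdelta; pose d := ln (1 + delta).
  have Hd : 0 < d by rewrite /d -ln_1; apply: ln_increasing; lra.
  have := ev_and (sg_decay Hrho Hsig k Hd) (ev_and (ev_ge 1) (ev_and (ev_logk k.+1 1) (ev_logk k.+2 1))).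
  apply: ev_imp => u [Hr [Hu [L1 L2]]].
  rewrite (sgE Hrho Hsig) in Hr; last by lra.
  have Hpos : 0 < sigma k.+1 u.
    by have := sg_bounds Hrho Hsig k.+1 u; rewrite (sgE Hrho Hsig); lra.
  have HP : 0 < P u by rewrite /P; nra.
  have -> : Rpower (sigma k.+1 u) (1 / u) * P u = exp (ln (sigma k.+1 u) / u + gk k.+1 u).
    rewrite -{1}(exp_ln (P u)) // /Rpower -exp_plus; congr exp.
    rewrite /P ln_mult; try lra.
    by rewrite /gk /logk !iterS; field; lra.
  have Hln : - (u * (gk k.+1 u + d)) <= ln (sigma k.+1 u) <= - (u * (gk k.+1 u - d)).
    split; first by rewrite -(ln_exp (- _)); apply: ln_le; [exact: exp_pos|tauto].
    by rewrite -(ln_exp (- (u * (gk k.+1 u - d)))); apply: ln_le; tauto.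
  have Hq1 : - d <= ln (sigma k.+1 u) / u + gk k.+1 u.
    suff : - (gk k.+1 u + d) <= ln (sigma k.+1 u) / u by lra.
    by apply/Rle_div_r; lra.
  have Hq2 : ln (sigma k.+1 u) / u + gk k.+1 u <= d.
    suff : ln (sigma k.+1 u) / u <= - (gk k.+1 u - d) by lra.
    by apply/Rle_div_l; lra.
  have := exp_le_compat Hq1; have := exp_le_compat Hq2.
  have Ed : exp d = 1 + delta by rewrite /d exp_ln; lra.
  rewrite exp_Ropp Ed.
  move=> H1 H2; apply/Rabs_le; split; last by lra.
  have : 1 - delta <= / (1 + delta).
    apply: (Rmult_le_reg_r (1 + delta)); first by lra.
    by rewrite Rinv_l; nra.
  lra.
have := ev_and (ev_ge 1) (ev_and (ev_logk k.+1 1) (ev_logk k.+2 1)).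
apply: ev_imp => u [Hu [L1 L2]].
have Hpos : 0 < sigma k.+1 u.
  by have := sg_bounds Hrho Hsig k.+1 u; rewrite (sgE Hrho Hsig); lra.
have HP : 0 < P u by rewrite /P; nra.
rewrite -/(P u); have -> : (1 + (Rpower (sigma k.+1 u) (1 / u) * P u - 1)) / P u = Rpower (sigma k.+1 u) (1 / u) by field; lra.
rewrite Rpower_mult; have -> : 1 / u * u = 1 by field; lra.
by rewrite Rpower_1.
Qed.

Theorem theorem2 :
  EH_hypothesis ->
  forall (rho : R -> R) (sigma : nat -> R -> R),
    is_dickman rho -> is_sigma_family rho sigma ->
  (* Phi_k(x, x^(1/u)) ~ x sigma_k(u), uniformly for 1 <= u <= U *)
  (forall U, 1 < U -> forall k : nat,
     forall eps, 0 < eps ->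
     exists X, forall x, X <= x -> forall u, 1 <= u <= U ->
       Rabs (Phi_count k x (Rpower x (1 / u)) - x * sigma k u)
         <= eps * (x * sigma k u)) /\
  (* sigma_k(u) = ((1+o(1)) / (log_k u * log_{k+1} u))^u as u -> oo, k >= 1 *)
  (forall k : nat, (1 <= k)%nat ->
     exists eta : R -> R,
       (forall delta, 0 < delta -> exists U0, forall u, U0 <= u -> Rabs (eta u) <= delta) /\
       (exists U1, forall u, U1 <= u ->
          sigma k u = Rpower ((1 + eta u) / (logk k u * logk k.+1 u)) u)).
Proof.
move=> EH rho sigma Hrho Hsig; split; first exact: (Phi_count_asymp EH Hrho Hsig).
exact: (sigma_asymp Hrho Hsig).
Qed.
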